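(* Given a graph $G$ with $n$ vertices and $m$ edges, an integer $k$, and a block deletion set of $G$ of size $\mathrm{bd}(G)$, there is a $2$-approximation algorithm for \textsc{Densest $k$-Subgraph} that runs in time $O\big(2^{\mathrm{bd}(G)/2}((k^3+\mathrm{bd}(G))n+m)\big)$.
   Context: All graphs are finite, simple and undirected. \textsc{Densest $k$-Subgraph}: given $G=(V,E)$ and $k$, find $S\subseteq V$, $|S|=k$, maximizing the number of edges of $G[S]$. A $2$-approximation algorithm outputs $S$ with $|S|=k$ such that $G[S]$ has at least half the optimal number of edges. A block graph is a graph in which every block (maximal connected subgraph without a cut vertex) is a clique. A block deletion set is a set $D\subseteq V$ such that $G[V\setminus D]$ is a block graph; $\mathrm{bd}(G)$ is the minimum size of such a set. *)

(* Defs.v *)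
From HB Require Import structures.
From mathcomp Require Import all_boot all_order all_algebra.
From mathcomp Require Import boolp reals exp.

Set Implicit Arguments.
Unset Strict Implicit.
Unset Printing Implicit Defensive.

(** * Graphs *)

(** A simple graph whose vertices form a subset of the finite type [T]. *)
Record sgraph (T : finType) := SGraph {
  verts : {set T};
  edge : rel T;
  edge_sym : symmetric edge;
  edge_irr : irreflexive edge;
  edge_verts : forall x y, edge x y -> x \in verts
}.

Section Graphs.
Variable T : finType.
Implicit Types (G H K : sgraph T) (D S U : {set T}) (v x y : T).

Definition edges G : {set {set T}} :=
  [set [set p.1; p.2] | p in [pred p : T * T | edge G p.1 p.2]].

Definition induced_edge G U : rel T :=
  fun x y => [&& x \in U, y \in U & edge G x y].

Lemma induced_edge_sym G U : symmetric (induced_edge G U).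
Proof. by move=> x y; rewrite /induced_edge edge_sym andbCA. Qed.

Lemma induced_edge_irr G U : irreflexive (induced_edge G U).
Proof. by move=> x; rewrite /induced_edge edge_irr !andbF. Qed.

Lemma induced_edge_verts G U x y :
  induced_edge G U x y -> x \in verts G :&: U.
Proof. by case/and3P=> xU _ /edge_verts xG; rewrite inE xG xU. Qed.

Definition induced G U : sgraph T :=
  SGraph (@induced_edge_sym G U) (@induced_edge_irr G U)
         (@induced_edge_verts G U).

Definition subgraph H K : Prop :=
  verts H \subset verts K /\ subrel (edge H) (edge K).

Definition connected_graph H : Prop :=
  verts H != set0 /\ {in verts H &, forall x y, connect (edge H) x y}.

(** [v] separates two other vertices of one component of [H]. *)
Definition cut_vertex H v : Prop :=
  exists x y, [/\ [/\ v \in verts H, x \in verts H :\ v & y \in verts H :\ v],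
    connect (edge H) x y & ~~ connect (edge (induced H (verts H :\ v))) x y].

Definition connected_no_cut_vertex H : Prop :=
  connected_graph H /\ forall v, ~ cut_vertex H v.

(** Subgraphs are not required to be induced, and "without a cut vertex"
    refers to cut vertices of the subgraph itself. *)
Definition block K H : Prop :=
  [/\ subgraph H K, connected_no_cut_vertex H &
      forall H', subgraph H' K -> connected_no_cut_vertex H' ->
        subgraph H H' -> subgraph H' H].

Definition clique_graph H : Prop :=
  {in verts H &, forall x y, x != y -> edge H x y}.

Definition block_graph G : Prop := forall H, block G H -> clique_graph H.

Definition block_deletion_set G D : Prop :=
  D \subset verts G /\ block_graph (induced G (verts G :\: D)).

(** The default value [#|verts G|] is the size of the trivial block deletion
    set [verts G]. *)
Definition bd G : nat :=
  \big[minn/#|verts G|]_(D : {set T} | `[< block_deletion_set G D >]) #|D|.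

Definition densest_opt G (k : nat) : nat :=
  \max_(S : {set T} | (S \subset verts G) && (#|S| == k))
    #|edges (induced G S)|.

Definition densest_2approx G (k : nat) S : Prop :=
  [/\ S \subset verts G, #|S| = k &
      densest_opt G k <= 2 * #|edges (induced G S)|].

End Graphs.

(** * Random access machine

    Programs are finite texts over natural-number variables and arrays, hence
    use a fixed number of registers and of random-access memory banks.  Cells
    hold words smaller than a bound [W] that programs cannot inspect; an
    operation whose operand, address or result does not fit in a word has no
    execution at all, so that big numbers cannot be used to save time.  Every
    elementary operation costs one unit of time. *)

Inductive binop := Add | Sub | Mul | Div | Mod | Leq | Eqb.

Inductive expr :=
  | Const of nat
  | Var of nat
  | Get of nat & expr (* [Get a i]: cell [i] of array [a] *)
  | Bin of binop & expr & expr.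

Inductive cmd :=
  | Skip
  | Assign of nat & expr
  | Put of nat & expr & expr (* [Put a i e]: cell [i] of array [a] gets [e] *)
  | Seq of cmd & cmd
  | If of expr & cmd & cmd
  | While of expr & cmd.

Record state := State { var : nat -> nat; arr : nat -> nat -> nat }.

Definition set_var (s : state) (x v : nat) : state :=
  State (fun y => if y == x then v else var s y) (arr s).

Definition set_arr (s : state) (a i v : nat) : state :=
  State (var s)
    (fun b j => if (b == a) && (j == i) then v else arr s b j).

Definition binop_eval (o : binop) (m n : nat) : nat :=
  match o with
  | Add => m + n
  | Sub => m - n
  | Mul => m * n
  | Div => m %/ n
  | Mod => m %% n
  | Leq => m <= n
  | Eqb => m == n
  end.

Fixpoint eval (s : state) (e : expr) : nat :=
  match e with
  | Const c => c
  | Var x => var s x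
  | Get a i => arr s a (eval s i)
  | Bin o e1 e2 => binop_eval o (eval s e1) (eval s e2)
  end.

Fixpoint fits (W : nat) (s : state) (e : expr) : bool :=
  (eval s e < W) &&
  match e with
  | Get _ i => fits W s i
  | Bin _ e1 e2 => fits W s e1 && fits W s e2
  | _ => true
  end.

Fixpoint esize (e : expr) : nat :=
  match e with
  | Get _ i => (esize i).+1
  | Bin _ e1 e2 => (esize e1 + esize e2).+1
  | _ => 1
  end.

(** [exec W p s s' t]: with word bound [W], program [p] started in state [s]
    halts in state [s'] after [t] units of time.  Nonzero means true. *)
Inductive exec (W : nat) : cmd -> state -> state -> nat -> Prop :=
  | ExecSkip s : exec W Skip s s 1
  | ExecAssign s x e : fits W s e ->
      exec W (Assign x e) s (set_var s x (eval s e)) (esize e).+1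
  | ExecPut s a i e : fits W s i -> fits W s e ->
      exec W (Put a i e) s (set_arr s a (eval s i) (eval s e))
        (esize i + esize e).+1
  | ExecSeq p q s1 s2 s3 t u : exec W p s1 s2 t -> exec W q s2 s3 u ->
      exec W (Seq p q) s1 s3 (t + u)
  | ExecIfTrue e p q s s' t : fits W s e -> eval s e != 0 ->
      exec W p s s' t -> exec W (If e p q) s s' (esize e + t).+1
  | ExecIfFalse e p q s s' t : fits W s e -> eval s e = 0 ->
      exec W q s s' t -> exec W (If e p q) s s' (esize e + t).+1
  | ExecWhileTrue e p s1 s2 s3 t u : fits W s1 e -> eval s1 e != 0 ->
      exec W p s1 s2 t -> exec W (While e p) s2 s3 u ->
      exec W (While e p) s1 s3 (esize e + t + u).+1
  | ExecWhileFalse e p s : fits W s e -> eval s e = 0 ->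
      exec W (While e p) s s (esize e).+1.

(** * Input and output conventions *)

(** Adjacency lists are given in an arbitrary order. *)
Definition adjacency_lists (n : nat) (G : sgraph 'I_n)
    (adj : 'I_n -> seq 'I_n) : Prop :=
  forall v, uniq (adj v) /\ adj v =i [pred w | edge G v w].

(** Variables 0 to 3 hold the numbers of vertices and edges, [k], and the size
    of the deletion set.  Array 1 is the concatenation of the adjacency lists,
    that of [v] occupying the cells from [off v] (included) to [off v.+1]
    (excluded), where [off] is array 0.  Array 2 lists the deletion set.  All
    other variables and cells are zero. *)
Definition input_state (n : nat) (G : sgraph 'I_n) (k : nat)
    (adj : 'I_n -> seq 'I_n) (ds : seq 'I_n) : state :=
  let degs := [seq size (adj v) | v <- enum 'I_n] in
  let off := [seq sumn (take i degs) | i <- iota 0 n.+1] in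
  let nbrs := flatten [seq map val (adj v) | v <- enum 'I_n] in
  State (nth 0 [:: n; #|edges G|; k; size ds])
    (fun a => nth 0 (nth [::] [:: off; nbrs; map val ds] a)).

(** The first [k] cells of array 3 list the elements of [S], once each. *)
Definition outputs (n : nat) (s : state) (k : nat) (S : {set 'I_n}) : Prop :=
  perm_eq (mkseq (arr s 3) k) [seq val v | v <- enum S].

(* Main.v *)
(** List the deletion set D first and then the other vertices in the order of a
    graph search.  In the block graph G - D two earlier neighbours of a vertex v
    lie with v on a cycle, hence in a common clique.  Therefore, if u is the
    last earlier neighbour of v in G - D, the set of these neighbours is either
    {u}, or {u} together with the earlier neighbours of u in G - D.  Maximizing
    over the vertex sets of given size the number of edges of G - D plus a sum
    of vertex weights is thus a knapsack problem on the forest v -> u, where a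
    state only records whether u is chosen and how many earlier neighbours of u
    are.  This takes O(k^3) steps per vertex.

    Split D into halves D1 and D2.  For i = 1, 2, trying the 2^|Di| possible
    traces on Di of the solution reduces to that problem the maximization of
    the number of edges whose lower end is in Di or outside D.  The two numbers
    of edges add up to at least the number of all edges, so that the better of
    the two solutions is a 2-approximation. *)

Require Import Defs.
From HB Require Import structures.
From mathcomp Require Import all_boot all_order all_algebra.
From mathcomp Require Import boolp reals exp zify.

Set Implicit Arguments.
Unset Strict Implicit.
Unset Printing Implicit Defensive.

(** * Block graphs *)

(** Why half of [D] suffices per guess: an edge whose lower end lies in the guessed half adds a
    known weight to its upper end, an edge of [G - D] is covered by the recursion along the forest,
    and all other edges are ignored. A vertex of the other half is then merely a weighted child of a
    dummy root, to be chosen or not at will. What is ignored only lowers the count, so the count of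
    a solution never exceeds its true number of edges.

    The factor [k^3]: a node has [2 (k + 1)] states and [k + 1] sizes, and merging it into its
    predecessor tries O(k) splits per entry. Counts of earlier neighbours are truncated at [k]; this
    loses nothing, because a set of at most [k] vertices cannot exceed it.

    The machine stops when a value does not fit in a word. Only stored values are therefore bounded,
    by [M = (n + 2) ^ 4], while words go up to [M ^ 40]: intermediate results of expressions of size
    at most 40 then fit automatically. *)

Section Blocks.
Variable T : finType.
Implicit Types (G H K : sgraph T) (A U : {set T}) (u v w x y z : T).

Lemma subgraph_trans H1 H2 H3 : subgraph H1 H2 -> subgraph H2 H3 -> subgraph H1 H3.
Proof.
move=> [V12 E12] [V23 E23]; split; first exact: subset_trans V23.
by move=> x y /E12/E23.
Qed.

(** Among the subgraphs without cut vertex above [H], one with the most vertices plus ordered edge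
    pairs is maximal for [subgraph]: a larger one cannot decrease either number, and if neither
    grows both sets are equal. *)
Lemma exists_block K H :
  subgraph H K -> connected_no_cut_vertex H ->
  exists2 B, block K B & subgraph H B.
Proof.
pose good H' := [/\ subgraph H' K, connected_no_cut_vertex H' & subgraph H H'].
pose E H' := [set p : T * T | edge H' p.1 p.2].
pose size_of H' := #|verts H'| + #|E H'|.
have mono H1 H2 : subgraph H1 H2 -> #|verts H1| <= #|verts H2| /\ #|E H1| <= #|E H2|.
  move=> [V12 E12]; split; first exact: subset_leq_card.
  by apply: subset_leq_card; apply/subsetP=> -[x y]; rewrite !inE; apply: E12.
move=> HK cH; have : exists2 B, good B & forall B', good B' -> size_of B' <= size_of B.
  have gH : good H by split=> //; split.
  have [m] := ubnP (size_of K - size_of H).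
  elim: m => // m IH in (X := H) gH *; rewrite ltnS => le_m.
  case: (pselect (exists2 B, good B & size_of X < size_of B)) => [[B gB ltB]|maxX].
    apply: (IH B gB); case: gB => [BK _ _]; have := mono _ _ BK.
    by rewrite /size_of in ltB le_m * => -[]; lia.
  exists X => // B gB; rewrite leqNgt; apply/negP=> ltB; apply: maxX.
  by exists B.
case=> B [BK cB HB] maxB; exists B => //; split=> // H' H'K cH' BH'.
have gH' : good H' by split=> //; apply: subgraph_trans BH'.
have := maxB _ gH'; have [leV leE] := mono _ _ BH'; rewrite /size_of => le.
case: BH' => V E'; have /eqP eqV : verts B == verts H' by rewrite eqEcard V; lia.
have /eqP/setP eqE : E B == E H'.
  by rewrite eqEcard; apply/andP; split; [apply/subsetP=> -[x y]; rewrite !inE; apply: E' | lia].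
by split; [rewrite eqV | move=> x y; have := eqE (x, y); rewrite !inE => ->].
Qed.

Lemma connect_path H A x p y :
  path (edge H) x p -> {subset x :: p <= A} -> y \in x :: p ->
  connect (induced_edge H A) x y.
Proof.
move=> xp sA; apply: path_connect.
apply: (@sub_in_path _ [in A] (edge H)) xp; last by apply/allP.
by move=> a b aA bA /= ab; rewrite /induced_edge; apply/and3P.
Qed.

Lemma induced_connect_sym H A : connect_sym (induced_edge H A).
Proof. exact: (sym_connect_sym (@induced_edge_sym _ H A)). Qed.

(** A cycle minus a vertex is still a path, and the chords kept by [induced] only help. For empty
    [p] the cycle degenerates to the edge [u v], which is covered as well. *)
Lemma cycle_no_cut_vertex H u v p :
  edge H u v -> edge H u (last v p) -> path (edge H) v p ->
  uniq (u :: v :: p) ->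
  connected_no_cut_vertex (induced H [set x in u :: v :: p]).
Proof.
move=> uv uz vp /andP[uc Uc]; set c := v :: p in uc Uc *; set C := [set x in u :: c].
have inC x : (x \in C) = (x == u) || (x \in c) by rewrite inE in_cons.
have CE : verts (induced H C) = C.
  apply/setP=> x; rewrite /= inE andbC; case xC: (x \in C) => //=.
  move: xC; rewrite inC => /orP[/eqP ->|]; first exact: edge_verts uv.
  rewrite inE => /orP[/eqP ->|xp]; first by rewrite edge_sym in uv; exact: edge_verts uv.
  have : x \in rcons (belast v p) (last v p) by rewrite -lastI inE xp orbT.
  rewrite mem_rcons inE => /orP[/eqP ->|].
    by rewrite edge_sym in uz; exact: edge_verts uz.
  case/splitPr: (xp) vp => p1 p2 ; rewrite cat_path /= => /and3P[_ e _] _.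
  by rewrite edge_sym in e; exact: edge_verts e.
have fromv A x : {subset c <= A} -> x \in c -> connect (induced_edge H A) v x.
  by move=> cA xc; apply: connect_path xc.
split; first split.
- by apply/set0Pn; exists u; rewrite CE inC eqxx.
- have uC x : x \in C -> connect (induced_edge H C) u x.
    rewrite inC => /orP[/eqP -> //|xc].
    apply: (@connect_trans _ _ v); last first.
      by apply: fromv => // y yc; rewrite inC yc orbT.
    by apply: connect1; rewrite /induced_edge !inC eqxx uv mem_head orbT.
  move=> x y xV yV; rewrite CE in xV yV; move: (uC _ xV) (uC _ yV) => ux uy.
  by apply: connect_trans uy; rewrite induced_connect_sym.
move=> w [x [y [[wC xC yC] _ /negP]]]; apply; rewrite CE in wC xC yC *.
set R := edge _; have RE : R =2 induced_edge H (C :\ w).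
  move=> a b; rewrite /R /= /induced_edge.
  case aC: (a \in C :\ w) => //=; case bC: (b \in C :\ w) => //=.
  by case/setD1P: aC; case/setD1P: bC; rewrite /induced_edge => _ -> _ ->.
rewrite (eq_connect RE); set A := C :\ w in xC yC *.
(* The centre [a] is [v] if [u] is removed. Otherwise it is [u]: the part of the cycle before [w] is
   reached forwards, and the part after [w] backwards through the closing edge. *)
suff [a aA] : exists a, forall x, x \in A -> connect (induced_edge H A) a x.
  apply: (@connect_trans _ _ a); last exact: aA.
  rewrite induced_connect_sym; exact: aA.
have inA t : (t \in A) = (t != w) && ((t == u) || (t \in c)).
  by rewrite -inC; apply/setD1P/andP.
have [wu|wu] := eqVneq w u.
  exists v => t; rewrite inA wu; case: eqP => //= _ tc.
  by apply: fromv tc => b bc; rewrite inA bc orbT wu andbT; apply: contraNneq uc => <-.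
have wc : w \in c by move: wC; rewrite inC (negPf wu).
exists u => t; rewrite inA => /andP[tw /orP[/eqP -> //|]].
have Auc b : b \in c -> b != w -> b \in A by move=> bc bw; rewrite inA bw bc orbT.
have Au : u \in A by rewrite inA eq_sym wu eqxx.
have uvp : path (edge H) u c by rewrite /= uv.
have uz' : edge H u (last u c) by [].
have {}Uc : uniq c by exact: Uc.
case/splitPr: wc uvp uz' Uc Auc => c1 c2.
rewrite cat_path last_cat cat_uniq => /and3P[uc1 _ wc2] uz' /and3P[_ + /andP[wc2' _]] Auc.
rewrite /= negb_or => /andP[wc1 _].
rewrite mem_cat inE (negPf tw) /= => /orP[tc|tc].
  apply: (connect_path uc1); last by rewrite inE tc orbT.
  move=> b; rewrite inE => /orP[/eqP -> //|bc]; apply: Auc; first by rewrite mem_cat bc.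
  by apply: contraNneq wc1 => <-.
case: c2 tc wc2 uz' wc2' Auc => // x2 p2 tc /andP[_ x2p2] uz' wc2 Auc.
have sA : {subset x2 :: p2 <= A}.
  move=> b bc; apply: Auc; first by rewrite mem_cat inE bc !orbT.
  by apply: contraNneq wc2 => <-.
apply: (@connect_trans _ _ (last x2 p2)).
  by apply: connect1; apply/and3P; split=> //; apply/sA/mem_last.
apply: (@connect_trans _ _ x2); last exact: connect_path tc.
by rewrite induced_connect_sym; apply: connect_path (mem_last _ _).
Qed.

(** A path from [v] to [z] avoiding [u] closes with [u] to a cycle. The block around this cycle is a
    clique, so it contains the chord [v z]. *)
Lemma block_graph_triangle H u v z :
  block_graph H -> edge H u v -> edge H u z -> v != z ->
  connect (induced_edge H [set~ u]) v z -> edge H v z.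
Proof.
move=> bH uv uz vz /connectP[p0 p0P zE]; case: (shortenP p0P) zE => p pP Up _ zE {p0 p0P}.
have vu : v != u by apply/eqP=> vu; rewrite vu edge_irr in uv.
have up : u \notin v :: p.
  have : all [in [set~ u]] (v :: p).
    rewrite /= inE in_set1 vu /=.
    elim: p (v) pP {Up zE vz uv vu} => //= a p IH b /andP[/and3P[_ -> _]] /IH //.
  by move=> h; apply/negP => /(allP h); rewrite !inE eqxx.
have vp : path (edge H) v p by apply: sub_path pP => a b /and3P[].
rewrite zE in uz vz *.
have cC := cycle_no_cut_vertex uv uz vp (introT andP (conj up Up)).
have sH : subgraph (induced H [set x in [:: u, v & p]]) H.
  by split; [apply: subsetIl | move=> a b /and3P[]].
have [] := exists_block sH cC; move=> B bB [VB EB]; have clB := bH _ bB; case: bB => -[_ sBE] _ _.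
apply/sBE/clB => //; apply: (subsetP VB); apply/setIP; split.
- by rewrite edge_sym in uv; apply: edge_verts uv.
- by rewrite !inE eqxx orbT.
- by rewrite edge_sym in uz; apply: edge_verts uz.
- by rewrite inE in_cons mem_last orbT.
Qed.

End Blocks.

(** * Earlier neighbours in a search order of a block graph *)

Section SearchOrder.
Variables (T : finType) (H : sgraph T) (pos : T -> nat).
Hypothesis pos_inj : injective pos.
Hypothesis bH : block_graph H.

Definition search_order : Prop := forall w x y,
  edge H w x -> edge H w y -> pos x < pos w -> pos y < pos w ->
  connect (induced_edge H [set z | pos z < pos w]) x y.

Hypothesis sH : search_order.

Lemma earlier_clique w x y :
  edge H w x -> edge H w y -> pos x < pos w -> pos y < pos w -> x != y ->
  edge H x y.
Proof.
move=> wx wy xw yw xy; apply: (block_graph_triangle bH wx wy xy).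
apply: connect_sub (sH wx wy xw yw) => a b /and3P[aw bw ab].
rewrite !inE in aw bw; apply: connect1; rewrite /induced_edge ab andbT !inE.
by apply/andP; split; [apply: contraTneq aw | apply: contraTneq bw] => ->; rewrite ltnn.
Qed.

(** Earlier neighbours of [w] form a clique with last element [u], which gives one direction.
    Conversely, an earlier neighbour [y] of [u] is adjacent to [x], so [w], [x], [y] is a path
    avoiding [u] between two neighbours of [u]. The second neighbour [x] is what ties the block of
    [w] and [u] to the earlier neighbours of [u]. *)
Lemma earlier_last w u x y :
  edge H w u -> pos u < pos w ->
  edge H w x -> pos x < pos w -> x != u ->
  (forall z, edge H w z -> pos z < pos w -> pos z <= pos u) ->
  y != u ->
  edge H w y && (pos y < pos w) = edge H u y && (pos y < pos u).
Proof.
move=> wu uw wx xw xu maxu.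
have sub z : z != u -> edge H w z -> pos z < pos w -> edge H u z && (pos z < pos u).
  move=> zu wz zw; rewrite (earlier_clique wu wz) //= 1?eq_sym // ltn_neqAle maxu // andbT.
  by apply: contraNneq zu => /pos_inj ->.
move=> yu; apply/andP/andP=> [[wy yw]|[uy yltu]]; first by apply/andP/sub.
have yw : pos y < pos w by apply: leq_trans uw; apply: leq_trans (leqnSn _).
have [<- //|xy] := eqVneq x y.
have /andP[ux xltu] := sub _ xu wx xw.
have exy : edge H x y by apply: (earlier_clique ux uy).
split=> //; apply: (block_graph_triangle bH (u := u)) => //; first by rewrite edge_sym.
  by apply: contraTneq yw => ->; rewrite ltnn.
have wneu : w != u by apply: contraTneq uw => ->; rewrite ltnn.
apply: (@connect_trans _ _ x); apply: connect1; rewrite /induced_edge !inE.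
  by rewrite wneu xu.
by rewrite xu yu.
Qed.

End SearchOrder.

(** * Counting chosen earlier neighbours by recursion *)

Section Counting.
Variables (n : nat) (N : rel nat).
Hypothesis N_lt : forall i y, N i y -> y < i.
Hypothesis N_last : forall i u x y, N i u -> N i x -> x != u ->
  (forall z, N i z -> z <= u) -> y != u -> N i y = N u y.

Definition count_earlier (S : nat -> bool) i := \sum_(y < n.+1 | N i y) S y.
Definition last_earlier i := \max_(y < n.+1 | N i y) y.

(** Position [0] belongs to no vertex. As the value of an empty maximum it stands for a missing
    earlier neighbour, and [S 0 = false] makes it contribute nothing. With a single earlier
    neighbour the factor [1 < ...] switches the recursion off; with more, [N_last] identifies the
    others with the earlier neighbours of the last one. *)
Lemma count_earlier_rec (S : nat -> bool) i :
  S 0 = false -> i <= n ->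
  count_earlier S i = S (last_earlier i) +
    (1 < count_earlier (fun=> true) i) * count_earlier S (last_earlier i).
Proof.
move=> S0 le_i; case: (pickP (fun y : 'I_n.+1 => N i y)) => [y0 y0P|none]; last first.
  have E0 : last_earlier i = 0 by apply: big_pred0.
  have E1 S' : count_earlier S' i = 0 by apply: big_pred0.
  by rewrite E0 !E1 S0.
have [] := @eq_bigmax_cond _ (fun y : 'I_n.+1 => N i y) (@nat_of_ord _).
  by apply/card_gt0P; exists y0.
move=> u Nu maxu; rewrite -[LHS]/(\sum_(y < n.+1 | N i y) S y).
have leu (z : 'I_n.+1) : N i z -> z <= u.
  by move=> Nz; rewrite -maxu; apply: (leq_bigmax_cond (F := @nat_of_ord n.+1)).
have leu' z : N i z -> z <= u.
  move=> Nz; have ltz : z < n.+1 by have := N_lt Nz; lia.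
  exact: (leu (Ordinal ltz)).
rewrite {1}/last_earlier maxu (bigD1 u) //=; congr (_ + _).
have -> : count_earlier (fun=> true) i = (\sum_(y < n.+1 | N i y && (y != u)) 1).+1.
  by rewrite /count_earlier (bigD1 u).
rewrite ltnS.
case: (pickP (fun y : 'I_n.+1 => N i y && (y != u))) => [x /andP[Nx xu]|none]; last first.
  by rewrite !(big_pred0 _ _ _ _ none).
have -> : 0 < \sum_(y < n.+1 | N i y && (y != u)) 1.
  by rewrite (bigD1 x) //= Nx xu.
rewrite mul1n /last_earlier maxu; apply: eq_bigl => y.
have [->|yu] := eqVneq y u; rewrite ?andbF ?andbT.
  by apply/esym/negP=> /N_lt; rewrite ltnn.
by apply: N_last Nu Nx _ _ _ => //; exact: leu'.
Qed.

End Counting.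

(** * Counting edges along an enumeration of the vertices *)

(** Each unordered edge is the image of exactly one ordered pair, the one that lists its upper end
    first. *)
Lemma card_edges (T : finType) (H : sgraph T) (pos : T -> nat) :
  injective pos ->
  #|edges H| = \sum_(x : T) \sum_(y : T) (edge H x y && (pos y < pos x)).
Proof.
move=> pos_inj; rewrite pair_bigA /=.
pose Lo := [set p : T * T | edge H p.1 p.2 && (pos p.2 < pos p.1)].
have -> : \sum_p (edge H p.1 p.2 && (pos p.2 < pos p.1)) = #|Lo|.
  rewrite -sum1_card [RHS]big_mkcond; apply: eq_bigr => p _.
  by rewrite inE; case: (_ && _).
have -> : edges H = [set [set p.1; p.2] | p in Lo].
  apply/setP=> e; apply/imsetP/imsetP => -[[x y]]; rewrite inE /=.
    move=> xy ->; case: (ltngtP (pos y) (pos x)) => [lt|gt|/pos_inj eq].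
    - by exists (x, y); rewrite ?inE /= ?xy.
    - by exists (y, x); rewrite ?inE /= 1?edge_sym ?xy // setUC.
    - by rewrite eq edge_irr in xy.
  by case/andP=> xy _ ->; exists (x, y).
apply: card_in_imset => -[x y] [x' y']; rewrite !inE /= => /andP[_ lt] /andP[_ lt'] eq.
have : x \in [set x'; y'] by rewrite -eq set21.
have : y \in [set x'; y'] by rewrite -eq set22.
rewrite !inE => /orP[]/eqP ey /orP[]/eqP ex; subst => //.
- by rewrite ltnn in lt.
- by have := ltn_trans lt lt'; rewrite ltnn.
- by rewrite ltnn in lt.
Qed.

Section Positions.
Variables (n : nat) (os : seq 'I_n).
Hypothesis os_uniq : uniq os.
Hypothesis os_full : forall v, v \in os.
Implicit Types (G H : sgraph 'I_n) (u v w : 'I_n).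

Definition position v := (index v os).+1.

Lemma size_os : size os = n.
Proof.
by rewrite -(card_uniqP os_uniq) -[RHS]card_ord; apply: eq_card => v; rewrite os_full.
Qed.

Lemma position_inj : injective position.
Proof. by move=> u v [/index_inj]; apply. Qed.

Lemma position_le v : position v <= n.
Proof. by rewrite /position -[X in _ <= X]size_os index_mem os_full. Qed.

Lemma position_surj i : 0 < i <= n -> exists v, i = position v.
Proof.
case: i => // i /= lt_i; have v0 : 'I_n by exists i.
by exists (nth v0 os i); rewrite /position index_uniq // size_os.
Qed.

(** The arrays of the program are indexed by positions, so adjacency is carried over to natural
    numbers; it is false outside [1], ..., [n]. *)
Definition padj H i j : bool :=
  [exists u, exists v, [&& edge H u v, position u == i & position v == j]].

Lemma padjP H u v : padj H (position u) (position v) = edge H u v.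
Proof.
apply/existsP/idP => [[u' /existsP[v' /and3P[e /eqP/position_inj <- /eqP/position_inj <-]]] //|e].
by exists u; apply/existsP; exists v; rewrite e !eqxx.
Qed.

Lemma padj_pos H i j : padj H i j -> [/\ 0 < i <= n, 0 < j <= n & exists u v,
  [/\ i = position u, j = position v & edge H u v]].
Proof.
case/existsP=> u /existsP[v /and3P[e /eqP <- /eqP <-]]; rewrite !position_le.
by split=> //; exists u, v.
Qed.

Lemma big_position R (idx : R) (op : Monoid.com_law idx) (F : nat -> R) :
  F 0 = idx ->
  \big[op/idx]_(v : 'I_n) F (position v) = \big[op/idx]_(i < n.+1) F i.
Proof.
move=> F0; rewrite big_ord_recl F0 Monoid.mul1m.
have -> : \big[op/idx]_(v : 'I_n) F (position v) = \big[op/idx]_(v <- os) F (position v).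
  rewrite -big_enum /=; apply: perm_big; apply: uniq_perm => //; first exact: enum_uniq.
  by move=> v; rewrite mem_enum os_full.
rewrite -(big_mkord xpredT (fun i => F i.+1)) -[X in \big[_/_]_(0 <= _ < X) _]size_os.
case: (pickP (fun v : 'I_n => true)) => [v0 _|none]; last first.
  by case E: os => [|v ?]; rewrite ?big_nil ?big_geq //; have := none v.
rewrite (big_nth v0) big_nat_cond [RHS]big_nat_cond; apply: eq_bigr => i /andP[/andP[_ lt] _].
by rewrite /position index_uniq.
Qed.

(** Links what the program computes along an adjacency list to the sums over positions of the
    analysis. A general monoid is used since sums and maxima are both needed. *)
Lemma big_neighbours R (idx : R) (op : Monoid.com_law idx) H
    (adj : 'I_n -> seq 'I_n) v (P : pred nat) (F : nat -> R) :
  adjacency_lists H adj ->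
  \big[op/idx]_(w <- adj v | P (position w)) F (position w) =
  \big[op/idx]_(j < n.+1 | padj H (position v) j && P j) F j.
Proof.
case/(_ v) => Ua aE; rewrite big_mkcond big_uniq //= big_mkcond [RHS]big_mkcond /=.
rewrite -(@big_position _ _ _ (fun j => if padj H (position v) j && P j then F j else idx) _).
  by apply: eq_bigr => w _; rewrite padjP aE inE; case: edge.
by case: ifP => // /andP[/padj_pos[]].
Qed.

(* Each edge of the set [S] of positions is counted at its upper end. *)
Definition edges_in H (S : nat -> bool) :=
  \sum_(i < n.+1) \sum_(j < n.+1 | padj H i j && (j < i)) (S i && S j).

Lemma card_edges_induced H (U : {set 'I_n}) :
  #|edges (induced H U)| = edges_in H (fun i => [exists v in U, position v == i]).
Proof.
rewrite (card_edges (induced H U) position_inj) /edges_in.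
pose I i := [exists v in U, position v == i].
rewrite -(@big_position _ _ _ (fun i => \sum_(j < n.+1 | padj H i j && (j < i)) (I i && I j)) _); last first.
  by rewrite big_pred0 // => j; rewrite ltn0 andbF.
have inU v : I (position v) = (v \in U).
  apply/existsP/idP => [[w /andP[wU /eqP/position_inj <-]] //|vU].
  by exists v; rewrite vU eqxx.
apply: eq_bigr => u _; rewrite [RHS]big_mkcond /=.
rewrite -(@big_position _ _ _ (fun j => if padj H (position u) j && (j < position u) then
   nat_of_bool (I (position u) && I j) else 0) _).
  apply: eq_bigr => v _; rewrite padjP !inU /induced_edge.
  by case: (u \in U); case: (v \in U); case: edge => //=; case: (_ < _).
by case: ifP => // /andP[/padj_pos[_]].
Qed.

Lemma sum_degrees H (adj : 'I_n -> seq 'I_n) :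
  adjacency_lists H adj -> \sum_(v : 'I_n) size (adj v) = 2 * #|edges H|.
Proof.
move=> aH; rewrite (card_edges H (pos := val)); last exact: val_inj.
rewrite mul2n -addnn {2}exchange_big /= -big_split /=; apply: eq_bigr => v _.
have [Ua aE] := aH v; rewrite -big_split /= -sum1_size big_uniq //= big_mkcond /=.
apply: eq_bigr => w _; rewrite aE inE [edge H w v]edge_sym.
case: ltngtP => [_|_|/val_inj ->]; rewrite ?edge_irr //; by case: edge.
Qed.

End Positions.

(** * Vertex sequences built by a graph search *)

Section SearchSeq.
Variables (T : finType) (H : sgraph T).
Implicit Types (s : seq T) (v w x y z : T).

Definition connected_in s x y : bool := connect (induced_edge H [set z in s]) x y.

(* The first [c] vertices form a union of components, and the remaining ones
   are a connected part of a further component. *)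
Record search_seq s c : Prop := SearchSeq {
  search_closed : forall x w, x \in take c s -> edge H x w -> w \in take c s;
  search_connected : forall x y, x \in drop c s -> y \in drop c s -> connected_in s x y;
  search_earlier : forall w x y, w \in s ->
    x \in take (index w s) s -> y \in take (index w s) s ->
    edge H w x -> edge H w y -> connected_in (take (index w s) s) x y }.

Lemma connected_inW s s' x y :
  {subset s <= s'} -> connected_in s x y -> connected_in s' x y.
Proof.
move=> ss'; apply: connect_sub => a b /and3P[ia ib e]; rewrite !inE in ia ib.
by apply: connect1; apply/and3P; split; rewrite ?inE ?ss'.
Qed.

(** Completed components are closed under adjacency, so a new vertex can only be attached to the
    component under construction. *)
Lemma search_new s c w x :
  search_seq s c -> w \notin s -> x \in s -> edge H w x -> x \in drop c s.
Proof.
move=> ss ws; rewrite -{1}(cat_take_drop c s) mem_cat => /orP[xs|//].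
rewrite edge_sym => /(search_closed ss xs) /mem_take ws'.
by rewrite ws' in ws.
Qed.

Lemma search_earlier_rcons s c w : search_seq s c -> w \notin s ->
  forall v x y, v \in rcons s w ->
    x \in take (index v (rcons s w)) (rcons s w) ->
    y \in take (index v (rcons s w)) (rcons s w) ->
    edge H v x -> edge H v y ->
    connected_in (take (index v (rcons s w)) (rcons s w)) x y.
Proof.
move=> ss ws v x y; rewrite -cats1 index_cat take_cat.
case vs: (v \in s).
  by rewrite index_mem vs => _; apply: (search_earlier ss vs).
rewrite mem_cat vs inE /= => /eqP ->; rewrite eqxx addn0 ltnn subnn take0 cats0.
move=> xs ys wx wy; apply: (search_connected ss); exact: search_new wx || exact: search_new wy.
Qed.

Lemma search_seq_child s c v w :
  search_seq s c -> w \notin s -> v \in s -> edge H v w ->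
  search_seq (rcons s w) c.
Proof.
move=> ss ws vs vw; have wv : edge H w v by rewrite edge_sym.
have vd := search_new ss ws vs wv.
have le_c : c <= size s.
  by rewrite leqNgt; apply/negP=> lt; rewrite drop_oversize // ltnW in vd.
have ssub : {subset s <= rcons s w} by move=> a; rewrite mem_rcons inE => ->; rewrite orbT.
have vwc : connected_in (rcons s w) v w.
  by apply: connect1; rewrite /induced_edge !inE !mem_rcons !inE vs eqxx orbT.
have wvc : connected_in (rcons s w) w v.
  by rewrite /connected_in induced_connect_sym.
split; last exact: (search_earlier_rcons ss ws).
  move=> a b; rewrite -cats1 takel_cat //; exact: (search_closed ss).
move=> a b; rewrite -!cats1 drop_cat; case: ltngtP le_c => // [lt_c|eq_c] _; last first.
  by rewrite eq_c drop_size in vd.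
have toV t : t \in drop c s ++ [:: w] -> connected_in (rcons s w) v t /\ connected_in (rcons s w) t v.
  rewrite mem_cat inE => /orP[ts|/eqP -> //].
  by split; apply: (connected_inW ssub); apply: (search_connected ss).
move=> /toV[_ av] /toV[vb _]; rewrite cats1; exact: connect_trans av vb.
Qed.

(** Once no edge leaves [s], all of it counts as completed, and [w] alone starts the next
    component. *)
Lemma search_seq_root s c w :
  search_seq s c -> w \notin s ->
  (forall x y, x \in s -> edge H x y -> y \in s) ->
  search_seq (rcons s w) (size s).
Proof.
move=> ss ws cl; split; last exact: (search_earlier_rcons ss ws).
  by move=> a b; rewrite -cats1 takel_cat // take_size; apply: cl.
move=> a b; rewrite -!cats1 drop_size_cat // !inE => /eqP -> /eqP ->.
exact: connect0.
Qed.

(** Meant for [r] the list of deleted vertices: they have no edges in [H], so placing them first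
    only shifts the relevant indices by [size r]. *)
Lemma search_seq_order s c (r : seq T) :
  search_seq s c -> (forall v, v \in verts H -> v \in s) ->
  (forall v, v \in r -> v \notin verts H) ->
  search_order H (fun v => (index v (r ++ s)).+1).
Proof.
move=> ss all_s rH w x y wx wy.
have vE v u : edge H v u -> index v (r ++ s) = size r + index v s.
  move=> /edge_verts vH; rewrite index_cat; case: ifP => // /rH.
  by rewrite vH.
have xw : edge H x w by rewrite edge_sym.
have yw : edge H y w by rewrite edge_sym.
rewrite (vE _ _ wx) (vE _ _ xw) (vE _ _ yw) !ltnS !ltn_add2l => ltx lty.
have tk v u : edge H v u -> index v s < index w s -> v \in take (index w s) s.
  by move=> /edge_verts/all_s vs lt; rewrite in_take.
have ws : w \in s by apply/all_s/(edge_verts wx).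
have := search_earlier ss ws (tk _ _ xw ltx) (tk _ _ yw lty) wx wy.
apply: connect_sub => a b /and3P[ia ib e]; rewrite !inE in ia ib.
have e' : edge H b a by rewrite edge_sym.
apply: connect1; apply/and3P; split=> //; rewrite inE.
- by rewrite (vE _ _ e) ltnS ltn_add2l -in_take // (mem_take ia).
- by rewrite (vE _ _ e') ltnS ltn_add2l -in_take // (mem_take ib).
Qed.

End SearchSeq.

(** * The knapsack table *)

Section Table.
Variables (n k : nat) (pr : nat -> nat) (tb : nat -> bool) (w : nat -> nat).
Variable cnt : (nat -> bool) -> nat -> nat.
Variables al0 al1 : nat -> bool.
Hypothesis pr_lt : forall i, 0 < i <= n -> pr i < i.

(* The node to which [x] belongs once the nodes [n], ..., [n - z + 1] have
   been merged into their predecessors. *)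
Fixpoint anc z x :=
  if z is z'.+1 then
    if anc z' x == n - z' then pr (n - z') else anc z' x
  else x.

Definition admissible (S : nat -> bool) : Prop :=
  forall x, x <= n -> if S x then al1 x else al0 x.

Definition members z u (S : nat -> bool) := \sum_(x < n.+1 | anc z x == u) S x.

Definition gain z u (S : nat -> bool) :=
  \sum_(x < n.+1 | anc z x == u) S x * (w x + cnt S x).

(* [v] is one more than the gain of the set [l], and [0] if there is no such
   set.  The state [q = 2 a + s] tells whether [u] is chosen and how many
   earlier neighbours of [u] are.  Soundness holds whenever at least [a] of
   them are, so that [a] may be truncated to [k]. *)
Definition sound z u q j v (l : seq nat) : Prop :=
  [/\ uniq l, size l = j, forall x, x \in l -> x <= n /\ anc z x = u,
      [/\ (u \in l) = odd q &
      forall x, x <= n -> anc z x = u -> if x \in l then al1 x else al0 x] &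
      forall S, S 0 = false ->
        (forall x, x <= n -> anc z x = u -> S x = (x \in l)) ->
        q./2 <= cnt S u -> v.-1 <= gain z u S].

(** Unlike in [sound], the count is exact: with at most [k] chosen vertices it never reaches the
    range where truncation matters. The inequality is strict because [v] is shifted by one, which
    also forces [v] to be nonzero if such a set exists. *)
Definition complete z u q j v : Prop :=
  forall S, admissible S -> \sum_(x < n.+1) S x <= k -> S u = odd q ->
    cnt S u = q./2 -> members z u S = j -> gain z u S < v.

(** The bound on [v] keeps the table within words: each of the [j] vertices gains at most [n] from
    its weight and at most [n] from its earlier neighbours. *)
Definition entry_ok z u q j v l : Prop :=
  [/\ v <= 2 * n * j + 1, v != 0 -> sound z u q j v l & complete z u q j v].

Lemma anc_live z x : z <= n -> x <= n - z -> anc z x = x.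
Proof.
elim: z => //= z IH lt_z le_x; rewrite IH; [|lia|lia].
by case: eqP => //; lia.
Qed.

Lemma anc_le z x : z <= n -> x <= n -> anc z x <= n - z.
Proof.
elim: z => [|z IH] lt_z le_x /=; first by rewrite subn0.
have := IH (ltnW lt_z) le_x; case: eqP => [->|]; last by lia.
have := @pr_lt (n - z); lia.
Qed.

Lemma anc_step z x u : z < n -> u < n - z ->
  (anc z.+1 x == u) = (anc z x == u) || ((pr (n - z) == u) && (anc z x == n - z)).
Proof.
move=> lt_z lt_u /=; have := @pr_lt (n - z).
case: (anc z x =P n - z) => [->|_]; rewrite ?andbT ?andbF ?orbF //.
by case: eqP => // [->|]; case: eqP => //; lia.
Qed.

(** Makes [gain] and [members] additive when the class of [n - z] joins that of its predecessor. *)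
Lemma sum_step z (F : nat -> nat) : z < n ->
  \sum_(x < n.+1 | anc z.+1 x == pr (n - z)) F x =
  \sum_(x < n.+1 | anc z x == pr (n - z)) F x +
  \sum_(x < n.+1 | anc z x == n - z) F x.
Proof.
move=> lt_z; have lt_pr : pr (n - z) < n - z by apply: pr_lt; lia.
rewrite (bigID (fun x : 'I_n.+1 => anc z x == pr (n - z))).
congr (_ + _); apply: eq_bigl => x; rewrite anc_step // eqxx andTb.
  by case: (anc z x == pr _); rewrite ?andbF.
by case: eqP => [->|_] /=; rewrite ?andbT ?andbF //; apply/esym/eqP; lia.
Qed.

Lemma entry_keep z u q j v l : z < n -> u < n - z -> u != pr (n - z) ->
  entry_ok z u q j v l -> entry_ok z.+1 u q j v l.
Proof.
move=> lt_z lt_u nu; have aE x : (anc z.+1 x == u) = (anc z x == u).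
  by rewrite anc_step // [pr _ == _]eq_sym (negPf nu) orbF.
have aE' x : (anc z.+1 x = u) <-> (anc z x = u).
  by split=> /eqP ax; apply/eqP; [rewrite -aE | rewrite aE].
have gE S : gain z.+1 u S = gain z u S by apply: eq_bigl => x; apply: aE.
have mE S : members z.+1 u S = members z u S by apply: eq_bigl => x; apply: aE.
case=> le_v sv cv; split=> //.
- move=> /sv[Ul sl lP [ul al] gl]; split=> //.
  + by move=> x /lP[? /aE' ?].
  + by split=> // x le_x /aE'; apply: al.
  + move=> S S0 Sl le_q; rewrite gE; apply: gl => // x le_x /aE'; exact: Sl.
- by move=> S; rewrite mE gE; apply: cv.
Qed.

Hypothesis k_le : k <= n.

(** Before any merge a node contains only itself, so only sizes [0] and [1] can have a nonzero
    entry, and [l] matters for these alone. *)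
Lemma entry_init u q j v l : (forall i, w i <= n) -> u <= n -> q./2 <= k ->
  (j = 0 -> l = [::]) -> (j = 1 -> l = [:: u]) ->
  v = (if odd q then (j == 1) * al1 u * (w u + q./2 + 1) else (j == 0) * al0 u) ->
  entry_ok 0 u q j v l.
Proof.
move=> w_le le_u le_q l0 l1 ->.
have uE (x : 'I_n.+1) : (anc 0 x == u) = (x == Ordinal (le_u : u < n.+1)) by [].
have gE S : gain 0 u S = S u * (w u + cnt S u).
  by rewrite /gain (eq_bigl _ _ uE) big_pred1_eq.
have mE S : members 0 u S = S u by rewrite /members (eq_bigl _ _ uE) big_pred1_eq.
have wu := w_le u; split.
- case: odd; last by case: eqP => //; case: al0; lia.
  case: eqP => [->|_]; last by lia.
  by case: al1; lia.
- case oq: (odd q).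
    case: (eqVneq j 1) => [j1|_]; last by move=> /=.
    case a1: (al1 u) => //= _; rewrite (l1 j1) j1; split=> //.
    + by move=> x; rewrite mem_seq1 => /eqP ->.
    + split; first by rewrite mem_head oq.
      by move=> x _ /= ->; rewrite mem_head.
    + move=> S S0 /(_ u le_u erefl); rewrite mem_head => Su le_c.
      by rewrite gE Su; lia.
  case: (eqVneq j 0) => [j0|_]; last by move=> /=.
  case a0: (al0 u) => //= _; rewrite (l0 j0) j0; split=> //.
    by split=> // x _ /= ->.
- move=> S aS _ Su cS; rewrite mE gE Su cS => <-.
  have := aS u le_u; rewrite Su; case: odd => -> /=; lia.
Qed.

Lemma leq_pred_merge a b x y :
  a != 0 -> b != 0 -> a.-1 <= x -> b.-1 <= y -> (a + b - 1).-1 <= x + y.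
Proof. lia. Qed.

Lemma leq_min_link (s t : bool) a b m : a <= b -> minn (s + t * a) m <= s + t * b.
Proof. case: t; lia. Qed.

Hypothesis cnt_rec : forall S i, S 0 = false -> 0 < i <= n ->
  cnt S i = S (pr i) + tb i * cnt S (pr i).
Hypothesis cnt_le : forall (S : nat -> bool) i, cnt S i <= \sum_(x < n.+1) S x.
Hypothesis al1_0 : al1 0 = false.

Lemma entry_merge z q c j (vu : nat -> nat) lu (vi : bool -> nat -> nat) li v l :
  let i := n - z in let u := pr i in
  z < n -> q./2 <= k -> j <= k ->
  c = minn (odd q + tb i * q./2) k ->
  (forall j', j' <= j -> entry_ok z u q j' (vu j') (lu j')) ->
  (forall j' (b : bool), j' <= j -> entry_ok z i (2 * c + b) j' (vi b j') (li b j')) ->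
  (v != 0 -> exists j' (b : bool), [/\ j' <= j, vu (j - j') != 0, vi b j' != 0,
     v = vu (j - j') + vi b j' - 1 & l = lu (j - j') ++ li b j']) ->
  (forall j' (b : bool), j' <= j -> vu (j - j') != 0 -> vi b j' != 0 ->
     vu (j - j') + vi b j' - 1 <= v) ->
  entry_ok z.+1 u q j v l.
Proof.
move=> i u lt_z le_q le_j cE eu ei vP vmax.
have lt_u : u < i by apply: pr_lt; rewrite /i; lia.
have half b : (2 * c + nat_of_bool b)./2 = c by case: b; lia.
have oddb b : odd (2 * c + nat_of_bool b) = b by case: b; lia.
have gE S : gain z.+1 u S = gain z u S + gain z i S.
  exact: (sum_step (fun x => S x * (w x + cnt S x)) lt_z).
have mE S : members z.+1 u S = members z u S + members z i S.
  exact: (sum_step S lt_z).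
have aE x : (anc z.+1 x == u) = (anc z x == u) || (anc z x == i).
  by rewrite anc_step // eqxx.
have ui : u == i = false by apply/eqP; lia.
have iu : i == u = false by rewrite eq_sym.
have ancu : anc z u = u by apply: anc_live; rewrite /i in lt_u *; lia.
have crec S : S 0 = false -> cnt S i = S u + tb i * cnt S u.
  by move=> S0; apply: cnt_rec => //; rewrite /i; lia.
split.
- case: (eqVneq v 0) => [->//|/vP[j' [b [le_j' _ _ -> _]]]].
  have [h1 _ _] := eu (j - j') (leq_subr _ _); have [h2 _ _] := ei j' b le_j'.
  have : 2 * n * j = 2 * n * (j - j') + 2 * n * j' by rewrite -mulnDr subnK.
  by lia.
- move=> /vP[j' [b [le_j' nu ni vE lE]]].
  have [_ /(_ nu)[Uu su uP [uu ua] ug] _] := eu (j - j') (leq_subr _ _).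
  have [_ /(_ ni)[Ui si iP [ii ia] ig] _] := ei j' b le_j'.
  have mu x : anc z x = u -> (x \in l) = (x \in lu (j - j')).
    move=> ax; rewrite lE mem_cat; case xi: (x \in li b j'); rewrite ?orbF //.
    by case: (iP _ xi) => _; rewrite ax => /eqP; rewrite ui.
  have mi x : anc z x = i -> (x \in l) = (x \in li b j').
    move=> ax; rewrite lE mem_cat; case xi: (x \in lu (j - j')) => //.
    by case: (uP _ xi) => _; rewrite ax => /eqP; rewrite iu.
  split.
  + rewrite lE cat_uniq Uu Ui andbT /=; apply/hasPn => x /= /iP[_ ax].
    by apply/negP=> /uP[_]; rewrite ax => /eqP; rewrite iu.
  + by rewrite lE size_cat su si subnK.
  + move=> x; rewrite lE mem_cat => /orP[/uP[? ax]|/iP[? ax]]; split=> //; apply/eqP;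
    by rewrite aE ax eqxx ?orbT.
  + split; first by rewrite mu.
    move=> x le_x /eqP; rewrite aE => /orP[]/eqP ax; first by rewrite mu //; apply: ua.
    by rewrite mi //; apply: ia.
  + move=> S S0 Sl le_c; rewrite gE.
    have Slu x : x <= n -> anc z x = u -> S x = (x \in lu (j - j')).
      by move=> le_x ax; rewrite -mu //; apply: Sl => //; apply/eqP; rewrite aE ax eqxx.
    have Sli x : x <= n -> anc z x = i -> S x = (x \in li b j').
      by move=> le_x ax; rewrite -mi //; apply: Sl => //; apply/eqP; rewrite aE ax eqxx orbT.
    have Su : S u = odd q by rewrite Slu // (leq_trans (ltnW lt_u)) ?leq_subr.
    (* A lower bound on the count of [u] gives one for [i] even after truncation; this is why
       [sound] only asks for at least [a] neighbours. *)
    have le_cS : c <= cnt S i by rewrite crec // Su cE; apply: leq_min_link.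
    rewrite vE; apply: leq_pred_merge => //; first exact: ug.
    by apply: ig => //; rewrite half.
- move=> S aS le_S Su cS; rewrite mE gE => mj.
  have S0 : S 0 = false by have := aS 0 (leq0n _); rewrite al1_0; case: (S 0).
  (* The count is at most the size of [S], hence at most [k], so the truncation in [c] changes
     nothing. *)
  have cSi : cnt S i = c by have := cnt_le S i; rewrite crec // Su cS cE; lia.
  have le_mi : members z i S <= j by lia.
  have [_ _ /(_ S aS le_S)] := ei _ (S i) le_mi; rewrite oddb half => /(_ erefl cSi erefl) gi.
  have mu : members z u S = j - members z i S by lia.
  have [_ _ /(_ S aS le_S Su cS mu) gu] := eu _ (leq_subr (members z i S) j).
  have := vmax _ (S i) le_mi; lia.
Qed.

End Table.

(** * Time-bounded execution *)

Fixpoint mvars (p : cmd) : seq nat :=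
  match p with
  | Assign x _ => [:: x]
  | Seq p q | If _ p q => mvars p ++ mvars q
  | While _ p => mvars p
  | _ => [::]
  end.

Fixpoint marrs (p : cmd) : seq nat :=
  match p with
  | Put a _ _ => [:: a]
  | Seq p q | If _ p q => marrs p ++ marrs q
  | While _ p => marrs p
  | _ => [::]
  end.

Fixpoint rvars (e : expr) : seq nat :=
  match e with
  | Const _ => [::]
  | Var x => [:: x]
  | Get _ i => rvars i
  | Bin _ e1 e2 => rvars e1 ++ rvars e2
  end.

Fixpoint rarrs (e : expr) : seq nat :=
  match e with
  | Const _ | Var _ => [::]
  | Get a i => a :: rarrs i
  | Bin _ e1 e2 => rarrs e1 ++ rarrs e2
  end.

(** A syntactic frame: facts about variables and arrays that a program never writes survive it
    without being part of its specification. *)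
Definition frame (p : cmd) (s s' : state) : Prop :=
  (forall x, x \notin mvars p -> var s' x = var s x) /\
  (forall a, a \notin marrs p -> arr s' a = arr s a).

Lemma frame_trans p s1 s2 s3 : frame p s1 s2 -> frame p s2 s3 -> frame p s1 s3.
Proof.
by case=> V1 A1 [V2 A2]; split=> x xp; rewrite ?V2 ?V1 ?A2 ?A1.
Qed.

Lemma frame_sub p q s s' :
  {subset mvars p <= mvars q} -> {subset marrs p <= marrs q} ->
  frame p s s' -> frame q s s'.
Proof.
move=> sV sA [V A]; split=> x xq; [apply: V | apply: A]; apply: contra xq.
- exact: sV.
- exact: sA.
Qed.

Lemma exec_frame W p s s' t : exec W p s s' t -> frame p s s'.
Proof.
elim=> {p s s' t} //=.
- move=> s x e _; split=> //= y; rewrite inE => /negPf yx.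
  by rewrite yx.
- move=> s a i e _ _; split=> //= b; rewrite inE => /negPf ba.
  by apply/funext=> j /=; rewrite ba.
- move=> p q s1 s2 s3 t u _ F1 _ F2.
  by apply: (@frame_trans _ _ s2); [apply: frame_sub F1 | apply: frame_sub F2]
    => x /=; rewrite mem_cat => ->; rewrite ?orbT.
- move=> e p q s s' t _ _ _ F; apply: frame_sub F => x /=;
  by rewrite mem_cat => ->.
- move=> e p q s s' t _ _ _ F; apply: frame_sub F => x /=;
  by rewrite mem_cat => ->; rewrite orbT.
- move=> e p s1 s2 s3 t u _ _ _ F1 _; exact: frame_trans.
Qed.

Lemma eval_frame p s s' e :
  frame p s s' -> all (fun x => x \notin mvars p) (rvars e) ->
  all (fun a => a \notin marrs p) (rarrs e) -> eval s' e = eval s e.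
Proof.
case=> V A; elim: e => //=.
- by move=> x; rewrite andbT => xp _; apply: V.
- by move=> a i IH iV /andP[ap iA]; rewrite IH // A.
- by move=> o e1 IH1 e2 IH2; rewrite !all_cat => /andP[? ?] /andP[? ?]; rewrite IH1 // IH2.
Qed.

Section Run.
Variables (M L : nat).

Fixpoint small_consts (e : expr) : bool :=
  match e with
  | Const c => c <= 2
  | Var _ => true
  | Get _ i => small_consts i
  | Bin _ e1 e2 => small_consts e1 && small_consts e2
  end.

Definition ok (e : expr) : bool := small_consts e && (esize e <= L).

Definition bounded (s : state) : Prop :=
  [/\ 2 < M, forall x, var s x < M & forall a i, arr s a i < M].

(** Products multiply the bounds of the operands; the unit that [esize] charges for the operator
    yields a spare factor [M], which covers sums and truth values. The other operators do not exceed
    their first operand. *)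
Lemma eval_lt s e : bounded s -> small_consts e -> eval s e < M ^ esize e.
Proof.
case=> M2 BV BA; have M0 : 0 < M by lia.
have E1 : M ^ 1 = M by rewrite expn1.
elim: e => [c|x|a i IH|o e1 IH1 e2 IH2] /=.
- lia.
- by rewrite E1.
- move=> _; apply: leq_trans (BA _ _) _.
  by rewrite -{1}E1 leq_exp2l; lia.
- case/andP=> /IH1 {IH1} h1 /IH2 {IH2} h2.
  set a := esize e1 in h1 *; set b := esize e2 in h2 *.
  have pa : 0 < M ^ a by rewrite expn_gt0 M0.
  have pb : 0 < M ^ b by rewrite expn_gt0 M0.
  have ge1 : 2 < M ^ (a + b).+1 by rewrite expnS expnD; nia.
  have ge2 : M ^ a * M ^ b <= M ^ (a + b).+1 by rewrite expnS expnD; nia.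
  have ge3 : M ^ a + M ^ b <= M ^ (a + b).+1 by rewrite expnS expnD; nia.
  have := leq_div (eval s e1) (eval s e2).
  have := leq_mod (eval s e1) (eval s e2).
  have : eval s e1 * eval s e2 < M ^ a * M ^ b by rewrite ltn_mul.
  by case: o => /=; try case: leqP; try case: eqP; move: (eval s e1 %/ _) (eval s e1 %% _) => *; nia.
Qed.

Lemma ok_fits s e : bounded s -> ok e -> fits (M ^ L) s e.
Proof.
move=> B /andP[]; have [M2 _ _] := B; elim: e => [c|x|a i IH|o e1 IH1 e2 IH2] sc sL.
1,2: by rewrite /= andbT; apply: leq_trans (eval_lt B sc) _; rewrite leq_exp2l; lia.
all: apply/andP; split;
  first by apply: leq_trans (eval_lt B sc) _; rewrite leq_exp2l; lia.
- by apply: IH => //=; rewrite /= in sL; lia.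
- move: sc sL => /= /andP[sc1 sc2] sL.
  by apply/andP; split; [apply: IH1 | apply: IH2] => //; lia.
Qed.

(* As [M ^ L] exceeds the value of every expression of size at most [L] over
   cells smaller than [M], only the values that get stored have to be bounded. *)
Definition run (p : cmd) (s : state) (T : nat) (Q : state -> Prop) : Prop :=
  bounded s -> exists s' t,
    [/\ exec (M ^ L) p s s' t, t <= T, bounded s' & Q s'].

Lemma run_weaken p s T T' (Q Q' : state -> Prop) :
  run p s T Q -> T <= T' ->
  (forall s', frame p s s' -> bounded s' -> Q s' -> Q' s') -> run p s T' Q'.
Proof.
move=> r TT' QQ' /r[s' [t [ex tT B q]]]; exists s', t; split=> //.
- exact: leq_trans TT'.
- by apply: QQ' => //; apply: exec_frame ex.
Qed.

Lemma run_bounded p s T Q : (bounded s -> run p s T Q) -> run p s T Q.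
Proof. by move=> r B; apply: r. Qed.

Lemma run_skip s T (Q : state -> Prop) : 0 < T -> Q s -> run Skip s T Q.
Proof. by move=> T0 q B; exists s, 1; split=> //; constructor. Qed.

Lemma bounded_set_var s x v : bounded s -> v < M -> bounded (set_var s x v).
Proof. by case=> ? BV BA vM; split=> //= y; case: ifP. Qed.

Lemma bounded_set_arr s a i v : bounded s -> v < M -> bounded (set_arr s a i v).
Proof. by case=> ? BV BA vM; split=> //= b j; case: ifP. Qed.

Lemma run_assign s x e T (Q : state -> Prop) :
  ok e -> (bounded s -> eval s e < M) -> esize e < T ->
  Q (set_var s x (eval s e)) -> run (Assign x e) s T Q.
Proof.
move=> oe eM eT q B; exists (set_var s x (eval s e)), (esize e).+1; split=> //.
- by constructor; apply: ok_fits.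
- by apply: bounded_set_var => //; apply: eM.
Qed.

Lemma run_put s a i e T (Q : state -> Prop) :
  ok i -> ok e -> (bounded s -> eval s e < M) -> esize i + esize e < T ->
  Q (set_arr s a (eval s i) (eval s e)) -> run (Put a i e) s T Q.
Proof.
move=> oi oe eM eT q B.
exists (set_arr s a (eval s i) (eval s e)), (esize i + esize e).+1; split=> //.
- by constructor; apply: ok_fits.
- by apply: bounded_set_arr => //; apply: eM.
Qed.

Lemma run_seq p q s T1 T Q :
  T1 <= T ->
  run p s T1 (fun s' => frame p s s' -> run q s' (T - T1) Q) ->
  run (Seq p q) s T Q.
Proof.
move=> TT r /r[s2 [t [ex tT B /(_ (exec_frame ex) B)]]].
case=> s3 [u [ex' uT B' q3]]; exists s3, (t + u); split=> //; last by lia.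
by econstructor; eassumption.
Qed.

Lemma run_assign_seq s x e q T Q :
  ok e -> (bounded s -> eval s e < M) -> esize e < T ->
  run q (set_var s x (eval s e)) (T - (esize e).+1) Q ->
  run (Seq (Assign x e) q) s T Q.
Proof. by move=> oe eM eT r; apply: (@run_seq _ _ _ (esize e).+1) => //; apply: run_assign. Qed.

Lemma run_put_seq s a i e q T Q :
  ok i -> ok e -> (bounded s -> eval s e < M) -> esize i + esize e < T ->
  run q (set_arr s a (eval s i) (eval s e)) (T - (esize i + esize e).+1) Q ->
  run (Seq (Put a i e) q) s T Q.
Proof. by move=> oi oe eM eT r; apply: (@run_seq _ _ _ (esize i + esize e).+1) => //; apply: run_put. Qed.

Lemma run_if e p q s T Q :
  ok e -> esize e < T ->
  (eval s e != 0 -> run p s (T - (esize e).+1) Q) ->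
  (eval s e = 0 -> run q s (T - (esize e).+1) Q) ->
  run (If e p q) s T Q.
Proof.
move=> oe eT r1 r2 B; have fe := ok_fits B oe.
have [e0|e0] := eqVneq (eval s e) 0.
  have [s' [t [ex tT B' q']]] := r2 e0 B.
  by exists s', (esize e + t).+1; split=> //; [apply: ExecIfFalse | lia].
have [s' [t [ex tT B' q']]] := r1 e0 B.
by exists s', (esize e + t).+1; split=> //; [apply: ExecIfTrue | lia].
Qed.

(** The cost [T'] of a round may depend on the state. The potential pays for it and for one test,
    which allows amortized bounds such as that of the graph search. *)
Lemma run_while e p (I : state -> Prop) (pot : state -> nat) s T :
  ok e -> I s ->
  (forall s', frame p s s' -> I s' -> eval s' e != 0 -> exists T',
     run p s' T' (fun s'' => I s'' /\ T' + (esize e).+1 + pot s'' <= pot s')) ->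
  pot s + (esize e).+1 <= T ->
  run (While e p) s T (fun s' => I s' /\ eval s' e = 0).
Proof.
move=> oe Is step le_T.
(* The frame stays anchored at the initial state, now called [s0], while the induction moves [s]. *)
have {step} : exists2 s0, frame p s0 s & (forall s', frame p s0 s' -> I s' -> eval s' e != 0 -> exists T',
     run p s' T' (fun s'' => I s'' /\ T' + (esize e).+1 + pot s'' <= pot s')).
  by exists s.
case=> s0 F step; have [m] := ubnP (pot s).
elim: m => // m IH in s T Is le_T F * => pm B; have fe := ok_fits B oe.
have [e0|e0] := eqVneq (eval s e) 0.
  exists s, (esize e).+1; split=> //; [exact: ExecWhileFalse | lia].
have [T' /(_ B)[s2 [t [ex tT' B2 [I2 le2]]]]] := step s F Is e0.
have [] := IH s2 (pot s2 + (esize e).+1) I2 (leqnn _) _ _ B2.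
- exact: frame_trans F (exec_frame ex).
- lia.
move=> s3 [u [ex' uT B3 q3]]; exists s3, (esize e + t + u).+1; split=> //.
- by apply: ExecWhileTrue ex ex'.
- lia.
Qed.

End Run.

(** * Counting loops *)

Definition For (x : nat) (lim : expr) (p : cmd) : cmd :=
  Seq (Assign x (Const 0))
    (While (Bin Leq (Bin Add (Var x) (Const 1)) lim)
       (Seq p (Assign x (Bin Add (Var x) (Const 1))))).

Section RunFor.
Variables (M L : nat).
Hypothesis L_ge : 17 <= L.

(** The 20 units of a round are 4 for the increment and at most 16 for the test, as
    [esize lim <= 11]; the other 20 cover the initialization and the last test. The limit is
    evaluated anew at each test, hence must not read what the loop writes. *)
Lemma run_for_sum x lim p (I : nat -> state -> Prop) (c : nat -> nat) s T :
  small_consts lim -> esize lim <= 11 -> x \notin mvars p ->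
  x \notin rvars lim ->
  all (fun y => y \notin mvars p) (rvars lim) ->
  all (fun a => a \notin marrs p) (rarrs lim) ->
  (bounded M s -> eval s lim < M) ->
  I 0 (set_var s x 0) ->
  (forall i s', i < eval s lim -> frame (For x lim p) s s' -> var s' x = i ->
     I i s' -> run M L p s' (c i) (fun s'' => frame p s' s'' -> I i.+1 (set_var s'' x i.+1))) ->
  20 + \sum_(i < eval s lim) (c i + 20) <= T ->
  run M L (For x lim p) s T (fun s' => I (eval s lim) s').
Proof.
move=> sc el xp xl lV lA NM I0 step le_T.
apply: run_bounded => /NM {}NM.
set N := eval s lim in NM step le_T *.
have limE s' : frame (For x lim p) s s' -> eval s' lim = N.
  case=> V A; apply: (@eval_frame (Seq p (Assign x (Const 0)))) => /=.
  - split=> y /= yp; [apply: V | apply: A].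
      by apply: contra yp; rewrite /= inE !mem_cat !inE; case: eqP; case: (y \in _).
    by apply: contra yp; rewrite /= !mem_cat !in_nil !orbF.
  - apply/allP=> y yl; rewrite mem_cat inE negb_or (allP lV) //=.
    by apply: contraNneq xl => <-.
  - by rewrite cats0.
apply: (@run_weaken _ _ _ _ (2 + (\sum_(i < N) (c i + 20) + (esize lim + 5))) _
  (fun s' => [/\ I (var s' x) s', var s' x <= N & N <= var s' x])); last first.
- move=> s' _ _ [Is le1 le2]; rewrite (_ : N = var s' x) //; lia.
- by rewrite -/N in le_T *; lia.
apply: run_assign_seq; rewrite /ok /=; try lia.
set s1 := set_var s x 0.
have F1 : frame (For x lim p) s s1.
  by split=> // y; rewrite inE negb_or /= => /andP[/negPf ->].
rewrite addKn.
set cond := Bin Leq _ _; set body := Seq _ _.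
have E1 s' : frame body s1 s' -> frame (For x lim p) s s'.
  move=> F; apply: frame_trans F1 _; apply: frame_sub F => y //=.
  by rewrite inE => ->; rewrite orbT.
pose inv s' := I (var s' x) s' /\ var s' x <= N.
pose pot s' := \sum_(var s' x <= i < N) (c i + 20).
apply: (run_weaken (@run_while M L cond body inv pot s1 _ _ _ _ (leqnn _))).
- by rewrite /ok /= sc /=; lia.
- by rewrite /inv /= eqxx.
- move=> s' F [Is le1] /=; rewrite limE; last exact: E1.
  rewrite eqb0 negbK => lt1; exists (c (var s' x) + 4).
  rewrite addn1 in lt1.
  apply: (run_seq (T1 := c (var s' x))); first lia.
  apply: run_weaken (step _ s' lt1 (E1 _ F) erefl Is) (leqnn _) _ => s2 F2 B2 Is2 _.
  have E2 : var s2 x = var s' x by case: F2 => V _; apply: V.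
  apply: run_assign => //=; rewrite /ok ?/=; try (case=> ? _ _); try lia.
  rewrite /inv /pot /= eqxx E2 addn1; split; first by split; [exact: Is2 | lia].
  by rewrite [X in _ <= X]big_ltn //; lia.
- by rewrite /pot /= eqxx big_mkord leq_add2l; lia.
- move=> s' F _ [[Is le1] /=]; rewrite limE; last exact: E1.
  by move=> /eqP; rewrite eqb0; split=> //; lia.
Qed.

Lemma run_for x lim p (I : nat -> state -> Prop) c s T :
  small_consts lim -> esize lim <= 11 -> x \notin mvars p ->
  x \notin rvars lim ->
  all (fun y => y \notin mvars p) (rvars lim) ->
  all (fun a => a \notin marrs p) (rarrs lim) ->
  (bounded M s -> eval s lim < M) ->
  I 0 (set_var s x 0) ->
  (forall i s', i < eval s lim -> frame (For x lim p) s s' -> var s' x = i ->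
     I i s' -> run M L p s' c (fun s'' => frame p s' s'' -> I i.+1 (set_var s'' x i.+1))) ->
  20 + eval s lim * (c + 20) <= T ->
  run M L (For x lim p) s T (fun s' => I (eval s lim) s').
Proof.
move=> sc el xp xl lV lA NM I0 step le_T.
by apply: run_for_sum => //; [exact: step | rewrite sum_nat_const card_ord].
Qed.

End RunFor.

(** * The program *)

Declare Scope ram_scope.
Delimit Scope ram_scope with ram.
Notation "! x" := (Var x) (at level 5, x at level 4, format "! x") : ram_scope.
Notation "# c" := (Const c) (at level 5, c at level 4, format "# c") : ram_scope.
Infix "+" := (Bin Add) : ram_scope.
Infix "-" := (Bin Defs.Sub) : ram_scope.
Infix "*" := (Bin Mul) : ram_scope.
Infix "/" := (Bin Div) : ram_scope.
Infix "mod" := (Bin Mod) (at level 40) : ram_scope.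
Infix "<=" := (Bin Leq) : ram_scope.
Notation "e < f" := (Bin Leq (Bin Add e (Const 1)) f) : ram_scope.
Infix "==" := (Bin Eqb) : ram_scope.
Notation "a .[ i ]" := (Get a i) : ram_scope.
Notation "x '::=' e" := (Assign x e) (at level 70) : ram_scope.
Notation "p ;; q" := (Seq p q) (at level 75, right associativity) : ram_scope.

Notation vn := 0 (only parsing).
Notation vk := 2 (only parsing).
Notation vd := 3 (only parsing).
Notation vK := 4 (only parsing).
Notation vP := 5 (only parsing).
Notation vlen := 6 (only parsing).
Notation vhead := 7 (only parsing).
Notation vroot := 8 (only parsing).
Notation vv := 9 (only parsing).
Notation vx := 10 (only parsing).
Notation vu := 11 (only parsing).
Notation vi := 12 (only parsing).
Notation vlo := 13 (only parsing).
Notation vhi := 14 (only parsing).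
Notation vdone := 15 (only parsing).
Notation vbest := 16 (only parsing).
Notation vz := 17 (only parsing).
Notation vq := 18 (only parsing).
Notation vj := 19 (only parsing).
Notation vc := 20 (only parsing).
Notation vy := 21 (only parsing).
Notation vval := 22 (only parsing).
Notation varg := 23 (only parsing).
Notation vb := 24 (only parsing).
Notation vt := 25 (only parsing).
Notation vw := 26 (only parsing).

Notation aoff := 0 (only parsing).
Notation anbr := 1 (only parsing).
Notation ads := 2 (only parsing).
Notation aout := 3 (only parsing).
Notation aord := 4 (only parsing).
Notation apos := 5 (only parsing).
Notation apr := 6 (only parsing).
Notation atb := 7 (only parsing).
Notation asel := 8 (only parsing).
Notation awt := 9 (only parsing).
Notation aval := 10 (only parsing).
Notation alst := 11 (only parsing).

Section Program.
Local Open Scope ram_scope.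

Definition push : cmd :=
  vlen ::= !vlen + #1 ;;
  Put aord !vlen !vu ;;
  Put apos !vu !vlen.

Definition deg : expr := aoff.[!vv + #1] - aoff.[!vv].
Definition neighbour : expr := anbr.[aoff.[!vv] + !vx].

(* Positions start at [1], so that [0] stands for an unvisited vertex and, in
   [apr], for a vertex without earlier neighbours outside the deletion set. *)
Definition place_deleted : cmd :=
  For vx !vd (vu ::= ads.[!vx] ;; push).

Definition visit : cmd :=
  For vx deg (vu ::= neighbour ;; If (apos.[!vu] == #0) push Skip).

(** [vhead] starts behind the deleted vertices. These are never scanned and already have positions,
    so that scanning lists of [G] amounts to searching [G - D]. One loop serves both the queue and
    the quest for new roots. *)
Definition search : cmd :=
  vhead ::= !vd ;;
  While (!vroot < !vn)
    (If (!vhead < !vlen)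
       (vhead ::= !vhead + #1 ;; vv ::= aord.[!vhead] ;; visit)
       (If (apos.[!vroot] == #0)
          (vu ::= !vroot ;; push)
          (vroot ::= !vroot + #1))).

(** [apr] holds the largest admissible position seen so far. If it is already nonzero, the present
    neighbour is at least the second one, which sets the flag [atb]. *)
Definition link_body : cmd :=
  vu ::= apos.[neighbour] ;;
  If ((!vd < !vu) * (!vu < !vi))
    (If apr.[!vi] (Put atb !vi #1) Skip ;;
     If (apr.[!vi] < !vu) (Put apr !vi !vu) Skip)
    Skip.

Definition link : cmd :=
  For vv !vn (vi ::= apos.[!vv] ;; For vx deg link_body).

Definition weigh : cmd :=
  For vv !vn
    (vi ::= apos.[!vv] ;;
     Put awt !vi #0 ;;
     For vx deg
       (vu ::= apos.[neighbour] ;;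
        If (!vu < !vi) (Put awt !vi (awt.[!vi] + asel.[!vu])) Skip)).

(* Cell [(i * 2K + q) * K + j] of [aval], where [K = k + 1], is the entry of
   node [i] for state [q] and sets of [j] vertices; the set itself is stored in
   the [K] cells of [alst] from [K] times that index on.  Node [0] is a dummy
   root, which is never chosen. *)
Definition fill : cmd :=
  For vz ((!vn + #1) * !vP)
    (vi ::= !vz / !vP ;;
     vq ::= (!vz mod !vP) / !vK ;;
     vj ::= !vz mod !vK ;;
     Put alst (!vz * !vK) !vi ;;
     If (!vq mod #2)
       (Put aval !vz
          ((!vj == #1) * (#1 <= !vi) *
           (#1 <= asel.[!vi] + (!vi <= !vlo) + (!vhi < !vi)) *
           (awt.[!vi] + !vq / #2 + #1)))
       (Put aval !vz ((!vj == #0) * (asel.[!vi] == #0)))).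

(** The counter [vx] encodes a split: [vx / 2] vertices come from the class of [vi], and [vx mod 2]
    tells whether [vi] is chosen. Since entries are gains plus one, a sum of two is reduced by
    one. *)
Definition best_split : cmd :=
  vval ::= #0 ;;
  varg ::= #0 ;;
  For vx (#2 * (!vj + #1))
    (vb ::= aval.[(!vi * (#2 * !vK) + (#2 * !vc + !vx mod #2)) * !vK + !vx / #2] ;;
     vw ::= aval.[!vu * !vP + !vz - !vx / #2] ;;
     If ((#1 <= !vb) * (#1 <= !vw) * (!vval < !vb + !vw))
       (vval ::= !vb + !vw - #1 ;; varg ::= !vx) Skip).

Definition copy_split : cmd :=
  Put aval (!vu * !vP + !vz) !vval ;;
  vb ::= !vj - !varg / #2 ;;
  For vx !vj
    (If (!vx < !vb)
       (Put alst ((!vu * !vP + !vz) * !vK + !vx)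
          alst.[(!vu * !vP + !vz - !varg / #2) * !vK + !vx])
       (Put alst ((!vu * !vP + !vz) * !vK + !vx)
          alst.[((!vi * (#2 * !vK) + (#2 * !vc + !varg mod #2)) * !vK
                 + !varg / #2) * !vK + (!vx - !vb)])).

(* The entries of a node are updated by decreasing index, because the new ones
   are computed from old ones of smaller index. *)
Definition set_entry : cmd :=
  vz ::= !vP - #1 - !vt ;;
  vj ::= !vz mod !vK ;;
  vq ::= !vz / !vK ;;
  vc ::= !vq mod #2 + atb.[!vi] * (!vq / #2) ;;
  vc ::= !vc - (!vK <= !vc).

Definition merge_entry : cmd := set_entry ;; best_split ;; copy_split.

Definition merge_nodes : cmd :=
  For vy !vn
    (vi ::= !vn - !vy ;;
     vu ::= apr.[!vi] ;;
     For vt !vP merge_entry).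

(** Cell [k] of [aval] belongs to the dummy root in state [0] and to sets of [k] vertices. [vbest]
    persists over both phases, so the better solution survives. *)
Definition record : cmd :=
  If (!vbest < aval.[!vk])
    (vbest ::= aval.[!vk] ;;
     For vx !vk (Put aout !vx aord.[alst.[!vk * !vK + !vx]]))
    Skip.

(* The guess is itself the binary counter: the number of guesses need not fit
   in a word. *)
Definition next_guess : cmd :=
  vdone ::= #1 ;;
  For vx (!vhi - !vlo)
    (vu ::= asel.[!vlo + #1 + !vx] + !vdone ;;
     Put asel (!vlo + #1 + !vx) (!vu mod #2) ;;
     vdone ::= !vu / #2).

Definition guess : cmd := weigh ;; fill ;; merge_nodes ;; record.

(** [vdone] is the final carry of the counter. It becomes [1] when the guess wraps around to zero,
    which leaves [asel] clean for the next phase. *)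
Definition phase : cmd :=
  vdone ::= #0 ;;
  While (!vdone == #0) (guess ;; next_guess).

(** The case [k = 0] is split off because the time bound can then be constant, as for a graph
    without edges, and would not even pay for visiting the vertices. *)
Definition solve : cmd :=
  If !vk
    (vK ::= !vk + #1 ;;
     vP ::= #2 * !vK * !vK ;;
     place_deleted ;;
     search ;;
     link ;;
     vlo ::= #0 ;; vhi ::= !vd / #2 ;; phase ;;
     vlo ::= !vd / #2 ;; vhi ::= !vd ;; phase)
    Skip.

End Program.

Lemma frame_var p s s' x : frame p s s' -> x \notin mvars p -> var s' x = var s x.
Proof. by case=> V _; apply: V. Qed.

Lemma frame_arr p s s' a : frame p s s' -> a \notin marrs p -> arr s' a = arr s a.
Proof. by case=> _ A; apply: A. Qed.

(** A value to be stored is below [M] by arithmetic, or because a variable or cell already holds it;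
    failing that, the goal is left to the user. *)
Ltac side := first
  [ by move=> *; rewrite /=; lia
  | let B := fresh in let V := fresh in let A := fresh in
    move=> B; case: (B) => _ V A; by [exact: V | exact: A]
  | rewrite /= ].

Ltac step :=
  lazymatch goal with
  | |- run _ _ (Seq (Assign _ _) _) _ _ _ =>
      apply: run_assign_seq; [by [] | side | side | rewrite /=]
  | |- run _ _ (Assign _ _) _ _ _ =>
      apply: run_assign; [by [] | side | side | rewrite /=]
  | |- run _ _ (Seq (Put _ _ _) _) _ _ _ =>
      apply: run_put_seq; [by [] | by [] | side | side | rewrite /=]
  | |- run _ _ (Put _ _ _) _ _ _ =>
      apply: run_put; [by [] | by [] | side | side | rewrite /=]
  | |- run _ _ (If _ _ _) _ _ _ =>
      apply: run_if; [by [] | side | rewrite /= | rewrite /=]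
  | |- run _ _ Skip _ _ _ => apply: run_skip; [side | ]
  end.

(** * Ordering the vertices *)

Section Order.
Variables (n : nat) (G : sgraph 'I_n) (adj : 'I_n -> seq 'I_n) (M : nat).
Hypothesis adjP : adjacency_lists G adj.
Hypothesis M_ge : 10 * n + 20 <= M.

Notation run := (run M 40).

Record has_graph (s : state) : Prop := HasGraph {
  has_n : var s vn = n;
  has_off : forall v : 'I_n, arr s aoff v.+1 = arr s aoff v + size (adj v);
  has_nbr : forall (v : 'I_n) i, i < size (adj v) ->
    arr s anbr (arr s aoff v + i) = nth 0 (map val (adj v)) i }.

Lemma has_graph_frame p s s' : frame p s s' ->
  vn \notin mvars p -> aoff \notin marrs p -> anbr \notin marrs p ->
  has_graph s -> has_graph s'.
Proof.
move=> F v0 a0 a1 [h1 h2 h3]; split; rewrite ?(frame_var F v0) //.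
- by move=> v; rewrite (frame_arr F a0).
- by move=> v i lt; rewrite (frame_arr F a0) (frame_arr F a1); apply: h3.
Qed.

Record has_order (s : state) (os : seq 'I_n) : Prop := HasOrder {
  order_uniq : uniq os;
  order_len : var s vlen = size os;
  order_ord : forall i, i < size os -> arr s aord i.+1 = nth 0 (map val os) i;
  order_pos : forall v : 'I_n, arr s apos v = if v \in os then (index v os).+1 else 0 }.

Lemma has_order_frame p s s' os : frame p s s' ->
  vlen \notin mvars p -> aord \notin marrs p -> apos \notin marrs p ->
  has_order s os -> has_order s' os.
Proof.
move=> F v0 a0 a1 [h0 h1 h2 h3]; split; rewrite ?(frame_var F v0) //.
- by move=> i lt; rewrite (frame_arr F a0); apply: h2.
- by move=> v; rewrite (frame_arr F a1); apply: h3.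
Qed.

Lemma order_position s os (v : 'I_n) : (forall w, w \in os) ->
  has_order s os -> arr s apos v = position os v.
Proof. by move=> os_full [_ _ _ ->]; rewrite os_full. Qed.

Lemma uniq_size_le (os : seq 'I_n) : uniq os -> size os <= n.
Proof.
by move=> /card_uniqP <-; rewrite -[X in _ <= X]card_ord; apply: max_card.
Qed.

Lemma run_push s os (w : 'I_n) :
  has_order s os -> var s vu = w -> w \notin os ->
  run push s 20 (fun s' => has_order s' (rcons os w)).
Proof.
move=> [Uo ol oo op] uw wos.
have Uw : uniq (rcons os w) by rewrite rcons_uniq wos.
have := uniq_size_le Uw; rewrite size_rcons => lt.
rewrite /push; step; step.
step; split=> //=.
- by rewrite ol size_rcons addn1.
- move=> i; rewrite size_rcons ltnS => le_i; rewrite ol addn1 eqSS uw.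
  rewrite map_rcons nth_rcons size_map; case: ltngtP le_i => // lt_i _.
  exact: oo.
- move=> v; rewrite uw ol (inj_eq val_inj) mem_rcons inE -cats1 index_cat.
  have [->|vw] := eqVneq v w; first by rewrite (negPf wos) /= eqxx addn0 addn1.
  by rewrite op /=; case: ifP.
Qed.

Lemma has_order_set_var s x v os : x != vlen -> has_order s os ->
  has_order (set_var s x v) os.
Proof. by move=> xl [h0 h1 h2 h3]; split=> //=; rewrite eq_sym (negPf xl). Qed.

Lemma run_place_deleted s (ds : seq 'I_n) :
  has_order s [::] -> uniq ds -> var s vd = size ds ->
  (forall i, i < size ds -> arr s ads i = nth 0 (map val ds) i) ->
  run place_deleted s (20 + 60 * n) (fun s' => has_order s' ds).
Proof.
move=> o0 Ud sd dsE; have le_n := uniq_size_le Ud.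
apply: run_weaken (run_for (I := fun i s' => has_order s' (take i ds)) (c := 40) _ _ _ _ _ _ _ _ _ _ (leqnn _)) _ _ => //.
- by rewrite /= sd => _; lia.
- by rewrite take0; apply: has_order_set_var.
- move=> i s' /= ; rewrite sd => lt_i F xi oi.
  have dsi : arr s' ads i = nth 0 (map val ds) i by rewrite (frame_arr F) //; apply: dsE.
  have d0 : 'I_n by case: (ds) lt_i.
  set v := nth d0 ds i.
  have dsi' : arr s' ads i = v by rewrite dsi (nth_map d0).
  step.
  apply: run_weaken (run_push (os := take i ds) (w := v) _ _ _) _ _ => //=.
  - exact: has_order_set_var.
  - by rewrite xi dsi'.
  - by rewrite in_take_leq ?index_uniq ?ltnn // ltnW.
  - move=> s'' _ _ os'' _; apply: has_order_set_var => //.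
    by rewrite (take_nth d0).
- by rewrite /= sd; lia.
- by move=> s' _ _; rewrite /= sd take_size.
Qed.

Lemma eval_deg s (v : 'I_n) :
  has_graph s -> var s vv = v -> eval s deg = size (adj v).
Proof.
by move=> [_ ho _] vE; rewrite /= vE addn1 ho addnC addnK.
Qed.

Lemma eval_neighbour s (v : 'I_n) i : has_graph s -> var s vv = v ->
  var s vx = i -> i < size (adj v) ->
  eval s neighbour = nth v (adj v) i.
Proof.
by move=> [_ _ hn] vE xE lt_i; rewrite /= vE xE hn // (nth_map v).
Qed.

Lemma size_adj v : size (adj v) <= n.
Proof. by apply: uniq_size_le; case: (adjP v). Qed.

Lemma mem_nth_adj v i : i < size (adj v) -> edge G v (nth v (adj v) i).
Proof. by move=> lt_i; have := mem_nth v lt_i; case: (adjP v) => _ ->. Qed.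

(** [J] is whatever the caller maintains about the sequence; it has to survive appending an unplaced
    neighbour of [v]. *)
Lemma run_visit s (v : 'I_n) os (J : seq 'I_n -> Prop) :
  has_graph s -> has_order s os -> var s vv = v -> J os ->
  (forall os' w, J os' -> edge G v w -> w \notin os' -> J (rcons os' w)) ->
  run visit s (20 + size (adj v) * 60) (fun s' => exists2 os', has_order s' os' &
    J os' /\ forall w, edge G v w -> w \in os').
Proof.
move=> gs o0 vE J0 Jr; have dE := eval_deg gs vE.
pose I i s' := exists2 os', has_order s' os' &
    J os' /\ forall j, j < i -> nth v (adj v) j \in os'.
apply: run_weaken (run_for (I := I) (c := 40) _ _ _ _ _ _ _ _ _ _ (leqnn _)) _ _ => //.
- by rewrite dE => _; have := size_adj v; lia.
- by exists os => //; apply: has_order_set_var.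
- move=> i s'; rewrite dE => lt_i F xi [os' oi [Ji all_i]].
  have gs' : has_graph s' by apply: has_graph_frame F _ _ _ gs.
  have vE' : var s' vv = v by rewrite (frame_var F).
  have nE := eval_neighbour gs' vE' xi lt_i; rewrite /= in nE; set w := nth v (adj v) i in nE.
  have vw : edge G v w by apply: mem_nth_adj.
  step.
  rewrite nE.
  have [Uo _ _ op] := oi.
  step; rewrite op.
  + case: ifP => // /negbT wos _; apply: run_weaken (run_push (os := os') (w := w) _ _ _) _ _ => //=.
      exact: has_order_set_var.
    move=> s'' _ _ os'' _; exists (rcons os' w); first exact: has_order_set_var.
    split; first exact: Jr.
    move=> j; rewrite ltnS leq_eqVlt mem_rcons inE => /orP[/eqP -> |lt_j].
      by rewrite eqxx.
    by rewrite all_i ?orbT.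
  + case: ifP => // wos _; step => _; exists os'; first by do 2 (apply: has_order_set_var => //).
    split=> // j; rewrite ltnS leq_eqVlt => /orP[/eqP -> //|]; exact: all_i.
- by rewrite dE.
- move=> s' _ _; rewrite dE => -[os' o' [J' all_w]]; exists os' => //; split=> // w.
  have [_ aE] := adjP v; move=> vw; have wa : w \in adj v by rewrite aE.
  by rewrite -(nth_index v wa); apply: all_w; rewrite index_mem.
Qed.

(** The cost [b] per list entry adds up to a multiple of the degree sum, the source of the term [m]
    in the running time. *)
Lemma run_for_vertices s p (I : nat -> state -> Prop) a b :
  has_graph s -> vv \notin mvars p -> vn \notin mvars p -> I 0 (set_var s vv 0) ->
  (forall (v : 'I_n) s', frame (For vv (Var vn) p) s s' -> var s' vv = v -> I v s' ->
     run p s' (a + b * size (adj v))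
       (fun s'' => frame p s' s'' -> I v.+1 (set_var s'' vv v.+1))) ->
  run (For vv (Var vn) p) s (20 + (a + 20) * n + \sum_(v : 'I_n) b * size (adj v)) (I n).
Proof.
move=> gs vp np I0 step.
have nE : eval s (Var vn) = n by exact: has_n gs.
pose c i := a + b * (arr s aoff i.+1 - arr s aoff i).
apply: run_weaken (run_for_sum (I := I) (c := c) _ _ _ _ _ _ _ _ _ _ (leqnn _)) _ _ => //.
- by rewrite /= np.
- by rewrite nE; lia.
- rewrite nE => i s' lt_i F xi Ii; have := step (Ordinal lt_i) s' F xi Ii.
  by rewrite /c (has_off gs (Ordinal lt_i)) addKn.
- rewrite nE -addnA leq_add2l.
  rewrite (eq_bigr (fun v : 'I_n => (a + 20) + b * size (adj v))).
    by rewrite big_split /= sum_nat_const card_ord mulnC.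
  by move=> v _; rewrite /c (has_off gs v) addKn; lia.
- by move=> s' _ _; rewrite nE.
Qed.

Lemma run_for_neighbours s p (v : 'I_n) (I : nat -> state -> Prop) c :
  has_graph s -> var s vv = v ->
  vx \notin mvars p -> vv \notin mvars p -> aoff \notin marrs p ->
  I 0 (set_var s vx 0) ->
  (forall i s', i < size (adj v) -> frame (For vx deg p) s s' -> var s' vx = i -> I i s' ->
     run p s' c (fun s'' => frame p s' s'' -> I i.+1 (set_var s'' vx i.+1))) ->
  run (For vx deg p) s (20 + size (adj v) * (c + 20)) (I (size (adj v))).
Proof.
move=> gs vE xp vp ap I0 step; have dE := eval_deg gs vE.
apply: run_weaken (run_for (I := I) (c := c) _ _ _ _ _ _ _ _ _ _ (leqnn _)) _ _ => //.
- by rewrite /= vp.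
- by rewrite /= ap.
- by rewrite dE => _; have := size_adj v; lia.
- by rewrite dE.
- by rewrite dE.
- by rewrite dE.
Qed.

End Order.

(** * The graph search and its amortized cost *)

Section Search.
Variables (n : nat) (G H : sgraph 'I_n) (adj : 'I_n -> seq 'I_n) (ds : seq 'I_n).
Variable M : nat.
Hypothesis adjP : adjacency_lists G adj.
Hypothesis HE : forall v w, edge H v w = [&& v \notin ds, w \notin ds & edge G v w].
Hypothesis M_ge : 10 * n + 20 <= M.

Notation run := (run M 40).

Definition processed (s : state) (v : 'I_n) : bool :=
  0 < arr s apos v <= var s vhead.

(** One summand per branch of the loop: roots still to be passed, vertices still to be placed, and
    vertices whose lists are still to be scanned. *)
Definition search_pot (s : state) : nat :=
  60 * (n - var s vroot) + 60 * (n - var s vlen) +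
  \sum_(v : 'I_n | ~~ processed s v) (100 + 80 * size (adj v)).

Record searching (s : state) (ys : seq 'I_n) (c : nat) : Prop := Searching {
  searching_order : has_order s (ds ++ ys);
  searching_seq : search_seq H ys c;
  searching_head : size ds <= var s vhead <= size ds + size ys;
  searching_closed : forall x w, x \in take (var s vhead - size ds) ys ->
    edge H x w -> w \in ys;
  searching_root : var s vroot <= n;
  searching_visited : forall v : 'I_n, v < var s vroot -> v \in ds ++ ys }.

Lemma processed_order s os v : has_order s os ->
  processed s v = (v \in take (var s vhead) os).
Proof.
case=> _ _ _ op; rewrite /processed op; case: ifP => vos.
  by rewrite in_take.
by symmetry; apply/negbTE; apply: contraFN vos => /mem_take.
Qed.

Lemma run_search s : has_graph adj s -> has_order s ds -> var s vd = size ds ->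
  var s vroot = 0 ->
  run search s (20 + 220 * n + \sum_(v : 'I_n) 80 * size (adj v))
    (fun s' => exists ys c, [/\ has_order s' (ds ++ ys), search_seq H ys c &
       forall v, v \in ds ++ ys]).
Proof.
move=> gs o0 sd root0; rewrite /search.
have [Uds _ _ _] := o0; have le_ds := uniq_size_le Uds.
step; set s1 := set_var s 7 (var s 3).
have gs1 : has_graph adj s1 by case: gs; split.
pose I s' := exists ys c, searching s' ys c.
set body := If _ _ _; set cond := Bin Leq _ _.
apply: run_weaken (@run_while M 40 cond body I search_pot s1 _ _ _ _ (leqnn _)) _ _ => //.
- exists [::], 0; split=> //=.
  + by rewrite cats0; apply: has_order_set_var.
  + by rewrite sd; lia.
  + by rewrite root0.
  + by rewrite root0.
- move=> s' F [ys [c [oi ss hd cl rt vi]]] rt'.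
  have gs' : has_graph adj s' by apply: has_graph_frame F _ _ _ gs1.
  have {}rt' : var s' vroot < n by move: rt'; rewrite /= (has_n gs') eqb0 negbK addn1.
  have [Uo ol oo op] := oi; have le_o := uniq_size_le Uo.
  rewrite size_cat in ol le_o.
  have [lt_h|ge_h] := ltnP (var s' vhead) (var s' vlen).
  + set h := var s' vhead in hd cl lt_h *.
    have lt_i : h - size ds < size ys by lia.
    have v0 : 'I_n by case: (ys) lt_i.
    set v := nth v0 ys (h - size ds).
    have vys : v \in ys by apply: mem_nth.
    have ordv : arr s' aord h.+1 = v.
      rewrite oo ?size_cat; last by lia.
      rewrite (nth_map v0) ?size_cat; last by lia.
      by rewrite nth_cat ltnNge (andP hd).1.
    have vds : v \notin ds.
      move: Uo; rewrite cat_uniq => /and3P[_ /hasPn dj _]; exact: dj.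
    exists (50 + size (adj v) * 60); rewrite /body; step; last first.
      by move=> /eqP; rewrite eqb0 addn1 lt_h.
    move=> _; step; step; rewrite addn1.
    set s2 := set_var _ _ _.
    have gs2 : has_graph adj s2 by case: gs'; split.
    have o2 : has_order s2 (ds ++ ys) by do 2 apply: has_order_set_var => //.
    (* All vertices placed in this round are neighbours of [v], so they extend the current component
       and [c] stays the same. *)
    pose J os := exists ys', [/\ os = ds ++ ys', search_seq H ys' c &
      exists zs, ys' = ys ++ zs].
    have vE2 : var s2 vv = v by rewrite /s2 /= ordv.
    have J0 : J (ds ++ ys) by exists ys; split=> //; exists [::]; rewrite cats0.
    have Jr os w : J os -> edge G v w -> w \notin os -> J (rcons os w).
      case=> ys' [-> ss' [zs ys'E]] vw; rewrite mem_cat negb_or => /andP[wds wys'].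
      exists (rcons ys' w); split; first by rewrite rcons_cat.
        apply: (search_seq_child ss' wys' (v := v)); first by rewrite ys'E mem_cat vys.
        by rewrite HE vds wds.
      by exists (rcons zs w); rewrite ys'E rcons_cat.
    apply: run_weaken (run_visit adjP M_ge gs2 o2 vE2 J0 Jr) _ _; first by lia.
    move=> s3 F3 _ [os o3 [[ys' [osE ss' [zs ys'E]]] vcl]]; subst os.
    have h3 : var s3 vhead = h.+1 by rewrite (frame_var F3).
    have r3 : var s3 vroot = var s' vroot by rewrite (frame_var F3).
    have sys' : size ys' = size ys + size zs by rewrite ys'E size_cat.
    have tk : take (h.+1 - size ds) ys' = rcons (take (h - size ds) ys) v.
      by rewrite ys'E takel_cat ?subSn ?(take_nth v0) //; lia.
    split.
      exists ys', c; split=> //.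
      * by rewrite h3; lia.
      * move=> x w; rewrite h3 tk mem_rcons inE => /orP[/eqP ->|].
          rewrite HE => /and3P[_ wds vw]; have := vcl w vw.
          by rewrite mem_cat (negPf wds).
        by move=> xs xw; rewrite ys'E mem_cat (cl _ _ xs xw).
      * by rewrite r3.
      * by move=> u; rewrite r3 ys'E catA mem_cat => /vi ->.
    (* [v] is the only vertex that this round turns into a processed one, and its summand pays for
       the scan. *)
    have hpot : search_pot s' = 60 * (n - var s' vroot) + 60 * (n - var s' vlen) +
        (100 + 80 * size (adj v) + \sum_(u | ~~ processed s3 u) (100 + 80 * size (adj u))).
      rewrite /search_pot (bigD1 v) /=; last first.
        rewrite (processed_order v oi) take_cat -/h ltnNge (andP hd).1 /=.
        rewrite mem_cat (negPf vds) /= in_take // index_uniq ?ltnn //.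
        by move: Uo; rewrite cat_uniq => /and3P[].
      congr (_ + (_ + _)); apply: eq_bigl => u.
      rewrite (processed_order u oi) (processed_order u o3) h3 -/h !take_cat.
      have -> : (h < size ds) = false by lia.
      have -> : (h.+1 < size ds) = false by lia.
      by rewrite tk !mem_cat mem_rcons inE; case: (u == v); case: (u \in ds); case: (u \in take _ _).
    rewrite hpot /search_pot r3 (order_len o3) size_cat sys' ol /=.
    rewrite -/(esize cond); lia.
  + have hlen : var s' vhead = size ds + size ys by rewrite ol in ge_h; lia.
    set r := Ordinal rt'.
    have rE : var s' vroot = r by [].
    exists 40; rewrite /body; step.
      by rewrite addn1 eqb0 negbK ltnNge ge_h.
    move=> _; step.
    * rewrite rE op; case: ifP => // /negbT ros _; step; rewrite rE.
      apply: run_weaken (run_push (os := ds ++ ys) (w := r) _ _ _ _) _ _ => //=.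
        exact: has_order_set_var.
      move=> s2 F2 _ o2.
      have h2 : var s2 vhead = var s' vhead by rewrite (frame_var F2).
      have r2 : var s2 vroot = r by rewrite (frame_var F2).
      have rds : r \notin ds by move: ros; rewrite mem_cat negb_or => /andP[].
      have rys : r \notin ys by move: ros; rewrite mem_cat negb_or => /andP[].
      (* The queue is exhausted, so every vertex of [ys] has been scanned and no edge leaves
         [ys]. *)
      have cl' x w : x \in ys -> edge H x w -> w \in ys.
        by move=> xs; apply: cl; rewrite hlen addKn take_size.
      split.
        exists (rcons ys r), (size ys); split.
        - by rewrite -rcons_cat.
        - exact: search_seq_root ss rys cl'.
        - by rewrite h2 size_rcons hlen; lia.
        - move=> x w; rewrite h2 hlen addKn -cats1 takel_cat // take_size => xs xw.
          by rewrite mem_cat (cl' _ _ xs xw).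
        - by rewrite r2; apply: ltnW.
        - move=> u; rewrite r2 -rcons_cat mem_rcons inE => lt_u.
          by rewrite vi ?orbT.
      rewrite /search_pot r2 (order_len o2) size_rcons size_cat ol rE.
      have -> : \sum_(v | ~~ processed s2 v) (100 + 80 * size (adj v)) =
                \sum_(v | ~~ processed s' v) (100 + 80 * size (adj v)).
        apply: eq_bigl => u; rewrite (processed_order u oi) (processed_order u o2) h2.
        by rewrite hlen -cats1 takel_cat // size_cat.
      by rewrite -/(esize cond); have := uniq_size_le (order_uniq o2);
        rewrite size_rcons size_cat /=; lia.
    * rewrite rE op; case: ifP => // ros _; step.
      split.
        exists ys, c; split=> //=.
        - exact: has_order_set_var.
        - by rewrite rE addn1; apply: ltn_ord.
        - move=> u; rewrite rE addn1 ltnS leq_eqVlt => /orP[/eqP/val_inj -> //|].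
          exact: vi.
      rewrite /search_pot /=.
      rewrite (eq_bigl (fun v => ~~ processed s' v)) //; lia.
- rewrite /search_pot /= root0 (order_len o0).
  have -> : 220 * n = 120 * n + 100 * n by rewrite -mulnDl.
  have : \sum_(v | ~~ processed s1 v) (100 + 80 * size (adj v)) <=
         100 * n + \sum_(v : 'I_n) 80 * size (adj v).
    rewrite mulnC -[X in X * _]card_ord -sum_nat_const -big_split /=.
    by rewrite [X in _ <= X](bigID (fun v => ~~ processed s1 v)) /=; apply: leq_addr.
  move=> le; apply: leq_trans (leq_add (leq_add (leqnn _) le) (leqnn _)) _.
  by move: (\sum_(v < n) _) => B; lia.
- move=> s' F _ [[ys [c [oi ss hd cl rt vi]]] rt'].
  have gs' : has_graph adj s' by apply: has_graph_frame F _ _ _ gs1.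
  exists ys, c; split=> // v; apply: vi; move: rt'; rewrite /= (has_n gs') => /eqP.
  by rewrite eqb0 addn1; have := ltn_ord v; lia.
Qed.

End Search.

(** * The forest of last earlier neighbours *)

Section Link.
Variables (n : nat) (G H : sgraph 'I_n) (adj : 'I_n -> seq 'I_n) (ds ys : seq 'I_n).
Variable M : nat.
Hypothesis adjP : adjacency_lists G adj.
Hypothesis HE : forall v w, edge H v w = [&& v \notin ds, w \notin ds & edge G v w].
Notation os := (ds ++ ys).
Hypothesis os_uniq : uniq os.
Hypothesis os_full : forall v, v \in os.

Notation run := (run M 40).
Notation pos := (position os).

Lemma lt_position v : (size ds < pos v) = (v \notin ds).
Proof.
rewrite /position ltnS index_cat; case: ifP => vds; last exact: leq_addr.
by rewrite leqNgt index_mem vds.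
Qed.

Lemma padj_rest i j :
  padj os H i j = [&& padj os G i j, size ds < i & size ds < j].
Proof.
apply/idP/and3P => [/padj_pos[]//|[/padj_pos[]// _ _ [u [v [-> -> e]]]]].
  move=> _ _ [u [v [-> ->]]]; rewrite HE => /and3P[uds vds e].
  by rewrite padjP // !lt_position.
by rewrite !lt_position padjP // HE => -> ->.
Qed.

Definition earlier i j : bool := padj os H i j && (j < i).

Lemma earlier_lt i j : earlier i j -> j < i.
Proof. by case/andP. Qed.

Lemma earlierE i j :
  earlier i j = padj os G i j && ((size ds < j) && (j < i)).
Proof.
rewrite /earlier padj_rest; case: padj => //=.
by case: (ltnP j i) => // ji; rewrite ?andbF // !andbT; apply/andP/idP => [[]//|]; lia.
Qed.

Definition link_max i (l : seq 'I_n) :=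
  \big[maxn/0]_(w <- l | (size ds < pos w) && (pos w < i)) pos w.
Definition link_num i (l : seq 'I_n) :=
  \sum_(w <- l | (size ds < pos w) && (pos w < i)) 1.

Lemma link_max_adj v : link_max (pos v) (adj v) = last_earlier n earlier (pos v).
Proof.
rewrite /link_max (big_neighbours os_uniq os_full _ v (fun j => (size ds < j) && (j < pos v)) id adjP).
by apply: eq_bigl => j; rewrite earlierE.
Qed.

Lemma link_num_adj v : link_num (pos v) (adj v) = count_earlier n earlier (fun=> true) (pos v).
Proof.
rewrite /link_num (big_neighbours os_uniq os_full _ v (fun j => (size ds < j) && (j < pos v)) (fun=> 1) adjP).
by apply: eq_bigl => j; rewrite earlierE.
Qed.

(** Holds because positions are positive; it justifies testing [apr] in the program instead of
    keeping a counter. *)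
Lemma link_max_eq0 i l : (link_max i l == 0) = (link_num i l == 0).
Proof.
rewrite /link_max /link_num; elim: l => [|w l IH]; first by rewrite !big_nil.
by rewrite !big_cons; case: ifP => // /andP[lt _]; rewrite add1n; lia.
Qed.

(** The outer loop follows the numbering of the vertices whereas [apr] and [atb] are indexed by
    positions, so the finished cells need not form an initial segment. *)
Definition linked_upto (x : nat) (i : nat) : bool :=
  [exists u : 'I_n, (u < x) && (pos u == i)].

Record linking (s : state) (x : nat) : Prop := Linking {
  linking_pr : forall i, arr s apr i =
    if linked_upto x i then last_earlier n earlier i else 0;
  linking_tb : forall i, arr s atb i =
    if linked_upto x i then (1 < count_earlier n earlier (fun=> true) i : nat) else 0 }.

Record linking_row (s : state) (v : 'I_n) (l : seq 'I_n) : Prop := LinkingRow {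
  row_pr : forall i, arr s apr i =
    if i == pos v then link_max i l else
    if linked_upto v i then last_earlier n earlier i else 0;
  row_tb : forall i, arr s atb i =
    if i == pos v then (1 < link_num i l : nat) else
    if linked_upto v i then (1 < count_earlier n earlier (fun=> true) i : nat) else 0 }.

Hypothesis M_ge : 10 * n + 20 <= M.

Lemma run_link_body s (v : 'I_n) i :
  has_graph adj s -> has_order s os -> var s vd = size ds ->
  var s vv = v -> var s vi = pos v -> var s vx = i -> i < size (adj v) ->
  linking_row s v (take i (adj v)) ->
  run link_body s 60 (fun s' => linking_row s' v (take i.+1 (adj v))).
Proof.
move=> gs oi sd vE iE xE lt_i [rp rt].
have nE := eval_neighbour gs vE xE lt_i; rewrite /= in nE.
set w := nth v (adj v) i in nE; have pE := order_position w os_full oi.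
have nbE : arr s 5 (arr s 1 (arr s 0 (var s 9) + var s 10)) = pos w by rewrite nE pE.
have Umx l : link_max (pos v) (rcons l w) =
    if (size ds < pos w) && (pos w < pos v) then maxn (link_max (pos v) l) (pos w)
    else link_max (pos v) l.
  by rewrite /link_max -cats1 big_cat big_cons big_nil /=; case: ifP => _; rewrite !maxn0.
have Unm l : link_num (pos v) (rcons l w) =
    if (size ds < pos w) && (pos w < pos v) then (link_num (pos v) l).+1
    else link_num (pos v) l.
  by rewrite /link_num -cats1 big_cat big_cons big_nil /=; case: ifP => _; rewrite ?addn0 ?addn1.
rewrite /link_body; step; rewrite nbE; step.
  rewrite sd iE !addn1 mulnb eqb0 negbK => C.
  have rpv := rp (pos v); rewrite eqxx in rpv.
  set m := link_max _ _ in rpv.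
  have le_m : m <= n.
    rewrite /m /link_max; elim/big_ind: _ => // [a b ? ?|u _]; first by lia.
    exact: position_le.
  have le_w := position_le os_uniq os_full w.
  apply: (@run_seq _ _ _ _ _ 15).
    by rewrite /=.
  step.
  - rewrite iE rpv => m0; step => _.
    step; rewrite /= iE rpv.
    + move=> lt_w; step; split=> j; rewrite /= ?iE.
        rewrite (take_nth v lt_i) -/w; case: eqVneq => [->|/negPf jv] //.
          by rewrite Umx C; lia.
        by rewrite rp jv.
      rewrite (take_nth v lt_i) -/w; case: eqVneq => [->|/negPf jv] /=.
        rewrite Unm C; have := link_max_eq0 (pos v) (take i (adj v)); rewrite -/m; lia.
      by rewrite rt jv.
    + move=> ge_w; step; split=> j; rewrite /= ?iE.
        rewrite (take_nth v lt_i) -/w rp; case: eqVneq => [->|/negPf jv] //.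
        by rewrite Umx C -/m; lia.
      rewrite (take_nth v lt_i) -/w; case: eqVneq => [->|/negPf jv] /=.
        rewrite Unm C; have := link_max_eq0 (pos v) (take i (adj v)); rewrite -/m; lia.
      by rewrite rt jv.
  - rewrite iE rpv => m0; step => _.
    have n0 : link_num (pos v) (take i (adj v)) = 0.
      by apply/eqP; rewrite -link_max_eq0 -/m m0.
    step; rewrite /= iE rpv; last by lia.
    move=> lt_w; step; split=> j; rewrite /= ?iE.
      rewrite (take_nth v lt_i) -/w; case: eqVneq => [->|/negPf jv].
        by rewrite Umx C; lia.
      by rewrite rp jv.
    rewrite (take_nth v lt_i) -/w rt; case: eqVneq => [->|/negPf jv] //.
    by rewrite Unm C n0.
rewrite sd iE !addn1 mulnb => /eqP; rewrite eqb0 => /negbTE C.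
step; split=> j; rewrite /= (take_nth v lt_i) -/w ?rp ?rt; case: eqP => // ->.
- by rewrite Umx C.
- by rewrite Unm C.
Qed.

Lemma linked_upto_pos x (v : 'I_n) : linked_upto x (pos v) = (v < x).
Proof.
apply/existsP/idP => [[u /andP[lt_u /eqP eq]]|lt_v].
  by rewrite -(position_inj os_full eq).
by exists v; rewrite lt_v eqxx.
Qed.

Lemma linked_uptoS (v : 'I_n) i : i != pos v -> linked_upto v.+1 i = linked_upto v i.
Proof.
move=> iv; apply: eq_existsb => u; rewrite ltnS leq_eqVlt andb_orl.
case: eqP => //= /val_inj ->; rewrite eq_sym (negPf iv).
by rewrite andbF.
Qed.

(** At an index that is no position there are no earlier neighbours, and the initial zeros are
    already correct. *)
Lemma linking_full s i : linking s n ->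
  arr s apr i = last_earlier n earlier i /\
  arr s atb i = (1 < count_earlier n earlier (fun=> true) i).
Proof.
move=> [lp lt]; rewrite lp lt; case: ifP => // ni.
have no j : earlier i j = false.
  apply/negbTE/negP => /andP[/(padj_pos os_uniq os_full)[_ _ [u [_ [iu _ _]]]] _].
  by rewrite iu linked_upto_pos ltn_ord in ni.
rewrite /last_earlier /count_earlier !big_pred0 //.
Qed.

Lemma run_link s :
  has_graph adj s -> has_order s os -> var s vd = size ds ->
  (forall i, arr s apr i = 0) -> (forall i, arr s atb i = 0) ->
  run link s (20 + 60 * n + \sum_(v : 'I_n) 80 * size (adj v)) (fun s' =>
    forall i, arr s' apr i = last_earlier n earlier i /\
      arr s' atb i = (1 < count_earlier n earlier (fun=> true) i)).
Proof.
move=> gs oi sd p0 t0.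
apply: run_weaken (run_for_vertices M_ge (I := fun x s' => linking s' x)
  (a := 40) (b := 80) gs _ _ _ _) _ _ => //.
- have no i : linked_upto 0 i = false by apply/existsP=> -[].
  by split=> i; rewrite no /= ?p0 ?t0.
- move=> v s' F vE [lp lt].
  have gs' : has_graph adj s' by apply: has_graph_frame F _ _ _ gs.
  have oi' : has_order s' os by apply: has_order_frame F _ _ _ oi.
  have sd' : var s' vd = size ds by rewrite (frame_var F).
  step; rewrite vE (order_position v os_full oi'); set s1 := set_var _ _ _.
  have gs1 : has_graph adj s1 by case: gs'; split.
  apply: run_weaken (run_for_neighbours adjP M_ge
    (I := fun i s2 => linking_row s2 v (take i (adj v))) (c := 60) gs1 vE _ _ _ _ _) _ _ => //.
  + by split=> i; rewrite /= take0 ?lp ?lt; case: eqVneq => // ->;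
      rewrite linked_upto_pos ltnn /link_max /link_num big_nil.
  + move=> i s2 lt_i F2 xi row.
    have gs2 : has_graph adj s2 by apply: has_graph_frame F2 _ _ _ gs1.
    have oi2 : has_order s2 os.
      by apply: has_order_frame F2 _ _ _ _ => //; apply: has_order_set_var.
    apply: run_weaken (run_link_body gs2 oi2 _ _ _ xi lt_i row) (leqnn _) _.
    * by rewrite (frame_var F2).
    * by rewrite (frame_var F2).
    * by rewrite (frame_var F2).
    * by move=> s3 _ _ [r1 r2] _; split.
  + by lia.
  + move=> s2 F2 _; rewrite take_size => -[r1 r2] _; split=> i; rewrite /= ?r1 ?r2.
      case: eqVneq => [->|iv]; last by rewrite linked_uptoS.
      by rewrite linked_upto_pos ltnSn link_max_adj.
    case: eqVneq => [->|iv]; last by rewrite linked_uptoS.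
    by rewrite linked_upto_pos ltnSn link_num_adj.
- by move=> s' _ _ ls i; apply: linking_full.
Qed.

End Link.

(** * Computing the table *)

Section Weigh.
Variables (n : nat) (G : sgraph 'I_n) (adj : 'I_n -> seq 'I_n) (os : seq 'I_n).
Variable M : nat.
Hypothesis adjP : adjacency_lists G adj.
Hypothesis M_ge : 10 * n + 20 <= M.
Hypothesis os_uniq : uniq os.
Hypothesis os_full : forall v, v \in os.

Notation run := (run M 40).
Notation pos := (position os).

Definition weight (X : nat -> nat) i := \sum_(j < n.+1 | padj os G i j && (j < i)) X j.

Definition weight_row (X : nat -> nat) v (l : seq 'I_n) :=
  \sum_(w <- l | pos w < pos v) X (pos w).

Lemma weight_row_adj X v : weight_row X v (adj v) = weight X (pos v).
Proof. exact: (big_neighbours os_uniq os_full _ v (fun j => j < pos v) X adjP). Qed.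

Lemma weight_row_le X v l : (forall i, X i <= 1) -> weight_row X v l <= size l.
Proof.
move=> X1; rewrite /weight_row; elim: l => [|w l IH]; first by rewrite big_nil.
by rewrite big_cons /=; case: ifP => _; have := X1 (pos w); lia.
Qed.

Lemma weight_le X i : (forall i, X i <= 1) -> weight X i <= n.
Proof.
move=> X1; case: (pickP (fun v : 'I_n => pos v == i)) => [v /eqP <-|none].
  rewrite -weight_row_adj; apply: leq_trans (weight_row_le _ _ X1) _.
  exact: (size_adj adjP).
rewrite /weight big_pred0 // => j; apply/negbTE/negP => /andP[+ _].
move=> /(padj_pos os_uniq os_full)[_ _ [u [_ [iu _ _]]]].
by have := none u; rewrite iu eqxx.
Qed.

Lemma run_weigh s :
  has_graph adj s -> has_order s os -> (forall i, arr s asel i <= 1) ->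
  run weigh s (20 + 60 * n + \sum_(v : 'I_n) 80 * size (adj v)) (fun s' =>
    forall v : 'I_n, arr s' awt (pos v) = weight (arr s asel) (pos v)).
Proof.
move=> gs oi sel1; set X := arr s asel.
pose I x s' := forall v : 'I_n, v < x -> arr s' awt (pos v) = weight X (pos v).
apply: run_weaken (run_for_vertices M_ge (I := I) (a := 40) (b := 80) gs _ _ _ _) _ _ => //.
  move=> v s' F vE Is.
  have gs' : has_graph adj s' by apply: has_graph_frame F _ _ _ gs.
  have oi' : has_order s' os by apply: has_order_frame F _ _ _ oi.
  step; rewrite vE (order_position v os_full oi').
  step; set s1 := set_arr _ _ _ _.
  have gs1 : has_graph adj s1 by case: gs'; split.
  have oi1 : has_order s1 os by case: oi'; split.
  have X1 : arr s1 asel = X by rewrite /= (frame_arr F).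
  pose J i s2 := (forall u : 'I_n, u < v -> arr s2 awt (pos u) = weight X (pos u)) /\
    arr s2 awt (pos v) = weight_row X v (take i (adj v)).
  apply: run_weaken (run_for_neighbours adjP M_ge (I := J) (c := 50) gs1 vE _ _ _ _ _) _ _ => //.
  - split=> [u lt_u|] /=; last by rewrite eqxx take0 /weight_row big_nil.
    case: eqP => [/(position_inj os_full) uv|_]; first by rewrite uv ltnn in lt_u.
    exact: Is.
  - move=> i s2 lt_i F2 xi [Ju Jv].
    have gs2 : has_graph adj s2 by apply: has_graph_frame F2 _ _ _ gs1.
    have oi2 : has_order s2 os by apply: has_order_frame F2 _ _ _ oi1.
    have vE2 : var s2 vv = v by rewrite (frame_var F2).
    have iE2 : var s2 vi = pos v by rewrite (frame_var F2).
    have XE2 : arr s2 asel = X by rewrite (frame_arr F2).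
    have nE := eval_neighbour gs2 vE2 xi lt_i; rewrite /= in nE.
    set w := nth v (adj v) i in nE.
    step; rewrite nE (order_position w os_full oi2).
    have tk : weight_row X v (take i.+1 (adj v)) = weight_row X v (take i (adj v)) +
        (if pos w < pos v then X (pos w) else 0).
      by rewrite (take_nth v lt_i) /weight_row -cats1 big_cat big_cons big_nil /= addn0.
    step; rewrite iE2 addn1.
    + rewrite eqb0 negbK => lt_w; rewrite lt_w in tk.
      step; rewrite iE2 Jv XE2.
        move=> _; have := sel1 (pos w); rewrite -/X.
        have := weight_row_le v (take i (adj v)) sel1; rewrite -/X.
        by have := size_take_min i (adj v); have := size_adj adjP v; lia.
      move=> _; split=> [u lt_u|] /=; last by rewrite eqxx tk.
      case: eqP => [/(position_inj os_full) uv|_]; first by rewrite uv ltnn in lt_u.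
      exact: Ju.
    + move/eqP; rewrite eqb0 => /negbTE lt_w; rewrite lt_w addn0 in tk.
      by step => _; split=> [u lt_u|]; [exact: Ju | rewrite tk].
  - lia.
  - move=> s2 F2 _ [Ju Jv] _ u; rewrite /= ltnS leq_eqVlt => /orP[/eqP/val_inj -> |]; last exact: Ju.
    by rewrite Jv take_size weight_row_adj.
by move=> s' _ _ Is v; apply: Is.
Qed.

End Weigh.

(** * The initial table *)

Section Fill.
Variables (n k : nat) (M : nat).
Notation K := k.+1.
Notation P := (2 * K * K).
Hypothesis k_le : k <= n.
Hypothesis M_ge : 10 * n + 20 <= M.
Hypothesis M_tab : n.+1 * P + 10 <= M.
Notation run := (run M 40).

(** The guess binds only positions in [(lo, hi]]; all others, including the other half of the
    deletion set, may be chosen. The dummy root [0] may not. *)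
Definition fits_guess (lo hi : nat) (X : nat -> nat) i : bool :=
  (0 < i) && ((X i == 1) || ~~ (lo < i <= hi)).

Lemma run_fill s w :
  var s vn = n -> var s vK = K -> var s vP = P ->
  (forall i, 0 < i <= n -> arr s awt i = w i) -> (forall i, w i <= n) ->
  (forall i, arr s asel i <= 1) ->
  let al0 i := arr s asel i == 0 in
  let al1 := fits_guess (var s vlo) (var s vhi) (arr s asel) in
  run fill s (20 + n.+1 * P * 140) (fun s' => forall u q j,
    u <= n -> q < 2 * K -> j < K ->
    arr s' aval ((u * (2 * K) + q) * K + j) =
      (if odd q then (j == 1) * al1 u * (w u + q./2 + 1) else (j == 0) * al0 u) /\
    arr s' alst (((u * (2 * K) + q) * K + j) * K) = u).
Proof.
move=> nE KE PE wtE w_le sel1 al0 al1.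
have P0 : 0 < P by lia.
pose value e := let i := e %/ P in let q := e %% P %/ K in let j := e %% K in
  if odd q then (j == 1) * al1 i * (w i + q./2 + 1) else (j == 0) * al0 i.
pose I z s' := forall e, e < z ->
  arr s' aval e = value e /\ arr s' alst (e * K) = e %/ P.
have limE : eval s ((Var vn + #1) * Var vP)%ram = n.+1 * P.
  by rewrite /= nE PE addn1.
apply: run_weaken (run_for (I := I) (c := 120) _ _ _ _ _ _ _ _ _ _ (leqnn _)) _ _ => //.
- by rewrite limE; lia.
- rewrite limE => z s' lt_z F zE Is.
  have nE' : var s' vn = n by rewrite (frame_var F).
  have KE' : var s' vK = K by rewrite (frame_var F).
  have PE' : var s' vP = P by rewrite (frame_var F).
  have loE' : var s' vlo = var s vlo by rewrite (frame_var F).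
  have hiE' : var s' vhi = var s vhi by rewrite (frame_var F).
  have selE' : arr s' asel = arr s asel by rewrite (frame_arr F).
  have wtE' : arr s' awt = arr s awt by rewrite (frame_arr F).
  set i := z %/ P; set q := z %% P %/ K; set j := z %% K.
  have le_i : i <= n by rewrite -ltnS ltn_divLR.
  have lt_q : q < 2 * K by rewrite ltn_divLR // ltn_mod.
  have lt_j : j < K by rewrite ltn_mod.
  have bb (b1 b2 b3 : bool) x : b1 * b2 * b3 * x <= x.
    by case: b1; case: b2; case: b3; rewrite ?mul0n ?mul1n.
  have lt_iM : i < M by apply: leq_ltn_trans le_i _; lia.
  have lt_qM : q < M by apply: leq_trans lt_q _; lia.
  have lt_jM : j < M by apply: leq_trans lt_j _; lia.
  step; first by rewrite zE PE' => _.
  step; first by rewrite zE KE' PE' => _.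
  step; try by rewrite zE KE' => _.
  step.
  rewrite zE KE' PE' -/i -/q -/j.
  have fin b s2 : arr s2 aval = arr (set_arr s' aval z b) aval ->
      arr s2 alst = arr (set_arr s' alst (z * K) i) alst -> b = value z -> I z.+1 s2.
    move=> e1 e2 bE e; rewrite ltnS leq_eqVlt e1 e2 /= => /orP[/eqP -> |lt_e].
      by rewrite !eqxx bE.
    have := Is e lt_e; rewrite eqn_pmul2r //; case: eqP lt_e => [->|//]; by rewrite ltnn.
  step; rewrite modn2.
  + rewrite eqb0 negbK => oq; step.
      rewrite loE' hiE' selE' wtE' => _.
      have [->|i0] := posnP i; first by rewrite muln0 mul0n; lia.
      have := w_le i; rewrite (wtE i) ?i0 // => wi.
      apply: leq_ltn_trans (bb _ _ _ _) _; rewrite divn2; lia.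
    move=> _; rewrite zE; apply: fin; [reflexivity | reflexivity | ].
    rewrite /value -/i -/q -/j oq loE' hiE' selE' wtE' divn2 /al1 /fits_guess.
    have [->|i0] := posnP i; first by rewrite !muln0.
    rewrite (wtE i) ?i0 // muln1; congr (_ * _ * _).
    by have := sel1 i; rewrite /fits_guess; lia.
  + move/eqP; rewrite eqb0 => /negbTE oq; step.
    move=> _; rewrite zE; apply: fin; [reflexivity | reflexivity | ].
    by rewrite /value -/i -/q -/j oq selE'.
- by rewrite limE; lia.
- move=> s' _ _; rewrite limE => Is u q j le_u lt_q lt_j.
  set e := _ * K + j.
  have eP : e = u * P + (q * K + j) by rewrite /e mulnDl -addnA -mulnA.
  have lt_p : q * K + j < P.
    by apply: (@leq_trans (q * K + K)); [rewrite ltn_add2l | rewrite -mulSnr leq_mul2r].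
  have lt_e : e < n.+1 * P.
    by rewrite eP; apply: (@leq_trans (u * P + P)); [rewrite ltn_add2l | rewrite -mulSnr leq_mul2r ltnS le_u orbT].
  have [-> ->] := Is e lt_e; rewrite /value.
  have -> : e %/ P = u by rewrite eP divnMDl // divn_small // addn0.
  have -> : e %% P = q * K + j by rewrite eP modnMDl modn_small.
  have -> : e %% K = j by rewrite /e modnMDl modn_small.
  by rewrite divnMDl // divn_small // addn0.
Qed.

End Fill.

(** * Updating one table entry *)

Section Merge.
Variables (n k M : nat).
Notation K := k.+1.
Notation P := (2 * K * K).
Hypothesis k_le : k <= n.
Hypothesis M_ge : 10 * n + 20 <= M.
Notation run := (run M 40).

Definition split_left (s : state) e x := arr s aval (e - x./2).
Definition split_right (s : state) i c x :=
  arr s aval ((i * (2 * K) + (2 * c + odd x)) * K + x./2).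

(** Only a nonzero [v] certifies a split. The range of [a] is needed in any case, since [copy_split]
    computes addresses from it even if no split was found. *)
Record is_best_split (A B : nat -> nat) (N v a : nat) : Prop := IsBestSplit {
  best_arg : a <= N.-1;
  best_found : v != 0 -> [/\ a < N, A a != 0, B a != 0 & v = A a + B a - 1];
  best_max : forall x, x < N -> A x != 0 -> B x != 0 -> A x + B x - 1 <= v }.

Lemma run_best_split s i u p j c :
  var s vi = i -> var s vu = u -> var s vz = p -> var s vj = j -> var s vc = c ->
  var s vK = K -> var s vP = P -> j <= k ->
  (forall x, x < 2 * j.+1 -> split_left s (u * P + p) x + split_right s i c x <= M) ->
  run best_split s (40 + 300 * K) (fun s' =>
    is_best_split (split_left s (u * P + p)) (split_right s i c) (2 * j.+1)
      (var s' vval) (var s' varg)).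
Proof.
move=> iE uE pE jE cE KE PE le_j ABM.
set A := split_left s _ in ABM *; set B := split_right s i c in ABM *.
have AE x : arr s aval (u * P + p - x./2) = A x by [].
have BE x : arr s aval ((i * (2 * K) + (2 * c + odd x)) * K + x./2) = B x by [].
clearbody A B.
rewrite /best_split; step; step; set s1 := set_var _ _ _.
have limE : eval s1 (#2 * (Var vj + #1))%ram = 2 * j.+1 by rewrite /= jE addn1.
pose I x s' := is_best_split A B x (var s' vval) (var s' varg).
apply: run_weaken (run_for (I := I) (c := 100) _ _ _ _ _ _ _ _ _ _ (leqnn _)) _ _ => //.
- by rewrite limE => _; lia.
- rewrite limE => x s' lt_x F xE [ba bf bm].
  have bE : (var s' vi * (2 * var s' vK) + (2 * var s' vc + var s' vx %% 2)) * var s' vK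
      + var s' vx %/ 2 = (i * (2 * K) + (2 * c + odd x)) * K + x./2.
    by rewrite xE !(frame_var F) //= iE KE cE modn2 divn2.
  have wE : var s' vu * var s' vP + var s' vz - var s' vx %/ 2 = u * P + p - x./2.
    by rewrite xE !(frame_var F) //= uE PE pE divn2.
  have vE' : arr s' aval = arr s aval by rewrite (frame_arr F).
  have le_M := ABM x lt_x.
  step; rewrite bE vE' BE.
  step; rewrite wE vE' AE.
  have new : B x * A x != 0 -> var s' vval < B x + A x ->
      is_best_split A B x.+1 (B x + A x - 1) x.
    move=> nz lt; split=> //.
      by rewrite muln_eq0 negb_or in nz; case/andP: nz => nB nA; split=> //; rewrite addnC.
    move=> y; rewrite ltnS leq_eqVlt => /orP[/eqP -> |lt_y nA nB]; first by rewrite addnC.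
    by have := bm y lt_y nA nB; lia.
  have old : (B x * A x != 0 -> B x + A x <= var s' vval) ->
      is_best_split A B x.+1 (var s' vval) (var s' varg).
    move=> nz; split; first by apply: leq_trans ba (leq_pred _).
      by move=> /bf[? ? ? ?]; split=> //; apply: ltnW.
    move=> y; rewrite ltnS leq_eqVlt => /orP[/eqP -> |lt_y] nA nB; last exact: bm.
    have := nz; rewrite muln_eq0 negb_or nA nB => /(_ isT); lia.
  step; rewrite !mulnb.
  + rewrite eqb0 negbK; case/andP=> /andP[nB nA] lt; step.
    step=> _; rewrite /I /=; rewrite xE; apply: new; last by rewrite addn1 in lt.
    by rewrite muln_eq0 negb_or -!lt0n nB.
  + move=> nb; step => _; rewrite /I /=; apply: old.
    rewrite muln_eq0 negb_or -!lt0n => /andP[nB nA].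
    by move: nb => /eqP; rewrite eqb0 nB nA /= addn1 -leqNgt.
- by rewrite limE; lia.
- by move=> s' _ _; rewrite limE.
Qed.

Definition list_row (s : state) e j := mkseq (fun x => arr s alst (e * K + x)) j.

Lemma run_copy_split s i u p j c v a :
  let e := u * P + p in
  let e' := (i * (2 * K) + (2 * c + odd a)) * K + a./2 in
  var s vi = i -> var s vu = u -> var s vz = p -> var s vj = j -> var s vc = c ->
  var s vK = K -> var s vP = P -> var s vval = v -> var s varg = a ->
  j <= k -> e' != e ->
  run copy_split s (60 + 100 * K) (fun s' =>
    [/\ arr s' aval = arr (set_arr s aval e v) aval,
        (forall f x, f != e -> x < K -> arr s' alst (f * K + x) = arr s alst (f * K + x)) &
        a./2 <= j -> a./2 <= e -> list_row s' e j = list_row s (e - a./2) (j - a./2) ++ list_row s e' a./2]).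
Proof.
move=> e e' iE uE pE jE cE KE PE vE aE le_j ne.
rewrite /copy_split; step; rewrite uE PE pE vE -/e.
step.
rewrite jE aE divn2; set s1 := set_var _ _ _.
have limE : eval s1 (Var vj) = j by rewrite /= jE.
pose target x := if x < j - a./2 then arr s alst ((e - a./2) * K + x)
  else arr s alst (e' * K + (x - (j - a./2))).
pose I x s' := [/\ forall y, y < x -> arr s' alst (e * K + y) = target y,
  forall y, x <= y -> y < K -> arr s' alst (e * K + y) = arr s alst (e * K + y) &
  forall f y, f != e -> y < K -> arr s' alst (f * K + y) = arr s alst (f * K + y)].
(* Rows of [K] cells are disjoint, so row and offset can be read off an address. *)
have cell f g y y' : y < K -> y' < K -> (f * K + y == g * K + y') = (f == g) && (y == y').
  move=> lt_y lt_y'; apply/eqP/andP => [eq|[/eqP -> /eqP ->] //].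
  have := congr1 (divn^~ K) eq; rewrite !divnMDl // !divn_small // !addn0 => fg.
  by split; [apply/eqP | move: eq; rewrite fg => /addnI ->].
apply: run_weaken (run_for (I := I) (c := 70) _ _ _ _ _ _ _ _ _ _ (leqnn _)) _ _ => //.
- by rewrite limE => _; lia.
- rewrite limE => x s' lt_x F xE [It Ir Io].
  have lt_xK : x < K by lia.
  have eE : (var s' vu * var s' vP + var s' vz) * var s' vK + var s' vx = e * K + x.
    by rewrite xE !(frame_var F) //= uE PE pE KE.
  have bE : var s' vb = j - a./2 by rewrite (frame_var F).
  have lE : (var s' vu * var s' vP + var s' vz - var s' varg %/ 2) * var s' vK + var s' vx =
      (e - a./2) * K + x.
    by rewrite xE !(frame_var F) //= uE PE pE KE aE divn2.
  have rE : ((var s' vi * (2 * var s' vK) + (2 * var s' vc + var s' varg %% 2)) * var s' vK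
      + var s' varg %/ 2) * var s' vK + (var s' vx - var s' vb) =
      e' * K + (x - (j - a./2)).
    by rewrite bE xE !(frame_var F) //= iE cE KE aE divn2 modn2.
  have fin val : val = target x -> I x.+1 (set_var (set_arr s' 11 (e * K + x) val) vx x.+1).
    move=> vt; split=> [y|y lt_y lt_yK|f y nf lt_yK] /=.
    - rewrite ltnS eqn_add2l => le_y; case: eqVneq => [->|xy]; first by rewrite vt.
      by apply: It; rewrite ltn_neqAle xy.
    - by rewrite eqn_add2l; case: eqP lt_y => [->|_ lt_y]; [rewrite ltnn | apply: Ir => //; apply: ltnW].
    - by rewrite cell // (negPf nf); apply: Io.
  step; rewrite xE bE addn1.
  + rewrite eqb0 negbK => lt; step; rewrite eE lE => _; apply: fin.
    (* If the source row is the target row itself, its cell [x] has not been overwritten yet. *)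
    rewrite /target lt; case: (eqVneq (e - a./2) e) => [->|ne']; first by rewrite Ir.
    by rewrite Io.
  + move/eqP; rewrite eqb0 => /negbTE lt; step; rewrite eE rE => _; apply: fin.
    by rewrite /target lt Io //; apply: leq_ltn_trans (leq_subr _ _) _.
- by rewrite limE; lia.
- move=> s' F _; rewrite limE => -[It _ Io]; split=> //.
    by rewrite (frame_arr F).
  move=> le_a le_e; apply: (@eq_from_nth _ 0).
    by rewrite size_cat !size_mkseq subnK.
  move=> x; rewrite size_mkseq => lt_x; rewrite nth_cat size_mkseq nth_mkseq // It // /target.
  by case: ltnP => le_x; rewrite nth_mkseq //; lia.
Qed.

End Merge.

(** * Merging all nodes into the root *)

Section MergeAll.
Variables (n k M : nat).
Notation K := k.+1.
Notation P := (2 * K * K).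
Variables (pr : nat -> nat) (tb : nat -> bool) (w : nat -> nat).
Variable cnt : (nat -> bool) -> nat -> nat.
Variables al0 al1 : nat -> bool.
Hypothesis pr_lt : forall i, 0 < i <= n -> pr i < i.
Hypothesis cnt_rec : forall S i, S 0 = false -> 0 < i <= n ->
  cnt S i = S (pr i) + tb i * cnt S (pr i).
Hypothesis cnt_le : forall (S : nat -> bool) i, cnt S i <= \sum_(x < n.+1) S x.
Hypothesis k_le : k <= n.
Hypothesis al1_0 : al1 0 = false.
Hypothesis M_ge : 10 * n + 20 <= M.
Hypothesis M_tab : n.+1 * P + 10 <= M.
Hypothesis M_val : 2 * n * n + 10 <= M.
Notation run := (run M 40).

Definition entry (s : state) z u q j : Prop :=
  let e := (u * (2 * K) + q) * K + j in
  entry_ok n k pr w cnt al0 al1 z u q j (arr s aval e) (list_row k s e j).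

Definition same_entry (s s' : state) f : Prop :=
  arr s' aval f = arr s aval f /\
  forall x, x < K -> arr s' alst (f * K + x) = arr s alst (f * K + x).

Lemma same_row s s' f j : same_entry s s' f -> j < K -> list_row k s' f j = list_row k s f j.
Proof.
move=> [_ same] lt_j; apply/eq_in_map => x; rewrite mem_iota => /andP[_ lt_x].
by apply: same; apply: ltn_trans lt_j.
Qed.

Lemma same_entry_ok s s' z u q j :
  same_entry s s' ((u * (2 * K) + q) * K + j) -> j < K ->
  entry s z u q j -> entry s' z u q j.
Proof. by move=> same lt_j; rewrite /entry (same_row same lt_j) (proj1 same). Qed.

Lemma indexE u q j : (u * (2 * K) + q) * K + j = u * P + (q * K + j).
Proof. by rewrite mulnDl -addnA -mulnA. Qed.

Lemma index_lt q j : q < 2 * K -> j < K -> q * K + j < P.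
Proof.
move=> lt_q lt_j; apply: (@leq_trans (q * K + K)); first by rewrite ltn_add2l.
by rewrite -mulSnr leq_mul2r.
Qed.

Lemma node_lt u v p : u < v -> p < P -> u * P + p < v * P.
Proof.
move=> lt_uv lt_p; apply: (@leq_trans (u * P + P)); first by rewrite ltn_add2l.
by rewrite -mulSnr leq_mul2r lt_uv orbT.
Qed.

(** The last [t] entries of the predecessor are new; all else agrees with the state [s0] before this
    merge, to whose entries the update rule refers. *)
Definition merging (s0 s : state) z t : Prop :=
  let u := pr (n - z) in
  (forall q j, q < 2 * K -> j < K -> P - t <= q * K + j -> entry s z.+1 u q j) /\
  (forall f, ~~ (u * P + (P - t) <= f < u * P + P) -> same_entry s0 s f).

Lemma run_set_entry s t i (b : bool) :
  t < P -> var s vi = i -> var s vt = t -> var s vK = K -> var s vP = P ->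
  arr s atb i = b ->
  run set_entry s 40 (fun s' => exists q j,
    [/\ [/\ q < 2 * K, j < K & q * K + j = P - 1 - t],
       var s' vz = q * K + j, var s' vj = j & var s' vc = minn (odd q + b * q./2) k]).
Proof.
move=> lt_t iE tE KE PE bE; set p := P - 1 - t; set q := p %/ K; set j := p %% K.
have lt_p : p < P by rewrite /p; lia.
have lt_q : q < 2 * K by rewrite ltn_divLR.
have lt_j : j < K by rewrite ltn_mod.
have pE : p = q * K + j by apply: divn_eq.
have PM : P + 10 <= M by apply: leq_trans M_tab; rewrite leq_add2r leq_pmull.
have KP : 2 * K <= P by rewrite leq_pmulr.
have pM : p < M by apply: ltn_trans lt_p _; apply: leq_trans PM; lia.
have qM : q < M by apply: leq_trans lt_q _; lia.
have jM : j < M by apply: leq_trans lt_j _; lia.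
pose c := odd q + b * q./2.
have c_le : c <= K by rewrite /c; clear -lt_q; case: b; case: (odd q); lia.
have cM : c < M by apply: leq_ltn_trans c_le _; clear -PM KP; lia.
(* As [c] is at most [K = k + 1], subtracting the truth value of the test is the same as truncating
   at [k]. *)
have cE : c - (K <= c) = minn c k by clear -c_le; lia.
apply: (@run_assign_seq); [by [] | by rewrite /= PE tE | by [] | rewrite /= PE tE -/p].
apply: (@run_assign_seq); [by [] | by rewrite /= KE | by [] | rewrite /= KE -/j].
apply: (@run_assign_seq); [by [] | by rewrite /= KE | by [] | rewrite /= KE -/q].
apply: (@run_assign_seq); [by [] | by rewrite /= iE bE modn2 divn2 | by [] | rewrite /= iE bE modn2 divn2 -/c].
apply: (@run_assign); [by [] | by rewrite /= KE cE => _; apply: leq_ltn_trans (geq_minl _ _) cM | by [] | rewrite /= KE cE].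
by exists q, j.
Qed.

Lemma run_merge_entry s0 s z t :
  z < n -> t < P ->
  (forall u q j, u <= n - z -> q < 2 * K -> j < K -> entry s0 z u q j) ->
  var s vi = n - z -> var s vu = pr (n - z) -> var s vt = t ->
  var s vK = K -> var s vP = P -> arr s atb (n - z) = tb (n - z) ->
  merging s0 s z t ->
  run merge_entry s (200 + 400 * K) (fun s' => merging s0 s' z t.+1).
Proof.
set i := n - z; set u := pr i => lt_z lt_t ent0 iE uE tE KE PE tbE [new same].
have lt_u : u < i by apply: pr_lt; rewrite /i; lia.
have le_u : u <= i by apply: ltnW.
rewrite /merge_entry.
apply: (@run_seq _ _ _ _ _ 40); first by [].
apply: run_weaken (run_set_entry lt_t iE tE KE PE tbE) (leqnn _) _.
move=> s1 _ _ [q [j [[lt_q lt_j pE] zE jE cE]]] F1.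
set p := q * K + j in pE zE; set c := minn _ k in cE.
have {}iE : var s1 vi = i by rewrite (frame_var F1).
have {}uE : var s1 vu = u by rewrite (frame_var F1).
have {}KE : var s1 vK = K by rewrite (frame_var F1).
have {}PE : var s1 vP = P by rewrite (frame_var F1).
have le_q : q./2 <= k by clear -lt_q; lia.
have le_ck : c <= k by apply: geq_minr.
have le_jk : j <= k by [].
have same1 f : ~~ (u * P + (P - t) <= f < u * P + P) -> same_entry s0 s1 f.
  have v1 : arr s1 aval = arr s aval by rewrite (frame_arr F1).
  have l1 : arr s1 alst = arr s alst by rewrite (frame_arr F1).
  by move=> /same; rewrite /same_entry v1 l1.
pose e := u * P + p; pose valu j' := arr s0 aval ((u * (2 * K) + q) * K + j').
pose vali b j' := arr s0 aval ((i * (2 * K) + (2 * c + nat_of_bool b)) * K + j').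
have eu j' : j' <= j -> entry s0 z u q j'.
  by move=> le_j'; apply: ent0 => //; apply: leq_ltn_trans lt_j.
have lt_b (b : bool) : 2 * c + b < 2 * K by case: b; lia.
have ei j' (b : bool) : j' <= j -> entry s0 z i (2 * c + b) j'.
  by move=> le_j'; apply: ent0 => //; apply: leq_ltn_trans lt_j.
(* The left part of a split is read at an index at most [e], where the decreasing loop has changed
   nothing yet. *)
have same_u f : f <= e -> same_entry s0 s1 f.
  move=> le_f; apply: same1; rewrite negb_and -!ltnNge ltnS; apply/orP; left.
  by apply: leq_ltn_trans le_f _; rewrite /e ltn_add2l pE; clear -lt_t; lia.
(* The cells of [i] lie beyond all those of [u], because [u < i]. *)
have same_i q' j' : q' < 2 * K -> j' < K -> same_entry s0 s1 ((i * (2 * K) + q') * K + j').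
  move=> lt_q' lt_j'; apply: same1; rewrite indexE negb_and -!leqNgt.
  have -> : u * P + P = u.+1 * P by rewrite (mulSnr u).
  have : u.+1 * P <= i * P by rewrite leq_mul2r lt_u orbT.
  by move=> le_P; apply/orP; right; apply: leq_trans le_P (leq_addr _ _).
have AE x : x < 2 * j.+1 -> split_left s1 e x = valu (j - x./2).
  move=> lt_x; rewrite /split_left /valu indexE (proj1 (same_u _ (leq_subr _ _))).
  by congr (arr s0 aval _); rewrite /e /p !addnA addnBA //; clear -lt_x; lia.
have BE x : x < 2 * j.+1 -> split_right k s1 i c x = vali (odd x) x./2.
  by move=> lt_x; rewrite /split_right /vali (proj1 (same_i _ _ _ _)) //; lia.
have valu_le j' : j' <= j -> valu j' <= 2 * n * j' + 1 by move=> /eu[].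
have vali_le b j' : j' <= j -> vali b j' <= 2 * n * j' + 1 by move=> /(ei _ b)[].
have ABM x : x < 2 * j.+1 -> split_left s1 (u * P + p) x + split_right k s1 i c x <= M.
  move=> lt_x; rewrite -/e AE // BE //.
  have h1 := valu_le _ (leq_subr x./2 j); have h2 : vali (odd x) x./2 <= 2 * n * x./2 + 1.
    by apply: vali_le; lia.
  have h3 : 2 * n * (j - x./2) + 2 * n * x./2 = 2 * n * j by rewrite -mulnDr subnK //; lia.
  have : 2 * n * j <= 2 * n * n by rewrite leq_mul2l; apply/orP; right; lia.
  lia.
apply: (@run_seq _ _ _ _ _ (40 + 300 * K)); first by rewrite /=; lia.
apply: run_weaken (run_best_split k_le M_ge iE uE zE jE cE KE PE le_jk ABM) (leqnn _) _.
rewrite -/e; move=> s2 _ _ best F2.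
set v := var s2 vval in best; set a := var s2 varg in best.
pose e' := (i * (2 * K) + (2 * c + odd a)) * K + a./2.
case: best => ba bf bm.
have le_a : a./2 <= j by clear -ba; lia.
have lt_aK : a./2 < K by apply: leq_ltn_trans lt_j.
have far_i q' j' : q' < 2 * K -> j' < K -> (i * (2 * K) + q') * K + j' != e.
  move=> lt_q' lt_j'; rewrite indexE; apply/eqP => eq.
  have := node_lt lt_u (index_lt lt_q lt_j); rewrite -/p -/e -eq.
  by rewrite ltnNge leq_addr.
have ne_e' : e' != e by apply: far_i.
have {}iE : var s2 vi = i by rewrite (frame_var F2).
have {}uE : var s2 vu = u by rewrite (frame_var F2).
have {}zE : var s2 vz = p by rewrite (frame_var F2).
have {}jE : var s2 vj = j by rewrite (frame_var F2).
have {}cE : var s2 vc = c by rewrite (frame_var F2).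
have {}KE : var s2 vK = K by rewrite (frame_var F2).
have {}PE : var s2 vP = P by rewrite (frame_var F2).
have same2 f : same_entry s0 s1 f -> same_entry s0 s2 f.
  have v2 : arr s2 aval = arr s1 aval by rewrite (frame_arr F2).
  have l2 : arr s2 alst = arr s1 alst by rewrite (frame_arr F2).
  by rewrite /same_entry v2 l2.
apply: run_weaken (run_copy_split k_le M_ge iE uE zE jE cE KE PE
  (erefl v) (erefl a) le_jk ne_e') _ _; first by rewrite /=; lia.
rewrite -/e -/e' => s3 _ _ [val3 lst3 row3].
have same3 f : f != e -> same_entry s0 s1 f -> same_entry s0 s3 f.
  move=> fe /same2[eqv eql]; split=> [|x lt_x]; first by rewrite val3 /= (negPf fe).
  by rewrite lst3 // eql.
have le_ae : a./2 <= e.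
  apply: leq_trans le_a _; rewrite /e /p addnA; exact: leq_addl.
have ejE : e - a./2 = (u * (2 * K) + q) * K + (j - a./2).
  by rewrite indexE /e /p !addnA addnBA.
have row_new : list_row k s3 e j =
    list_row k s0 (e - a./2) (j - a./2) ++ list_row k s0 e' a./2.
  rewrite (row3 le_a le_ae); congr (_ ++ _).
    by apply: same_row; [apply/same2/same_u/leq_subr | apply: leq_ltn_trans lt_j; apply: leq_subr].
  by apply: same_row => //; apply/same2/same_i.
have new_e : entry s3 z.+1 u q j.
  rewrite /entry indexE -/p -/e val3 /= eqxx row_new.
  apply: (entry_merge (c := c) (vu := valu)
    (lu := fun j' => list_row k s0 ((u * (2 * K) + q) * K + j') j') (vi := vali)
    (li := fun (b : bool) j' => list_row k s0 ((i * (2 * K) + (2 * c + b)) * K + j') j')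
    pr_lt k_le cnt_rec cnt_le al1_0 lt_z le_q le_jk (erefl _) eu ei).
    move=> v0; exists a./2, (odd a); have [lt_a nA nB vE] := bf v0.
    by rewrite AE // in nA vE; rewrite BE // in nB vE; split=> //; rewrite ejE.
  (* The loop of [best_split] tries the split [(j', b)] when its counter is [2 * j' + b]. *)
  move=> j' b le_j' nu ni; have lt_x : 2 * j' + b < 2 * j.+1 by clear -le_j'; case: b; lia.
  have hx : (2 * j' + b)./2 = j' by clear; case: b; lia.
  have ox : odd (2 * j' + b) = b by clear; case: b; lia.
  by have := bm _ lt_x; rewrite AE // BE // hx ox; apply.
have e_out : ~~ (u * P + (P - t) <= e < u * P + P).
  by rewrite negb_and -ltnNge; apply/orP; left; rewrite /e ltn_add2l pE; clear -lt_t; lia.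
split.
  move=> q' j' lt_q' lt_j' le_p'; case: (eqVneq (q' * K + j') p) => [eq|ne].
    have qq : q' = q.
      by have := congr1 (divn^~ K) eq; rewrite /p !divnMDl // !divn_small // !addn0.
    have jj : j' = j by move: eq; rewrite qq => /addnI.
    by rewrite qq jj.
  have lt_p' : P - t <= q' * K + j' by clear -ne le_p' pE lt_t; lia.
  have f_ne : (u * (2 * K) + q') * K + j' != e by rewrite indexE eqn_add2l.
  have ent := new q' j' lt_q' lt_j' lt_p'.
  apply: (same_entry_ok _ lt_j' ent); split.
    rewrite val3 /= (negPf f_ne); have v2 : arr s2 aval = arr s1 aval by rewrite (frame_arr F2).
    by rewrite v2 (frame_arr F1).
  move=> x lt_x; rewrite lst3 //; have l2 : arr s2 alst = arr s1 alst by rewrite (frame_arr F2).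
  by rewrite l2 (frame_arr F1).
move=> f out; apply: same3.
  apply: contraNneq out => ->; rewrite /e leq_add2l ltn_add2l pE.
  by apply/andP; split; clear -lt_t; lia.
apply: same1; apply: contra out => /andP[h ->]; rewrite andbT.
by apply: leq_trans h; rewrite leq_add2l; clear; lia.
Qed.

Lemma run_merge s :
  var s vn = n -> var s vK = K -> var s vP = P ->
  (forall i, 0 < i <= n -> arr s apr i = pr i) ->
  (forall i, 0 < i <= n -> arr s atb i = tb i) ->
  (forall u q j, u <= n -> q < 2 * K -> j < K -> entry s 0 u q j) ->
  run merge_nodes s (20 + n * (80 + P * (220 + 400 * K))) (fun s' =>
    forall q j, q < 2 * K -> j < K -> entry s' n 0 q j).
Proof.
move=> nE KE PE prE tbE ent.
pose I z s' := forall u q j, u <= n - z -> q < 2 * K -> j < K -> entry s' z u q j.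
have PM : P + 10 <= M by apply: leq_trans M_tab; rewrite leq_add2r leq_pmull.
apply: run_weaken (run_for (I := I) (c := 60 + P * (220 + 400 * K)) _ _ _ _ _ _ _ _ _ _ (leqnn _)) _ _ => //.
- by rewrite /= nE => _; lia.
- by move=> u q j; rewrite subn0; apply: ent.
- move=> z s' /= ; rewrite nE => lt_z F zE ents.
  have nE' : var s' vn = n by rewrite (frame_var F).
  set i := n - z; have i_bd : 0 < i <= n by rewrite /i; clear -lt_z; lia.
  step; rewrite nE' zE -/i.
  step; have pE : arr s' apr i = pr i by rewrite (frame_arr F) // prE.
  rewrite pE; set s1 := set_var _ _ _.
  have lim : eval s1 (Var vP) = P by rewrite /= (frame_var F).
  apply: run_weaken (run_for (I := fun t s2 => merging s' s2 z t) (c := 200 + 400 * K)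
     _ _ _ _ _ _ _ _ _ _ (leqnn _)) _ _ => //.
  + by rewrite lim => _; lia.
  + by split=> // q j lt_q lt_j; rewrite subn0 leqNgt index_lt.
  + move=> t s2; rewrite lim => lt_t F2 tE mg.
    apply: run_weaken (run_merge_entry lt_z lt_t ents _ _ tE _ _ _ mg) (leqnn _) _.
    * by rewrite (frame_var F2).
    * by rewrite (frame_var F2).
    * by rewrite (frame_var F2) //= (frame_var F).
    * by rewrite (frame_var F2) //= (frame_var F).
    * by rewrite (frame_arr F2) //= (frame_arr F) // tbE.
    * by move=> s3 _ _ mg' _.
  + rewrite lim /=; nia.
  + move=> s2 F2 _; rewrite lim => -[new same] _ u q j le_u lt_q lt_j.
    have lt_u : u < i by rewrite /i; clear -le_u lt_z; lia.
    (* Only the class of the predecessor changes; every other node keeps its cells and, by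
       [entry_keep], their meaning. *)
    case: (eqVneq u (pr i)) => [->|ne]; first by apply: new => //; rewrite subnn.
    have ent' : entry s' z u q j by apply: ents => //; apply: ltnW.
    have keep : same_entry s' s2 ((u * (2 * K) + q) * K + j).
      apply: same; rewrite indexE subnn addn0 -/i.
      have lt_p := index_lt lt_q lt_j.
      case: (ltngtP u (pr i)) ne => // lt _; apply/negP => /andP[h1 h2].
        by have := node_lt lt lt_p; rewrite ltnNge h1.
      have : pr i * P + P <= u * P by rewrite -(mulSnr (pr i)) leq_mul2r lt orbT.
      by rewrite leqNgt (leq_ltn_trans _ h2) // leq_addr.
    have := same_entry_ok keep lt_j ent'; exact: entry_keep.
- by rewrite /= nE; nia.
- move=> s' _ _ /=; rewrite nE => ents q j lt_q lt_j.
  by apply: ents.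
Qed.

End MergeAll.

(** * Enumerating the guesses *)

Section Code.
Variables (lo len : nat).

Definition code (X : nat -> nat) := \sum_(x < len) X (lo + 1 + x) * 2 ^ x.

End Code.

Lemma code0 lo X : code lo 0 X = 0.
Proof. exact: big_ord0. Qed.

Lemma codeS lo len X : code lo len.+1 X = code lo len X + X (lo + 1 + len) * 2 ^ len.
Proof. exact: big_ord_recr. Qed.

Lemma code_lt lo len X : (forall j, X j <= 1) -> code lo len X < 2 ^ len.
Proof.
move=> X1; elim: len => [|len IH]; first by rewrite code0.
rewrite codeS expnS; have := X1 (lo + 1 + len); case: (X _) => [|[]] //; lia.
Qed.

(** Lets the loop invariant speak of numbers: a set whose code is the current one agrees with the
    current guess. *)
Lemma code_inj lo len X Y : (forall j, X j <= 1) -> (forall j, Y j <= 1) ->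
  code lo len X = code lo len Y -> forall x, x < len -> X (lo + 1 + x) = Y (lo + 1 + x).
Proof.
move=> X1 Y1; elim: len => // len IH; rewrite !codeS => eq.
have hX := code_lt lo len X1; have hY := code_lt lo len Y1.
have e1 : X (lo + 1 + len) = Y (lo + 1 + len).
  have := X1 (lo + 1 + len); have := Y1 (lo + 1 + len).
  by move: eq; case: (X _) => [|[]]; case: (Y _) => [|[]] //; lia.
move=> x; rewrite ltnS leq_eqVlt => /orP[/eqP -> //|]; apply: IH.
by move: eq; rewrite e1 => /addIn.
Qed.

Section Steps.
Variables (k M : nat).
Notation run := (run M 40).
Hypothesis M_k : 10 * k + 20 <= M.

Lemma run_record s : var s vk = k -> var s vK = k.+1 ->
  run record s (50 + 60 * k) (fun s' =>
    if var s vbest < arr s aval k then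
      var s' vbest = arr s aval k /\
      forall x, x < k -> arr s' aout x = arr s aord (arr s alst (k * k.+1 + x))
    else var s' vbest = var s vbest /\ arr s' aout = arr s aout).
Proof.
move=> kE KE; rewrite /record; step; rewrite kE addn1.
- rewrite eqb0 negbK => lt; rewrite lt; step; rewrite kE.
  set s1 := set_var _ _ _.
  have lim : eval s1 (Var vk) = k by [].
  pose I x s' := forall y, y < x -> arr s' aout y = arr s aord (arr s alst (k * k.+1 + y)).
  apply: run_weaken (run_for (I := I) (c := 30) _ _ _ _ _ _ _ _ _ _ (leqnn _)) _ _ => //.
  + by rewrite lim => _; lia.
  + move=> x s'; rewrite lim => lt_x F xE Ix.
    step; rewrite xE !(frame_var F) //= kE KE (frame_arr F) // (frame_arr F) //= => _ y.
    rewrite ltnS leq_eqVlt /= => /orP[/eqP ->|lt_y]; first by rewrite eqxx.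
    by rewrite (ltn_eqF lt_y); apply: Ix.
  + by rewrite lim /=; lia.
  + by move=> s' F _; rewrite lim => Ik; split=> //; rewrite (frame_var F).
- by move/eqP; rewrite eqb0 => /negbTE ->; step.
Qed.

(** [vdone] is the carry, initially [1]. Each bit preserves the final equation, since bit plus carry
    is twice the new carry plus the new bit. *)
Lemma run_next_guess s lo hi : var s vlo = lo -> var s vhi = hi -> lo <= hi <= k ->
  (forall i, arr s asel i <= 1) ->
  run next_guess s (50 + 100 * k) (fun s' =>
    [/\ forall i, arr s' asel i <= 1, var s' vdone <= 1,
        forall i, ~~ (lo < i <= hi) -> arr s' asel i = arr s asel i &
        code lo (hi - lo) (arr s' asel) + var s' vdone * 2 ^ (hi - lo) =
        (code lo (hi - lo) (arr s asel)).+1]).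
Proof.
move=> loE hiE /andP[le_lh le_hk] sel1; rewrite /next_guess; step.
set s1 := set_var _ _ _.
have lim : eval s1 (Var vhi - Var vlo)%ram = hi - lo by rewrite /= loE hiE.
pose I x s' := [/\ forall i, arr s' asel i <= 1, var s' vdone <= 1,
  forall i, ~~ (lo < i <= lo + x) -> arr s' asel i = arr s asel i &
  code lo x (arr s' asel) + var s' vdone * 2 ^ x = (code lo x (arr s asel)).+1].
apply: run_weaken (run_for (I := I) (c := 60) _ _ _ _ _ _ _ _ _ _ (leqnn _)) _ _ => //.
- by rewrite lim => _; lia.
- by split; rewrite //= !code0.
- move=> x s'; rewrite lim => lt_x F xE [i1 d1 keep cE].
  have loE' : var s' vlo = lo by rewrite (frame_var F).
  set A := arr s' asel in i1 keep cE *; set b := A (lo + 1 + x); set d := var s' vdone in d1 cE *.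
  have bE : b = arr s asel (lo + 1 + x) by apply: keep; lia.
  have b1 : b <= 1 by apply: i1.
  step; rewrite loE' xE -/A -/b; first by move=> _; lia.
  step; rewrite loE' xE.
  step; try by move=> _; have := leq_div (b + d) 2; lia.
  move=> _; split=> /= [i||i|].
  + case: ifP => _; last exact: i1.
    by have := ltn_pmod (b + d) (isT : 0 < 2); lia.
  + lia.
  + move=> out; case: eqP out => [->|_ out]; first by rewrite !addn1; lia.
    by apply: keep; apply: contra out; lia.
  + rewrite !codeS eqxx -bE expnS.
    have -> : code lo x (fun j => if j == lo + 1 + x then (b + d) %% 2 else A j) = code lo x A.
      apply: eq_bigr => y _; case: eqP => // /addnI; have := ltn_ord y; lia.
    have -> : (b + d) %/ 2 * (2 * 2 ^ x) = ((b + d) %/ 2 * 2) * 2 ^ x by rewrite mulnA.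
    have := divn_eq (b + d) 2; move: (_ %/ 2) (_ %% 2) => h r bd.
    have : (b + d) * 2 ^ x = (h * 2) * 2 ^ x + r * 2 ^ x by rewrite bd mulnDl.
    by move: cE; rewrite mulnDl; lia.
- by rewrite lim /=; lia.
- move=> s' _ _; rewrite lim => -[i1 d1 keep cE]; split=> // i out.
  by apply: keep; rewrite subnKC.
Qed.

End Steps.

(** * One guess, and all guesses for one half *)

Section Guess.
Variables (n k : nat) (G H : sgraph 'I_n) (adj : 'I_n -> seq 'I_n) (ds ys : seq 'I_n).
Variable M : nat.
Notation K := k.+1.
Notation P := (2 * K * K).
Notation os := (ds ++ ys).
Notation N := (earlier H ds ys).
Hypothesis adjP : adjacency_lists G adj.
Hypothesis HE : forall v w, edge H v w = [&& v \notin ds, w \notin ds & edge G v w].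
Hypothesis os_uniq : uniq os.
Hypothesis os_full : forall v, v \in os.
Notation run := (run M 40).

(* The number of edges in [S] whose lower end is in [(lo, hi]] or outside the
   deletion set. *)
Definition value lo hi (S : nat -> bool) :=
  \sum_(i < n.+1) S i * (weight G os (fun j => (lo < j <= hi) && S j) i + count_earlier n N S i).

Lemma count_earlier_le (S : nat -> bool) i :
  count_earlier n N S i <= \sum_(x < n.+1) S x.
Proof.
by rewrite [X in _ <= X](bigID (fun x : 'I_n.+1 => N i x)) /=; apply: leq_addr.
Qed.

Lemma last_earlier_lt i : 0 < i -> last_earlier n N i < i.
Proof.
move=> i0; rewrite /last_earlier; elim/big_ind: _ => // [a b ? ?|j]; last exact: earlier_lt.
by rewrite gtn_max; apply/andP.
Qed.

Lemma earlier0 j : N 0 j = false.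
Proof. by rewrite /earlier ltn0 andbF. Qed.

Lemma count_earlierE S i : count_earlier n N S i =
  \sum_(j < n.+1 | padj os G i j && ((size ds < j) && (j < i))) S j.
Proof. by apply: eq_bigl => j; apply: (earlierE HE). Qed.

(** A lower end cannot be both in [(lo, hi]] and beyond [size ds], so no edge is counted twice. *)
Lemma edges_in_split lo hi (S : nat -> bool) (X : nat -> nat) :
  hi <= size ds -> (forall j, X j <= (lo < j <= hi) && S j) ->
  \sum_(i < n.+1) S i * (weight G os X i + count_earlier n N S i) <= edges_in os G S.
Proof.
move=> le_hi XS; apply: leq_sum => i _.
rewrite /weight count_earlierE.
rewrite big_mkcond [X in _ + X]big_mkcond [X in _ <= X]big_mkcond -big_split /= big_distrr /=.
apply: leq_sum => j _; case: padj => /=; last by rewrite muln0.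
rewrite [_ && (j < i)]andbC; case: (j < i) => /=; last by rewrite muln0.
have := XS j; case: (S i) => /=; last by rewrite mul0n.
rewrite mul1n; case: (ltnP (size ds) j) => le_d; case: (S j) => /=; rewrite ?andbT ?andbF; lia.
Qed.

(** A lower end lies in the first half, in the second half, or outside the deletion set; in the last
    case the edge counts in both values. *)
Lemma edges_in_cover h (S : nat -> bool) :
  edges_in os G S <= value 0 h S + value h (size ds) S.
Proof.
rewrite /value -big_split /=; apply: leq_sum => i _; rewrite -mulnDr.
set w1 := weight _ _ _ _; set w2 := weight _ _ _ _; set c := count_earlier _ _ _ _.
apply: (@leq_trans (S i * (w1 + (w2 + c)))); last by rewrite leq_mul2l; apply/orP; right; lia.
rewrite /w1 /w2 /c /weight count_earlierE big_mkcond [X in _ * (X + (_ + _))]big_mkcond.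
rewrite [X in _ * (_ + (X + _))]big_mkcond [X in _ * (_ + (_ + X))]big_mkcond.
rewrite -!big_split big_distrr; apply: leq_sum => j _ /=; case padjij: (padj os G i j) => /=; last by rewrite muln0.
have [_ /andP[j0 _] _] := padj_pos os_uniq os_full padjij.
rewrite [_ && (j < i)]andbC; case: (j < i) => //=; rewrite j0 /=.
by case: (S i); case: (S j) => //=; rewrite !mul1n !andbT;
  case: (leqP j h) => //=; case: (leqP j (size ds)).
Qed.

Hypothesis N_rec : forall (S : nat -> bool) i, S 0 = false -> i <= n ->
  count_earlier n N S i = S (last_earlier n N i) +
    (1 < count_earlier n N (fun=> true) i) * count_earlier n N S (last_earlier n N i).
Hypothesis k_le : k <= n.
Hypothesis M_ge : 10 * n + 20 <= M.
Hypothesis M_tab : n.+1 * P + 10 <= M.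
Hypothesis M_val : 2 * n * n + 10 <= M.

(** The last clause concerns the sets compatible with this guess only; [run_phase] collects them
    over all guesses. *)
Lemma run_guess s lo hi :
  has_graph adj s -> has_order s os ->
  var s vk = k -> var s vK = K -> var s vP = P -> var s vlo = lo -> var s vhi = hi ->
  (forall i, arr s apr i = last_earlier n N i) ->
  (forall i, arr s atb i = (1 < count_earlier n N (fun=> true) i)) ->
  lo <= hi <= size ds ->
  (forall i, arr s asel i <= 1) -> (forall i, ~~ (lo < i <= hi) -> arr s asel i = 0) ->
  run guess s (110 + 60 * n + \sum_(v : 'I_n) 80 * size (adj v) + n.+1 * P * 140 +
      n * (80 + P * (220 + 400 * K)) + 60 * k)
    (fun s' => [/\ var s vbest <= var s' vbest,
       (var s' vbest = var s vbest /\ arr s' aout = arr s aout) \/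
       exists l, [/\ uniq l, size l = k, forall x, x \in l -> 0 < x <= n,
         mkseq (arr s' aout) k = [seq arr s aord x | x <- l] &
         (var s' vbest).-1 <= edges_in os G (fun i => i \in l)] &
       forall S : nat -> bool, S 0 = false -> \sum_(i < n.+1) S i = k ->
         (forall j, lo < j <= hi -> arr s asel j = S j) -> value lo hi S < var s' vbest]).
Proof.
move=> gs oi kE KE PE loE hiE prE tbE /andP[le_lh le_hd] sel1 sel0.
have nE := has_n gs; set X := arr s asel in sel1 sel0 *.
pose w := weight G os X; have w_le i : w i <= n by apply: (weight_le adjP).
pose al0 i := X i == 0; pose al1 := fits_guess lo hi X.
pose cnt := count_earlier n N.
pose tb i := 1 < count_earlier n N (fun=> true) i.
have al10 : al1 0 = false by [].
have cnt_rec S i : S 0 = false -> 0 < i <= n ->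
    cnt S i = S (last_earlier n N i) + tb i * cnt S (last_earlier n N i).
  by move=> S0 /andP[_ le_i]; apply: N_rec.
have pr_lt i : 0 < i <= n -> last_earlier n N i < i by case/andP => i0 _; apply: last_earlier_lt.
have X0 : X 0 = 0 by apply: sel0.
rewrite /guess; set T1 := 20 + 60 * n + \sum_(v : 'I_n) 80 * size (adj v).
set T2 := 20 + n.+1 * P * 140; set T3 := 20 + n * (80 + P * (220 + 400 * K)).
apply: (@run_weaken _ _ _ _ (T1 + (T2 + (T3 + (50 + 60 * k))))); last 2 first.
- rewrite /T1 /T2 /T3; move: (\sum_(v < n) _) (n.+1 * P * 140) (n * _) => a b c; lia.
- by move=> s' _ _; apply.
apply: (@run_seq _ _ _ _ _ T1); first exact: leq_addr.
rewrite addKn; apply: run_weaken (run_weigh adjP M_ge os_uniq os_full gs oi sel1) (leqnn _) _.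
move=> s1 _ _ wtE F1; have F1v := frame_var F1; have F1a := frame_arr F1.
apply: (@run_seq _ _ _ _ _ T2); first exact: leq_addr.
have wtE' i : 0 < i <= n -> arr s1 awt i = w i.
  by move=> /(position_surj os_uniq os_full)[v ->]; rewrite wtE.
have X1 : arr s1 asel = X by rewrite F1a.
have sel1' i : arr s1 asel i <= 1 by rewrite X1.
rewrite addKn; apply: run_weaken (run_fill k_le M_ge M_tab _ _ _ wtE' w_le sel1') (leqnn _) _.
- by rewrite F1v.
- by rewrite F1v.
- by rewrite F1v.
rewrite X1 !F1v // loE hiE => s2 _ _ filled F2.
have F2v := frame_var F2; have F2a := frame_arr F2.
apply: (@run_seq _ _ _ _ _ T3); first exact: leq_addr.
rewrite addKn; apply: run_weaken (run_merge (pr := last_earlier n N) (tb := tb) (w := w)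
  (cnt := cnt) (al0 := al0) (al1 := al1) pr_lt cnt_rec count_earlier_le k_le al10 M_ge M_tab M_val
  _ _ _ _ _ _) (leqnn _) _.
- by rewrite F2v // F1v.
- by rewrite F2v // F1v.
- by rewrite F2v // F1v.
- by move=> i _; rewrite F2a // F1a.
- by move=> i _; rewrite F2a // F1a.
- move=> u q j le_u lt_q lt_j; have [vE lE] := filled u q j le_u lt_q lt_j.
  apply: entry_init => //; first by lia.
  - by move=> ->.
  - by move=> j1; subst j; rewrite /list_row /mkseq /= addn0 lE.
move=> s3 _ _ ent F3; have F3v := frame_var F3; have F3a := frame_arr F3.
(* After all merges the root [0] carries every position. It is not chosen and has no earlier
   neighbours, whence state [0]. *)
have ent0 : entry n k (last_earlier n N) w cnt al0 al1 s3 n 0 0 k by apply: ent.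
have M_k : 10 * k + 20 <= M by lia.
apply: run_weaken (run_record M_k _ _) _ _; last 1 first.
- move=> s4 F4 _.
  have b3 : var s3 vbest = var s vbest by rewrite F3v // F2v // F1v.
  have o3 : arr s3 aout = arr s aout by rewrite F3a // F2a // F1a.
  have a3 : arr s3 aord = arr s aord by rewrite F3a // F2a // F1a.
  rewrite b3 o3 a3; move: ent0; rewrite /entry !mul0n !add0n.
  set v := arr s3 aval k; set l := list_row k s3 k k => -[_ sv cv] rec.
  have anc0 x : x <= n -> anc n (last_earlier n N) n x = 0.
    move=> le_x; apply/eqP; rewrite -leqn0.
    apply: leq_trans (anc_le pr_lt (leqnn n) le_x) _; by rewrite subnn.
  have allS (F : nat -> nat) : \sum_(x < n.+1 | anc n (last_earlier n N) n x == 0) F x = \sum_(x < n.+1) F x.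
    by apply: eq_bigl => x; rewrite anc0 // -ltnS.
  have le_v : v <= var s4 vbest.
    by move: rec; case: ltnP => [_ [->]|le [->]].
  split.
  + by move: rec; case: ltnP => [/ltnW le [->]|_ [->]].
  + move: rec; case: ltnP => [lt [-> outE]|_ [-> ->]]; last by left.
    right; exists l.
    have /sv[Ul sl lP [l0 al] gl] : v != 0 by rewrite -lt0n; apply: leq_ltn_trans lt.
    split=> //.
    * by move=> x xl; have [-> _] := lP x xl; rewrite lt0n andbT; apply: contraTneq xl => ->; rewrite l0.
    * by rewrite /mkseq -map_comp; apply/eq_in_map => x; rewrite mem_iota => /andP[_ lt_x]; apply: outE.
    * pose S i : bool := i \in l; rewrite -/S.
      have S0 : S 0 = false by rewrite /S l0.
      apply: leq_trans (gl S S0 (fun _ _ _ => erefl) (leq0n _)) _.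
      rewrite /gain (allS (fun x => S x * (w x + cnt S x))).
      (* [al0] forbids leaving out a vertex that is guessed in, so the weights count only vertices
         of the solution. *)
      apply: (edges_in_split (lo := lo) le_hd) => j; case: (boolP (lo < j <= hi)) => [Zj|/sel0 -> //].
      rewrite /S; case jl: (j \in l) => /=; first exact: sel1.
      have le_j : j <= n.
        rewrite -(size_os os_uniq os_full) size_cat; apply: leq_trans (leq_addr _ _).
        by apply: leq_trans le_hd; case/andP: Zj.
      by have := al j le_j (anc0 j le_j); rewrite jl /al0 => /eqP ->.
  + move=> S S0 cS SX.
    have wS x : w x = weight G os (fun j => (lo < j <= hi) && S j) x.
      by apply: eq_bigr => j _; case: (boolP (lo < j <= hi)) => [/SX|/sel0].
    have aS : admissible n al0 al1 S.
      move=> x le_x; rewrite /al0 /al1 /fits_guess; case: (boolP (lo < x <= hi)) => Zx.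
        have -> : X x = S x by apply: SX.
        case Sx: (S x) => //=; rewrite ?orbF ?andbT lt0n.
        by apply: contraFneq S0 => <-.
      rewrite sel0 //; case Sx: (S x) => //=; rewrite ?andbT lt0n.
      by apply: contraFneq S0 => <-.
    have gS : gain n (last_earlier n N) w cnt n 0 S = value lo hi S.
      rewrite /gain (allS (fun x => S x * (w x + cnt S x))).
      by apply: eq_bigr => x _; rewrite wS.
    apply: leq_trans le_v; rewrite -gS; apply: cv => //.
    * by rewrite cS.
    * by rewrite /cnt /count_earlier big_pred0 // => j; apply: earlier0.
    * by rewrite /members (allS (fun x => S x)).
- by rewrite F3v // F2v // F1v.
- by rewrite F3v // F2v // F1v.
- by [].
Qed.

Definition guess_time := 110 + 60 * n + \sum_(v : 'I_n) 80 * size (adj v) + n.+1 * P * 140 +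
      n * (80 + P * (220 + 400 * K)) + 60 * k.

Definition recorded (s : state) : Prop :=
  var s vbest = 0 \/ exists l, [/\ uniq l, size l = k, forall x, x \in l -> 0 < x <= n,
    mkseq (arr s aout) k = [seq arr s aord x | x <- l] &
    (var s vbest).-1 <= edges_in os G (fun i => i \in l)].

Lemma run_phase s lo hi :
  has_graph adj s -> has_order s os ->
  var s vk = k -> var s vK = K -> var s vP = P -> var s vlo = lo -> var s vhi = hi ->
  (forall i, arr s apr i = last_earlier n N i) ->
  (forall i, arr s atb i = (1 < count_earlier n N (fun=> true) i)) ->
  lo <= hi <= size ds -> (forall i, arr s asel i = 0) -> recorded s ->
  run phase s (20 + 2 ^ (hi - lo) * (guess_time + 100 * n + 60)) (fun s' =>
    [/\ forall i, arr s' asel i = 0, var s vbest <= var s' vbest, recorded s' &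
      forall S : nat -> bool, S 0 = false -> \sum_(i < n.+1) S i = k ->
        value lo hi S < var s' vbest]).
Proof.
move=> gs oi kE KE PE loE hiE prE tbE le_lh sel_0 rec; rewrite /phase.
have le_hn : lo <= hi <= n.
  case/andP: le_lh => -> le_h; rewrite -(size_os os_uniq os_full) size_cat.
  exact: leq_trans le_h (leq_addr _ _).
step; set s1 := set_var _ _ _; set cond := Bin Eqb _ _; set body := Seq _ _.
set len := hi - lo.
(* Counting the overflow as well makes [rank] grow by exactly one per round, up to [2 ^ len]; all
   sets of smaller code have been dealt with. *)
pose rank s' := code lo len (arr s' asel) + var s' vdone * 2 ^ len.
pose I s' := [/\ [/\ forall i, arr s' asel i <= 1, forall i, ~~ (lo < i <= hi) -> arr s' asel i = 0 &
    var s' vdone <= 1], rank s' <= 2 ^ len, var s vbest <= var s' vbest, recorded s' &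
  forall S : nat -> bool, S 0 = false -> \sum_(i < n.+1) S i = k ->
    code lo len S < rank s' -> value lo hi S < var s' vbest].
set Tb := guess_time + 100 * n + 60.
pose pot s' := (2 ^ len - rank s') * Tb.
have b1 (S : nat -> bool) j : S j <= 1 by case: (S j).
apply: run_weaken (@run_while M 40 cond body I pot s1 _ _ _ _ (leqnn _)) _ _ => //.
- have c0 : code lo len (arr s1 asel) = 0 by apply: big1 => i _; rewrite /s1 /= sel_0.
  split=> //=; rewrite /rank ?c0 ?mul0n //=.
  by split=> // i; rewrite sel_0.
- move=> s' F [[sel1 sel0 d1] le_r le_b rec' cov] cE.
  have d0 : var s' vdone = 0 by move: cE; rewrite /= eqb0 negbK => /eqP.
  have rankE : rank s' = code lo len (arr s' asel) by rewrite /rank d0 mul0n addn0.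
  exists (guess_time + (50 + 100 * n)).
  have gs' : has_graph adj s' by apply: has_graph_frame F _ _ _ _ => //; case: gs; split.
  have oi' : has_order s' os.
    by apply: has_order_frame F _ _ _ _ => //; apply: has_order_set_var.
  apply: (@run_seq _ _ _ _ _ guess_time); first exact: leq_addr.
  rewrite addKn; apply: run_weaken (run_guess (lo := lo) (hi := hi) gs' oi' _ _ _ _ _ _ _ le_lh sel1 sel0) (leqnn _) _.
  + by rewrite (frame_var F).
  + by rewrite (frame_var F).
  + by rewrite (frame_var F).
  + by rewrite (frame_var F).
  + by rewrite (frame_var F).
  + by move=> i; rewrite (frame_arr F) //; exact: prE.
  + by move=> i; rewrite (frame_arr F) //; exact: tbE.
  move=> s2 _ _ [le_b2 out2 cov2] F2.
  have sel2 : arr s2 asel = arr s' asel by rewrite (frame_arr F2).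
  have sel1' i : arr s2 asel i <= 1 by rewrite sel2.
  apply: run_weaken (run_next_guess M_ge _ _ le_hn sel1') (leqnn _) _.
  + by rewrite (frame_var F2) // (frame_var F).
  + by rewrite (frame_var F2) // (frame_var F).
  move=> s3 F3 _ [sel3 d3 keep3]; rewrite -/len -/(rank s3) sel2 -rankE => rank3.
  have b3 : var s3 vbest = var s2 vbest by rewrite (frame_var F3).
  have o3 : arr s3 aout = arr s2 aout by rewrite (frame_arr F3).
  have a3 : arr s3 aord = arr s' aord by rewrite (frame_arr F3) // (frame_arr F2).
  have lt_r : rank s' < 2 ^ len by rewrite rankE code_lt.
  split; first split=> //.
  + by split=> // i out; rewrite keep3 // sel2 sel0.
  + by rewrite rank3.
  + by rewrite b3; apply: leq_trans le_b2.
  + rewrite /recorded b3 o3 a3; case: out2 => [[-> ->]|[l lP]]; first exact: rec'.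
    by right; exists l.
  + move=> S S0 cS; rewrite rank3 b3 ltnS leq_eqVlt => /orP[/eqP eqr|lt].
      apply: cov2 => // j /andP[lo_j j_hi].
      have lt_j : j - (lo + 1) < len by rewrite /len; lia.
      have := code_inj sel1 (b1 S) (etrans (esym rankE) (esym eqr)) lt_j.
      by rewrite subnKC //; lia.
    by apply: leq_trans le_b2; apply: cov.
  rewrite /pot rank3; have -> : 2 ^ len - rank s' = (2 ^ len - (rank s').+1).+1 by lia.
  by rewrite (mulSn (2 ^ len - _)) leq_add2r /Tb /=; move: guess_time => a; lia.
- have c0 : code lo len (arr s1 asel) = 0 by apply: big1 => i _; rewrite /s1 /= sel_0.
  rewrite /pot /rank c0 /= subn0 -/Tb; move: (2 ^ len * Tb) => b; lia.
- move=> s' F _ [[[sel1 sel0 d1] le_r le_b rec' cov] cE].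
  have dE : var s' vdone = 1.
    by move: cE d1; rewrite /=; case: (var s' vdone) => [|[]].
  (* The overflow alone exhausts the bound on [rank], so the guess is back at zero. *)
  have c0 : code lo len (arr s' asel) = 0 by move: le_r; rewrite /rank dE mul1n; lia.
  split=> // [i|S S0 cS].
    case: (boolP (lo < i <= hi)) => [/andP[lo_i i_hi]|]; last exact: sel0.
    have lt_i : i - (lo + 1) < len by rewrite /len; lia.
    have z0 : code lo len (fun=> 0) = 0 by apply: big1.
    have := code_inj sel1 (fun=> leq0n 1) (etrans c0 (esym z0)) lt_i.
    by rewrite subnKC //; lia.
  by apply: cov => //; rewrite /rank dE mul1n; apply: leq_trans (code_lt _ _ (b1 S)) (leq_addl _ _).
Qed.

End Guess.

(** * The whole algorithm *)

Section Input.
Variables (n k : nat) (G : sgraph 'I_n) (adj : 'I_n -> seq 'I_n) (ds : seq 'I_n).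
Hypothesis adjP : adjacency_lists G adj.
Hypothesis ds_uniq : uniq ds.
Hypothesis k_le : k <= n.
Notation s0 := (input_state G k adj ds).

Definition degrees := [seq size (adj v) | v <- enum 'I_n].

Lemma nth_degrees (v : 'I_n) : nth 0 degrees v = size (adj v).
Proof. by rewrite (nth_map v) ?nth_ord_enum // size_enum_ord. Qed.

Lemma size_degrees : size degrees = n.
Proof. by rewrite size_map size_enum_ord. Qed.

Lemma input_off i : i <= n -> arr s0 aoff i = sumn (take i degrees).
Proof.
move=> le_i; rewrite -[LHS]/(nth 0 [seq sumn (take j degrees) | j <- iota 0 n.+1] i).
by rewrite (nth_map 0) ?size_iota // nth_iota.
Qed.

Lemma input_has_graph : has_graph adj s0.
Proof.
split=> // [v|v i lt_i].
  rewrite !input_off //; last exact: ltnW.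
  by rewrite (take_nth 0) ?size_degrees // sumn_rcons nth_degrees.
rewrite input_off; last exact: ltnW.
rewrite /=; set ss := [seq map val (adj v) | v <- enum 'I_n].
have sv : v < size ss by rewrite size_map size_enum_ord.
have -> : sumn (take v degrees) = size (flatten (take v ss)).
  rewrite size_flatten /shape map_take -map_comp; congr (sumn (take v _)).
  by apply: eq_map => w /=; rewrite size_map.
rewrite -(cat_take_drop v ss) flatten_cat (drop_nth [::] sv) /= nth_cat.
have -> : (nth [::] ss v) = map val (adj v).
  by rewrite (nth_map v) ?nth_ord_enum // size_enum_ord.
have -> : take v (take v ss ++ map val (adj v) :: drop v.+1 ss) = take v ss.
  by rewrite take_size_cat // size_take sv.
by rewrite ltnNge leq_addr /= addKn nth_cat size_map lt_i.
Qed.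

Lemma sum_degrees_le : sumn degrees <= n * n.
Proof.
rewrite sumnE big_map; apply: (@leq_trans (\sum_(v <- enum 'I_n) n)).
  by apply: leq_sum => v _; apply: (size_adj adjP).
by rewrite big_enum /= sum_nat_const card_ord.
Qed.

Lemma card_edges_le : #|edges G| <= n * n.
Proof.
have := sum_degrees adjP; have := sum_degrees_le; rewrite sumnE big_map big_enum /=.
by move=> le eq; rewrite eq in le; lia.
Qed.

Lemma nth_val_lt (s : seq 'I_n) i M : n < M -> nth 0 (map val s) i < M.
Proof.
move=> nM; case: (ltnP i (size s)) => [lt_i|ge_i]; last by rewrite nth_default ?size_map //; lia.
have v0 : 'I_n by case: (s) lt_i.
by rewrite (nth_map v0) //; apply: ltn_trans (ltn_ord _) nM.
Qed.

(** The largest input numbers are the offsets and the number of edges, both at most [n * n] by the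
    degree sum. *)
Lemma input_bounded M : 2 < M -> n * n < M -> bounded M s0.
Proof.
move=> M2 nM; have nM' : n < M by apply: leq_ltn_trans nM; case: (n) => // n'; rewrite leq_pmulr.
split=> // [x|a i].
  have := card_edges_le; have := uniq_size_le ds_uniq.
  case: x => [|[|[|[|x]]]] /=; rewrite ?nth_nil; lia.
case: a => [|[|[|a]]].
- case: (leqP i n) => [le_i|gt_i]; last first.
    rewrite -[arr _ _ _]/(nth 0 [seq sumn (take j degrees) | j <- iota 0 n.+1] i).
    by rewrite nth_default ?size_map ?size_iota //; lia.
  rewrite input_off //; apply: leq_ltn_trans nM; apply: leq_trans sum_degrees_le.
  by rewrite -{2}(cat_take_drop i degrees) sumn_cat leq_addr.
- have nbrE : flatten [seq map val (adj v) | v <- enum 'I_n] =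
      map val (flatten [seq adj v | v <- enum 'I_n]) by rewrite map_flatten; congr flatten; rewrite -[RHS]map_comp.
  by rewrite /= nbrE; apply: nth_val_lt.
- exact: nth_val_lt.
- by rewrite /= nth_nil nth_nil; lia.
Qed.

End Input.

Section Positions.
Variables (n k : nat) (G : sgraph 'I_n) (os : seq 'I_n).
Hypothesis os_uniq : uniq os.
Hypothesis os_full : forall v, v \in os.
Notation pos := (position os).

Definition positions (U : {set 'I_n}) (i : nat) : bool := [exists v in U, pos v == i].

Lemma positions0 U : positions U 0 = false.
Proof. by apply/existsP => -[v /andP[_ /eqP]]. Qed.

Lemma positionsE U v : positions U (pos v) = (v \in U).
Proof.
apply/existsP/idP => [[w /andP[wU /eqP/(position_inj os_full) <-]] //|vU].
by exists v; rewrite vU eqxx.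
Qed.

Lemma sum_positions U : \sum_(i < n.+1) positions U i = #|U|.
Proof.
rewrite -(@big_position _ _ os_uniq os_full _ _ _ (fun i => positions U i : nat)) ?positions0 //.
rewrite -sum1_card [RHS]big_mkcond; apply: eq_bigr => v _; rewrite positionsE.
by case: (v \in U).
Qed.

Lemma densest_opt_le m :
  (forall S : nat -> bool, S 0 = false -> \sum_(i < n.+1) S i = k -> edges_in os G S <= m) ->
  densest_opt G k <= m.
Proof.
move=> bound; apply/bigmax_leqP => U /andP[_ /eqP cU].
rewrite (card_edges_induced os_uniq os_full) -/(positions U).
by apply: bound; [apply: positions0 | rewrite sum_positions].
Qed.

Lemma outputs_positions s l :
  uniq l -> size l = k -> (forall x, x \in l -> 0 < x <= n) ->
  has_order s os -> mkseq (arr s aout) k = [seq arr s aord x | x <- l] ->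
  let U := [set v | pos v \in l] in
  [/\ outputs s k U, #|U| = k & #|edges (induced G U)| = edges_in os G (fun i => i \in l)].
Proof.
move=> Ul sl lP oi outE U.
have ordE v : arr s aord (pos v) = v.
  case: oi => _ _ oo _; rewrite oo ?index_mem ?os_full //.
  by rewrite (nth_map v) ?index_mem ?os_full // nth_index ?os_full.
have surj x : x \in l -> exists2 v, x = pos v & v \in U.
  move=> xl; have [v vE] := position_surj os_uniq os_full (lP x xl).
  by exists v; rewrite // inE -vE.
have out : perm_eq [seq arr s aord x | x <- l] [seq val v | v <- enum U].
  apply: uniq_perm.
  - rewrite map_inj_in_uniq // => x y /surj[v -> _] /surj[w -> _].
    by rewrite !ordE => /val_inj ->.
  - by rewrite map_inj_uniq ?enum_uniq //; apply: val_inj.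
  - move=> x; apply/mapP/mapP => [[y /surj[v -> vU] ->]|[v]].
      by exists v; rewrite ?mem_enum // ordE.
    by rewrite mem_enum inE => vU ->; exists (pos v); rewrite ?ordE.
split.
- by rewrite /outputs outE.
- by have := perm_size out; rewrite !size_map -cardE sl.
- rewrite (card_edges_induced os_uniq os_full) -/(positions U).
  have PU i : positions U i = (i \in l).
    apply/idP/idP => [/existsP[v /andP[+ /eqP <-]]|/surj[v -> vU]]; first by rewrite inE.
    by rewrite positionsE.
  by apply: eq_bigr => i _; apply: eq_bigr => j _; rewrite !PU.
Qed.

End Positions.

Section Solve.
Variables (n k : nat) (G : sgraph 'I_n) (D : {set 'I_n}) (adj : 'I_n -> seq 'I_n) (ds : seq 'I_n).
Variable M : nat.
Hypothesis vG : verts G = [set: 'I_n].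
Hypothesis bD : block_deletion_set G D.
Hypothesis adjP : adjacency_lists G adj.
Hypothesis dsP : perm_eq ds (enum D).
Hypothesis k_le : k <= n.
Hypothesis k_gt0 : 0 < k.
Notation K := k.+1.
Notation P := (2 * K * K).
Hypothesis M_ge : 10 * n + 20 <= M.
Hypothesis M_tab : n.+1 * P + 10 <= M.
Hypothesis M_val : 2 * n * n + 10 <= M.
Notation run := (run M 40).
Notation d := (size ds).
Notation s0 := (input_state G k adj ds).
Notation H := (induced G (verts G :\: D)).

Lemma mem_deleted v : (v \in ds) = (v \in D).
Proof. by rewrite (perm_mem dsP) mem_enum. Qed.

Lemma rest_edge v w : edge H v w = [&& v \notin ds, w \notin ds & edge G v w].
Proof. by rewrite /= /induced_edge vG !in_setD !inE !andbT !mem_deleted. Qed.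

(** Carries [earlier_last] over from vertices to positions; here the block structure of [G - D]
    enters the analysis of the program. *)
Lemma earlier_rec (ys : seq 'I_n) c (S : nat -> bool) i :
  uniq (ds ++ ys) -> (forall v, v \in ds ++ ys) -> search_seq H ys c ->
  S 0 = false -> i <= n ->
  count_earlier n (earlier H ds ys) S i = S (last_earlier n (earlier H ds ys) i) +
    (1 < count_earlier n (earlier H ds ys) (fun=> true) i) *
    count_earlier n (earlier H ds ys) S (last_earlier n (earlier H ds ys) i).
Proof.
move=> Uo fo ss; apply: count_earlier_rec => [a b /andP[]//|].
have so : search_order H (position (ds ++ ys)).
  apply: search_seq_order ss _ _ => [v|v vds].
    by rewrite /= vG !inE andbT -mem_deleted; have := fo v; rewrite mem_cat => /orP[->|->].
  by rewrite /= vG !inE -mem_deleted vds.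
have pinj := position_inj fo.
move=> a u x y /andP[/(padj_pos Uo fo)[_ _ [w [u' [-> -> e]]]] lt].
case/andP=> /(padj_pos Uo fo)[_ _ [w' [x' [/pinj <- -> ex]]]] ltx xu maxu yu.
have [[y' yE]|none] := pselect (exists y', y = position (ds ++ ys) y').
  rewrite yE in yu *; rewrite /earlier !padjP //.
  apply: (earlier_last pinj _ so e lt ex ltx) => //.
  - by case: bD.
  - by apply: contraNneq xu => ->.
  - by move=> z ez ltz; apply: maxu; rewrite /earlier padjP // ez.
  - by apply: contraNneq yu => ->.
by apply/idP/idP => /andP[/(padj_pos Uo fo)[_ _ [_ [y' [_ yE _]]]] _]; case: none; exists y'.
Qed.

Definition degree_sum := \sum_(v : 'I_n) 80 * size (adj v).

Definition solve_time := 200 + 400 * n + 2 * degree_sum +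
  (2 ^ (d %/ 2) + 2 ^ (d - d %/ 2)) * (guess_time k adj + 100 * n + 60).

Lemma run_solve :
  run solve s0 solve_time (fun s => exists2 U, outputs s k U & densest_2approx G k U).
Proof.
have Uds : uniq ds by rewrite (perm_uniq dsP) enum_uniq.
have le_d : d <= n by apply: uniq_size_le.
have gs : has_graph adj s0 by apply: input_has_graph.
have KP : 2 * K <= P by rewrite leq_pmulr.
have PM : P + 10 <= M by apply: leq_trans M_tab; rewrite leq_add2r leq_pmull.
pose Tb := guess_time k adj + 100 * n + 60.
pose B1 := 2 ^ (d %/ 2) * Tb; pose B2 := 2 ^ (d - d %/ 2) * Tb.
have TE : solve_time = 200 + 400 * n + 2 * degree_sum + (B1 + B2).
  by rewrite /solve_time /B1 /B2 -mulnDl.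
move: solve_time TE => T TE.
rewrite /solve; step; last by move=> /= k0; have := k_gt0; rewrite k0.
move=> _; step; try by move=> _ /=; lia.
step; try by move=> _ /=; rewrite !addn1; lia.
rewrite addn1; set s1 := set_var _ _ _.
have gs1 : has_graph adj s1 by case: gs; split.
have o1 : has_order s1 ([::] : seq (ordinal n)) by split=> //= v; rewrite !nth_nil.
apply: (@run_seq _ _ _ _ _ (20 + 60 * n)).
  by rewrite /=; lia.
have sd1 : var s1 vd = d by []. have ads1 i : i < d -> arr s1 ads i = nth 0 (map val ds) i by [].
apply: run_weaken (run_place_deleted M_ge o1 Uds sd1 ads1) (leqnn _) _.
move=> s2 _ _ o2 F2; have gs2 : has_graph adj s2 by apply: has_graph_frame F2 _ _ _ gs1.
apply: (@run_seq _ _ _ _ _ (20 + 220 * n + degree_sum)).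
  by rewrite /=; lia.
apply: run_weaken (run_search adjP rest_edge M_ge gs2 o2 _ _) (leqnn _) _ => //.
- by rewrite (frame_var F2).
- by rewrite (frame_var F2).
move=> s3 _ _ [ys [c [o3 ss fo]]] F3.
have gs3 : has_graph adj s3 by apply: has_graph_frame F3 _ _ _ gs2.
have Uo : uniq (ds ++ ys) by case: o3.
have vE x : x \notin mvars place_deleted -> x \notin mvars search -> var s3 x = var s1 x.
  by move=> x1 x2; rewrite (frame_var F3) // (frame_var F2).
have aE a : a \notin marrs place_deleted -> a \notin marrs search -> arr s3 a = arr s1 a.
  by move=> x1 x2; rewrite (frame_arr F3) // (frame_arr F2).
apply: (@run_seq _ _ _ _ _ (20 + 60 * n + degree_sum)).
  by rewrite /=; lia.
apply: run_weaken (run_link adjP rest_edge Uo fo M_ge gs3 o3 _ _ _) (leqnn _) _.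
- by rewrite vE.
- by move=> i; rewrite aE //= ?nth_nil.
- by move=> i; rewrite aE //= ?nth_nil.
move=> s4 _ _ linked F4.
have gs4 : has_graph adj s4 by apply: has_graph_frame F4 _ _ _ gs3.
have o4 : has_order s4 (ds ++ ys) by apply: has_order_frame F4 _ _ _ o3.
have v4 x : x \notin mvars place_deleted -> x \notin mvars search -> x \notin mvars link ->
    var s4 x = var s1 x.
  by move=> x1 x2 x3; rewrite (frame_var F4) // vE.
have a4 a : a \notin marrs place_deleted -> a \notin marrs search -> a \notin marrs link ->
    arr s4 a = arr s1 a.
  by move=> x1 x2 x3; rewrite (frame_arr F4) // aE.
have dE : var s4 vd = d by rewrite v4.
have le_h : d %/ 2 <= d by apply: leq_div.
have lt_dM : d < M by lia.
step.
step; try by rewrite dE => _; lia.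
rewrite dE; set s5 := set_var _ _ _.
have gs5 : has_graph adj s5 by case: gs4; split.
have o5 : has_order s5 (ds ++ ys) by do 2 (apply: has_order_set_var => //).
have N_rec (S : nat -> bool) i := @earlier_rec ys c S i Uo fo ss.
apply: (@run_seq _ _ _ _ _ (20 + B1)); first by rewrite /=; lia.
have bds5 : 0 <= d %/ 2 <= d by rewrite leq0n.
have v5 x : x \notin [:: vlo; vhi] -> var s5 x = var s4 x.
  by rewrite !inE negb_or /s5 /= => /andP[/negPf -> /negPf ->].
have KE : var s4 vK = K by rewrite v4.
have PE : var s4 vP = P by rewrite v4.
have kE : var s4 vk = k by rewrite v4.
have rec5 : recorded k G ds ys s5 by left; rewrite v5 // v4.
have prE i : arr s4 apr i = last_earlier n (earlier H ds ys) i := (linked i).1.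
have tbE i : arr s4 atb i = (1 < count_earlier n (earlier H ds ys) (fun=> true) i) := (linked i).2.
have sel5 i : arr s5 asel i = 0 by rewrite /s5 /= a4 //= ?nth_nil.
apply: run_weaken (run_phase adjP rest_edge Uo fo N_rec k_le M_ge M_tab M_val gs5 o5
  kE KE PE (erefl _) (erefl _) prE tbE bds5 sel5 rec5) _ _.
  by rewrite subn0 /B1 /Tb.
move=> s6 _ _ [sel6 _ rec6 cov6] F6.
have gs6 : has_graph adj s6 by apply: has_graph_frame F6 _ _ _ gs5.
have o6 : has_order s6 (ds ++ ys) by apply: has_order_frame F6 _ _ _ o5.
have v6 x : x \notin [:: vlo; vhi] -> x \notin mvars phase -> var s6 x = var s4 x.
  by move=> x1 x2; rewrite (frame_var F6) // v5.
have dE6 : var s6 vd = d by rewrite v6.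
step.
step; rewrite dE6; set s7 := set_var _ _ _.
have gs7 : has_graph adj s7 by case: gs6; split.
have o7 : has_order s7 (ds ++ ys) by do 2 (apply: has_order_set_var => //).
have v7 x : x \notin [:: vlo; vhi] -> x \notin mvars phase -> var s7 x = var s4 x.
  by move=> x1 x2; rewrite -v6 //; move: x1; rewrite !inE negb_or /s7 /= => /andP[/negPf -> /negPf ->].
have bds7 : d %/ 2 <= d <= d by rewrite le_h /=.
apply: run_weaken (run_phase adjP rest_edge Uo fo N_rec k_le M_ge M_tab M_val gs7 o7
  _ _ _ (erefl _) (erefl _) _ _ bds7 sel6 rec6) _ _.
- by rewrite v7.
- by rewrite v7.
- by rewrite v7.
- by move=> i; rewrite /s7 /= (frame_arr F6) //; apply: prE.
- by move=> i; rewrite /s7 /= (frame_arr F6) //; apply: tbE.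
- by rewrite -/Tb -/B2 /=; lia.
move=> s8 F8 _ [_ le_b rec8 cov8].
have o8 : has_order s8 (ds ++ ys) by apply: has_order_frame F8 _ _ _ o7.
(* [vbest] does not decrease in the second phase, so both values of [S] lie strictly below its final
   value. *)
have cover (S : nat -> bool) : S 0 = false -> \sum_(i < n.+1) S i = k ->
    edges_in (ds ++ ys) G S <= 2 * (var s8 vbest).-1.
  move=> S0 cS; have h1 := cov6 S S0 cS; have h2 := cov8 S S0 cS.
  have := edges_in_cover rest_edge Uo fo (d %/ 2) S.
  by rewrite /s5 /s7 /= in h1 h2 le_b; lia.
(* Some set of [k] vertices exists, for instance the first [k], and its value is below [vbest];
   hence a solution has been recorded. *)
have b0 : var s8 vbest != 0.
  pose U := [set v : 'I_n | v < k].
  have cU : #|U| = k.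
    have -> : U = [set widen_ord k_le i | i in 'I_k].
      apply/setP=> v; rewrite inE; apply/idP/imsetP => [lt_v|[i _ ->]]; last exact: (ltn_ord i).
      by exists (Ordinal lt_v) => //; apply: val_inj.
    by rewrite card_imset ?card_ord // => i j /(congr1 val) /= /val_inj.
  rewrite -lt0n; apply: leq_ltn_trans (cov8 (positions (ds ++ ys) U) _ _) => //.
    exact: positions0.
  by rewrite (sum_positions Uo fo).
case: rec8 => [eq0|[l [Ul sl lP outE le_e]]]; first by rewrite eq0 in b0.
have [outU cU eU] := outputs_positions G Uo fo Ul sl lP o8 outE.
exists [set v | position (ds ++ ys) v \in l] => //; split=> //.
  by rewrite vG subsetT.
rewrite eU; apply: (densest_opt_le Uo fo) => S S0 cS.
by apply: leq_trans (cover S S0 cS) _; rewrite leq_mul2l.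
Qed.

End Solve.

(** * Bounds on words and on the running time *)

Lemma word_bounds n k : 0 < k <= n ->
  [/\ 10 * n + 20 <= (n + 2) ^ 4, n.+1 * (2 * k.+1 * k.+1) + 10 <= (n + 2) ^ 4 &
      2 * n * n + 10 <= (n + 2) ^ 4].
Proof.
case/andP=> k0 le_k; set x := n + 2.
(* The table has cubically many cells; since [n + 2] is at least [3], a fourth power absorbs the
   constants. *)
have x3 : 3 <= x by rewrite /x; lia.
have kK : k.+1 * k.+1 <= x * x by apply: leq_mul; rewrite /x; lia.
have x2 : 9 <= x * x by apply: (leq_mul x3 x3).
have x3' : 3 * (x * x) <= x * (x * x) by rewrite leq_mul2r x3 orbT.
have x4 : 3 * (x * (x * x)) <= x ^ 4 by rewrite !expnS expn0 muln1 leq_mul2r x3 orbT.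
have nn : n * n <= x * x by apply: leq_mul; rewrite /x; lia.
have nK : n.+1 * (k.+1 * k.+1) <= x * (x * x) by apply: leq_mul => //; rewrite /x; lia.
have nx : n <= x * x by apply: leq_trans (leq_addr 2 n) _; rewrite -/x leq_pmulr //; lia.
split; [lia | | by rewrite -mulnA; lia].
have -> : n.+1 * (2 * k.+1 * k.+1) = 2 * (n.+1 * (k.+1 * k.+1)) by rewrite -mulnA mulnCA.
lia.
Qed.

(** As [k] is positive, [1], [k] and [n] are all at most [Q = k ^ 3 * n]. A guess costs at most
    [11000 * Q + 160 * m], and the preprocessing, [600 * Q + 320 * m], is charged to the guesses, of
    which there is at least one. *)
Lemma solve_time_le n k (G : sgraph 'I_n) (adj : 'I_n -> seq 'I_n) (ds : seq 'I_n) :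
  0 < k <= n -> adjacency_lists G adj ->
  solve_time k adj ds <=
  (2 ^ (size ds %/ 2) + 2 ^ (size ds - size ds %/ 2)) *
    (120 * 100 * (k ^ 3 * n + #|edges G|)).
Proof.
case/andP=> k0 le_k aG; rewrite /solve_time; set X := 2 ^ _ + 2 ^ _.
have X1 : 0 < X by rewrite addn_gt0 expn_gt0.
have dE : degree_sum adj = 160 * #|edges G|.
  by rewrite /degree_sum -big_distrr /= (sum_degrees aG) mulnA.
rewrite /guess_time -/(degree_sum adj) dE.
set m := #|edges G|; set Q := k ^ 3 * n.
have k3 : k <= k ^ 3 by rewrite -{1}(expn1 k) leq_pexp2l.
have nQ : n <= Q by rewrite leq_pmull // expn_gt0 k0.
have kQ : k <= Q by lia.
have Q1 : 1 <= Q by lia.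
pose K := k.+1; have K2 : K <= 2 * k by rewrite /K; lia.
have P8 : 2 * K * K <= 8 * (k * k) by have := leq_mul K2 K2; lia.
have kk : k * k * n <= Q by rewrite /Q leq_mul2r !expnS expn0 muln1 mulnA leq_pmulr ?orbT.
have nP : n * (2 * K * K) <= 8 * Q.
  by apply: leq_trans (leq_mul (leqnn n) P8) _; rewrite mulnCA leq_mul2l /= mulnC.
have nP1 : n.+1 * (2 * K * K) <= 16 * Q.
  by rewrite mulSn; have : 2 * K * K <= n * (2 * K * K); [rewrite leq_pmull //; lia | lia].
have nPK : n * (2 * K * K * K) <= 16 * Q.
  apply: leq_trans (leq_mul (leqnn n) (leq_mul P8 K2)) _.
  by rewrite /Q !expnS expn0 muln1; clear; nia.
have expand : n * (80 + 2 * K * K * (220 + 400 * K)) =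
    80 * n + 220 * (n * (2 * K * K)) + 400 * (n * (2 * K * K * K)) by clear; nia.
rewrite -/K expand.
have gt : 110 + 60 * n + 160 * m + n.+1 * (2 * K * K) * 140 +
    (80 * n + 220 * (n * (2 * K * K)) + 400 * (n * (2 * K * K * K))) + 60 * k + 100 * n + 60 <=
    110 * 100 * Q + 160 * m.
  move: nP nP1 nPK; move: (n * (2 * K * K)) (n.+1 * (2 * K * K)) (n * (2 * K * K * K)) => a b c.
  lia.
apply: leq_trans (leq_add (leqnn _) (leq_mul (leqnn X) gt)) _.
apply: (@leq_trans (X * (600 * Q + 320 * m) + X * (110 * 100 * Q + 160 * m))).
  rewrite leq_add2r; apply: (@leq_trans (600 * Q + 320 * m)); first by lia.
  by rewrite leq_pmull.
by rewrite -mulnDr leq_mul2l; apply/orP; right; lia.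
Qed.

Import Order.TTheory GRing.Theory Num.Theory.

Local Open Scope ring_scope.

(** Rounding half of [d] up instead of down costs at most a factor [2], whence the constant
    [1 + 2]. *)
Lemma guesses_le (R : realType) (d : nat) :
  (2 ^ (d %/ 2) + 2 ^ (d - d %/ 2))%:R <= 3 * 2 `^ (d%:R / 2) :> R.
Proof.
have le1 : (d %/ 2)%:R <= d%:R / 2 :> R.
  by rewrite ler_pdivlMr // -natrM ler_nat leq_divM.
have le2 : (d - d %/ 2)%:R <= d%:R / 2 + 1 :> R.
  rewrite -lerBlDr ler_pdivlMr // mulrBl mul1r lerBlDr -natrM -natrD ler_nat.
  by have := leq_div d 2; have := divn_eq d 2; have := ltn_pmod d (isT : (0 < 2)%N); lia.
have h1 : 2 `^ ((d %/ 2)%:R) <= 2 `^ (d%:R / 2) :> R by apply: ler_powR => //; rewrite ler1n.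
have h2 : 2 `^ ((d - d %/ 2)%:R) <= 2 `^ (d%:R / 2 + 1) :> R by apply: ler_powR => //; rewrite ler1n.
rewrite powRD ?powRr1 // in h2; last by rewrite pnatr_eq0 implybT.
rewrite natrD !natrX; rewrite !powR_mulrn // in h1 h2.
apply: le_trans (lerD h1 h2) _.
by rewrite -[X in X + _]mulr1 -mulrDr mulrC.
Qed.

Theorem theorem6 (R : realType) :
  exists (p : cmd) (c : nat) (C : R),
  forall (n k : nat) (G : sgraph 'I_n) (D : {set 'I_n})
         (adj : 'I_n -> seq 'I_n) (ds : seq 'I_n),
    verts G = [set: 'I_n] ->
    (k <= n)%N ->
    block_deletion_set G D ->
    #|D| = bd G ->
    adjacency_lists G adj ->
    perm_eq ds (enum D) ->
  exists (t : nat) (s : state) (S : {set 'I_n}),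
    [/\ exec ((n + 2) ^ c)%N p (input_state G k adj ds) s t,
        outputs s k S,
        densest_2approx G k S
      & t%:R <= C * (2 `^ ((bd G)%:R / 2)
                     * ((k%:R ^+ 3 + (bd G)%:R) * n%:R + #|edges G|%:R) + 1)].
Proof.
(* Stored values are below [(n + 2) ^ 4] and expressions have size at most [40]. The factor [3]
   comes from [guesses_le], the other one from [solve_time_le]. *)
exists solve, (4 * 40)%N, (3 * (120 * 100)%:R) => n k G D adj ds vG le_k bD cD aG dsP.
have Uds : uniq ds by rewrite (perm_uniq dsP) enum_uniq.
have sd : size ds = bd G by rewrite (perm_size dsP) -cardE.
rewrite expnM; set M := ((n + 2) ^ 4)%N.
have M2 : (2 < M)%N by rewrite /M !expnS expn0; nia.
have nM : (n * n < M)%N by rewrite /M !expnS expn0; nia.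
have B0 : bounded M (input_state G k adj ds) by apply: input_bounded.
set rhs := 2 `^ _ * _.
have rhs0 : 0 <= rhs.
  by rewrite mulr_ge0 ?powR_ge0 // addr_ge0 // mulr_ge0 // addr_ge0 // exprn_ge0.
(* For [k = 0] the empty set is optimal, and the summand [1] of the bound pays for the single
   test. *)
have [k0|k0] := posnP k.
  have : run M 40 solve (input_state G k adj ds) 10 (fun s => s = input_state G k adj ds).
    by rewrite /solve; apply: run_if => //= [/eqP|_] //; apply: run_skip.
  case=> // s [t [ex le_t _ _]]; exists t, s, set0; split=> //.
  - by rewrite /outputs k0 enum_set0.
  - split; rewrite ?sub0set ?cards0 //; rewrite /densest_opt k0.
    by apply/bigmax_leqP => U /andP[_]; rewrite cards_eq0 => /eqP ->; rewrite leq_pmull.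
  - apply: (@le_trans _ _ (10%:R)); first by rewrite ler_nat.
    rewrite mulrDr mulr1; apply: (@le_trans _ _ (3 * (120 * 100)%:R)); last by rewrite lerDr mulr_ge0 // mulr_ge0.
    by rewrite -natrM ler_nat.
have kn : (0 < k <= n)%N by rewrite k0.
have [M_ge M_tab M_val] := word_bounds kn.
have [s [t [ex le_t _ [S outS apxS]]]] := run_solve vG bD aG dsP le_k k0 M_ge M_tab M_val B0.
exists t, s, S; split=> //.
have := leq_trans le_t (solve_time_le ds kn aG); rewrite -(ler_nat R) => le_T.
apply: le_trans le_T _; rewrite natrM natrM.
apply: (@le_trans _ _ (3 * 2 `^ ((bd G)%:R / 2) * ((120 * 100)%:R * (k ^ 3 * n + #|edges G|)%:R))).
  by rewrite ler_wpM2r ?mulr_ge0 // -sd guesses_le.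
rewrite [X in X <= _](_ : _ = 3 * (120 * 100)%:R * (2 `^ ((bd G)%:R / 2) * (k ^ 3 * n + #|edges G|)%:R)).
  rewrite ler_wpM2l ?mulr_ge0 // ler_wpDr // ler_wpM2l ?powR_ge0 //.
  by rewrite natrD natrM natrX lerD2r mulrDl lerDl mulr_ge0.
by rewrite mulrACA.
Qed.
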